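(* Let $q$ be a polynomial and let $p_1,p_2,\alpha_1,\alpha_2$ be nonzero complex constants with $\alpha_1\neq\alpha_2$. Suppose $f$ is an entire function with $\rho_2(f)<1$ satisfying $$f(z)^3+q(z)\,\Delta f(z)=p_1e^{\alpha_1 z}+p_2e^{\alpha_2 z}\quad (z\in\mathbb{C}),$$ where $\Delta f(z)=f(z+1)-f(z)$. Then $q$ is a constant, and one of the following holds: (1) $f(z)=e_1e^{\alpha_1 z/3}+e_2e^{\alpha_2 z/3}$, where $e_1,e_2$ are nonzero constants with $e_1^3=p_1$, $e_2^3=p_2$ (or $e_1^3=p_2$, $e_2^3=p_1$), $3e_1e_2-2q=0$, $\alpha_1+\alpha_2=0$ and $e^{\alpha_1/3}=-1$; (2) $f(z)=c_1e^{\alpha_1 z/3}$ with $c_1^3=p_1$, $c_1\left(e^{\alpha_1/3}-1\right)q=p_2$ and $\alpha_1=3\alpha_2$; (3) $f(z)=c_2e^{\alpha_2 z/3}$ with $c_2^3=p_2$, $c_2\left(e^{\alpha_2/3}-1\right)q=p_1$ and $\alpha_2=3\alpha_1$.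
   Context: For a meromorphic function $f$ on $\mathbb{C}$ with Nevanlinna characteristic $T(r,f)$, the hyper-order is $\rho_2(f)=\limsup_{r\to\infty}\frac{\log\log T(r,f)}{\log r}$. *)

(* Defs.v *)
From Stdlib Require Import Reals.
From Coquelicot Require Import Coquelicot.
Open Scope R_scope.

Definition Cexp (z : C) : C :=
  (exp (Re z) * cos (Im z), exp (Re z) * sin (Im z)).

Definition entire (f : C -> C) : Prop :=
  forall z : C, @ex_derive C_AbsRing C_NormedModule f z.

Definition is_polynomial (q : C -> C) : Prop :=
  exists (n : nat) (a : nat -> C),
    forall z : C, q z = sum_n (fun i => mult (a i) (pow_n z i)) n.

Definition logplus (x : R) : R := Rmax 0 (ln x).

(* Nevanlinna characteristic of an entire function (no poles, so N(r,f)=0):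
   T(r,f) = m(r,f) = (1/2pi) int_0^{2pi} log^+ |f(r e^{i t})| dt *)
Definition nevanlinna_T (f : C -> C) (r : R) : R :=
  / (2 * PI) * RInt (fun t => logplus (Cmod (f (r * cos t, r * sin t)))) 0 (2 * PI).

(* hyper-order rho_2(f) = limsup_{r -> oo} log log T(r,f) / log r, as an
   extended real (Coquelicot's Rbar): the infimum of the eventual upper bounds. *)
Definition hyper_order (f : C -> C) : Rbar :=
  Glb_Rbar (fun c : R => exists R0 : R, forall r : R, R0 < r ->
     ln (ln (nevanlinna_T f r)) / ln r <= c).

Definition fdiff (f : C -> C) (z : C) : C := (f (z + 1) - f z)%C.

(* Main.v *)
Require Import Defs.
From Stdlib Require Import Reals Lra Lia Classical ClassicalEpsilon.
From Coquelicot Require Import Coquelicot.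

(** If [f] exceeds a large multiple of [W = (1 + |z|)^m (1 + |e^(a1 z / 3)| + |e^(a2 z / 3)|)] at a point, the equation gives [|f (z + 1)| >= |f z|^2], on a whole disc and again at all later steps; this makes [T (r, f)] grow like [2^r], against hyper-order below 1. So [|f| <= K W], which replaces all of Nevanlinna theory.

    If [a1 / a2] is not real, the right-hand side has simple zeros in a region where it is huge, and there the equation and its derivative contradict each other. If [a2 = t a1] with [t] real, put [E = e^(a1 z)]: where [|E|] is large, [f] is comparable to [E^(1/3)], so [f' - (a1 / 3) f] is much smaller. For [t < 0] and [0 < t <= 2/3] this leads, by Liouville's theorem, to [f = c1 E^(1/3) + c2 E^(t/3) + P] with [P] a polynomial (and [c2 = 0] if [t > 0]), and comparing exponentials finishes. For [2/3 < t < 1], [f] divides [(D - a1) (D - t a1) (q fdiff f)] with a quotient of polynomial growth, which a growth argument shows to be zero; then [q fdiff f = 0] and [f^3 = p1 E + p2 E^t], which is impossible as the right-hand side has simple zeros. *)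

(** The threshold 2/3 comes from [3 f^2 g = (t - 1) a p2 E^t - (D - a) (q fdiff f)] with
    [g = f' - (a / 3) f]: two divisions by [f], of size [E^(1/3)], leave [g] with exponential rate
    [max t (1/3) - 2/3]. This is at most 0 exactly for [t <= 2/3], and only then is Liouville's
    theorem within reach. The operator [(D - a) (D - t a)] is used beyond that because it
    annihilates both exponentials on the right-hand side. The case [t > 1] becomes [1 / t < 1] when
    the two frequencies are exchanged.

    The difference operator enters the estimates for real [t] only through the fact that [fdiff f]
    grows no faster than [f]. The comparison of [f] with [E^(1/3)] is available only where [|E|]
    beats a power of [1 + |z|]; in the remaining strip-like region of the half-plane every power of
    [E] is polynomially bounded. All growth is therefore measured up to polynomial factors. *)

(** * Complex derivatives *)

(** An increment form that mediates between two normed-module structures on [C]: [entire] is stated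
    over [C_NormedModule], while the rules for products and compositions are taken from
    [AbsRing_NormedModule C_AbsRing]. *)
Definition cderiv (f : C -> C) (z l : C) : Prop :=
  forall eps : R, 0 < eps -> exists d : R, 0 < d /\
    forall h : C, Cmod h < d -> Cmod (f (z + h) - f z - l * h)%C <= eps * Cmod h.

Lemma Cplus_sub_cancel (z w : C) : (z + (w - z) = w)%C.
Proof. ring. Qed.

Lemma Cplus_minus_l (z h : C) : (z + h - z = h)%C.
Proof. ring. Qed.

Lemma cderiv_is_derive (f : C -> C) (z l : C) :
  cderiv f z l <-> @is_derive C_AbsRing (AbsRing_NormedModule C_AbsRing) f z l.
Proof.
split.
- intros H; split; [apply is_linear_scal_l|].
  intros x Hx.
  assert (Hxz : z = x) by (apply (@is_filter_lim_locally_unique C_AbsRing (AbsRing_NormedModule C_AbsRing)); exact Hx).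
  subst x; intros eps.
  destruct (H eps (cond_pos eps)) as [d [Hd Hh]].
  exists (mkposreal d Hd); intros y Hy.
  change (Cmod (y - z)%C < d) in Hy.
  change (Cmod (f y - f z - (y - z) * l)%C <= eps * Cmod (y - z)%C).
  specialize (Hh _ Hy); rewrite Cplus_sub_cancel in Hh.
  now rewrite (Cmult_comm (y - z) l).
- intros [_ H] eps Heps.
  destruct (H z (fun P HP => HP) (mkposreal eps Heps)) as [d Hd].
  exists d; split; [apply cond_pos|]; intros h Hh.
  assert (Hb : @ball (AbsRing_UniformSpace C_AbsRing) z d (z + h)%C).
  { change (Cmod (z + h - z)%C < d). now rewrite Cplus_minus_l. }
  specialize (Hd _ Hb).
  change (Cmod (f (z + h)%C - f z - (z + h - z) * l)%C <= eps * Cmod (z + h - z)%C) in Hd.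
  rewrite Cplus_minus_l in Hd.
  now rewrite (Cmult_comm l h).
Qed.

Lemma cderiv_is_C_derive (f : C -> C) (z l : C) :
  @is_derive C_AbsRing C_NormedModule f z l -> cderiv f z l.
Proof.
intros [_ H] eps Heps.
destruct (H z (fun P HP => HP) (mkposreal eps Heps)) as [d Hd].
exists d; split; [apply cond_pos|]; intros h Hh.
assert (Hb : @ball (AbsRing_UniformSpace C_AbsRing) z d (z + h)%C).
{ change (Cmod (z + h - z)%C < d). now rewrite Cplus_minus_l. }
specialize (Hd _ Hb).
change (Cmod (f (z + h)%C - f z - (z + h - z) * l)%C <= eps * Cmod (z + h - z)%C) in Hd.
rewrite Cplus_minus_l in Hd.
now rewrite (Cmult_comm l h).
Qed.

Lemma cderiv_const (c z : C) : cderiv (fun _ => c) z 0.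
Proof.
intros eps Heps; exists 1; split; [lra|]; intros h _.
replace (c - c - 0 * h)%C with (RtoC 0) by ring.
rewrite Cmod_0; assert (H := Cmod_ge_0 h); nra.
Qed.

Lemma cderiv_id (z : C) : cderiv (fun x => x) z 1.
Proof.
intros eps Heps; exists 1; split; [lra|]; intros h _.
replace (z + h - z - 1 * h)%C with (RtoC 0) by ring.
rewrite Cmod_0; assert (H := Cmod_ge_0 h); nra.
Qed.

Lemma cderiv_plus (f g : C -> C) (z l m : C) :
  cderiv f z l -> cderiv g z m -> cderiv (fun x => f x + g x)%C z (l + m).
Proof.
rewrite !cderiv_is_derive; intros Hf Hg.
exact (@is_derive_plus C_AbsRing (AbsRing_NormedModule C_AbsRing) f g z l m Hf Hg).
Qed.

Lemma cderiv_mult (f g : C -> C) (z l m : C) :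
  cderiv f z l -> cderiv g z m -> cderiv (fun x => f x * g x)%C z (l * g z + f z * m).
Proof.
rewrite !cderiv_is_derive; intros Hf Hg.
exact (is_derive_mult (K := C_AbsRing) f g z l m Hf Hg Cmult_comm).
Qed.

Lemma cderiv_comp (f g : C -> C) (z l m : C) :
  cderiv f (g z) l -> cderiv g z m -> cderiv (fun x => f (g x)) z (m * l).
Proof.
rewrite !cderiv_is_derive; intros Hf Hg.
exact (@is_derive_comp C_AbsRing (AbsRing_NormedModule C_AbsRing) f g z l m Hf Hg).
Qed.

Lemma cderiv_ext (f g : C -> C) (z l m : C) :
  cderiv f z l -> (forall x, f x = g x) -> l = m -> cderiv g z m.
Proof.
intros H Hfg <- eps Heps; destruct (H eps Heps) as [d [Hd Hh]].
exists d; split; [exact Hd|]; intros h Hm.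
rewrite <- !Hfg; auto.
Qed.

Lemma Cmod_minus_sym (x y : C) : Cmod (x - y) = Cmod (y - x).
Proof. rewrite <- Cmod_opp; f_equal; ring. Qed.

Lemma Cmod_triangle_minus (x y : C) : Cmod (x - y) <= Cmod x + Cmod y.
Proof. unfold Cminus; rewrite <- (Cmod_opp y); apply Cmod_triangle. Qed.

Lemma Cmod_triangle_rev (x y : C) : Cmod x - Cmod y <= Cmod (x + y).
Proof.
assert (H := Cmod_triangle_minus (x + y) y).
replace (x + y - y)%C with x in H by ring; lra.
Qed.

Lemma cderiv_unique (f : C -> C) (z l m : C) : cderiv f z l -> cderiv f z m -> l = m.
Proof.
intros Hl Hm; apply Ceq_minus, NNPP; intros Hne.
assert (Hp : 0 < Cmod (l - m)) by (apply Cmod_gt_0, Hne).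
destruct (Hl (Cmod (l - m) / 4)) as [d [Hd H1]]; [lra|].
destruct (Hm (Cmod (l - m) / 4)) as [e [He H2]]; [lra|].
set (r := Rmin d e / 2).
assert (Hr : 0 < r) by (unfold r; assert (0 < Rmin d e) by (apply Rmin_glb_lt; lra); lra).
assert (Hrd : r < d) by (unfold r; assert (H := Rmin_l d e); lra).
assert (Hre : r < e) by (unfold r; assert (H := Rmin_r d e); lra).
assert (Hc : Cmod (RtoC r) = r) by (rewrite Cmod_R; apply Rabs_right; lra).
specialize (H1 (RtoC r)); specialize (H2 (RtoC r)); rewrite Hc in H1, H2.
specialize (H1 Hrd); specialize (H2 Hre).
assert (H := Cmod_triangle_minus (f (z + r)%C - f z - m * r)%C (f (z + r)%C - f z - l * r)%C).
replace (f (z + r)%C - f z - m * r - (f (z + r)%C - f z - l * r))%C with ((l - m) * r)%C in H by ring.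
rewrite Cmod_mult, Hc in H; nra.
Qed.

Definition has_deriv (f f' : C -> C) : Prop := forall z : C, cderiv f z (f' z).

Lemma entire_has_deriv (f : C -> C) : entire f -> exists f', has_deriv f f'.
Proof.
intros H; exists (C_derive f); intros z.
apply cderiv_is_C_derive, C_derive_correct; [exact z|apply H].
Qed.

Lemma has_deriv_const (c : C) : has_deriv (fun _ => c) (fun _ => RtoC 0).
Proof. intros z; apply cderiv_const. Qed.

Lemma has_deriv_id : has_deriv (fun z => z) (fun _ => RtoC 1).
Proof. intros z; apply cderiv_id. Qed.

Lemma has_deriv_plus (f g f' g' : C -> C) : has_deriv f f' -> has_deriv g g' ->
  has_deriv (fun z => f z + g z)%C (fun z => f' z + g' z)%C.
Proof. intros Hf Hg z; apply cderiv_plus; auto. Qed.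

Lemma has_deriv_mult (f g f' g' : C -> C) : has_deriv f f' -> has_deriv g g' ->
  has_deriv (fun z => f z * g z)%C (fun z => f' z * g z + f z * g' z)%C.
Proof. intros Hf Hg z; apply cderiv_mult; auto. Qed.

Lemma has_deriv_ext (f g f' g' : C -> C) : has_deriv f f' ->
  (forall z, f z = g z) -> (forall z, f' z = g' z) -> has_deriv g g'.
Proof. intros H H1 H2 z; apply (cderiv_ext f g z (f' z)); auto. Qed.

Lemma has_deriv_minus (f g f' g' : C -> C) : has_deriv f f' -> has_deriv g g' ->
  has_deriv (fun z => f z - g z)%C (fun z => f' z - g' z)%C.
Proof.
intros Hf Hg.
apply (has_deriv_ext (fun z => f z + -1 * g z)%C _ (fun z => f' z + (0 * g z + -1 * g' z))%C).
- apply has_deriv_plus; [exact Hf|]. apply (has_deriv_mult _ _ (fun _ => RtoC 0)); [apply has_deriv_const|exact Hg].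
- intros z; ring.
- intros z; ring.
Qed.

Lemma has_deriv_scal (c : C) (f f' : C -> C) : has_deriv f f' ->
  has_deriv (fun z => c * f z)%C (fun z => c * f' z)%C.
Proof.
intros Hf.
apply (has_deriv_ext (fun z => c * f z)%C _ (fun z => 0 * f z + c * f' z)%C).
- apply (has_deriv_mult (fun _ => c) _ (fun _ => RtoC 0)); [apply has_deriv_const|exact Hf].
- reflexivity.
- intros z; ring.
Qed.

Lemma has_deriv_comp (f g f' g' : C -> C) : has_deriv f f' -> has_deriv g g' ->
  has_deriv (fun z => f (g z)) (fun z => g' z * f' (g z))%C.
Proof. intros Hf Hg z; apply cderiv_comp; auto. Qed.

Lemma has_deriv_affine (b c : C) : has_deriv (fun z => c * z + b)%C (fun _ => c).
Proof.
apply (has_deriv_ext (fun z => c * z + b)%C _ (fun _ => c * 1 + 0)%C).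
- apply has_deriv_plus; [apply has_deriv_scal, has_deriv_id|apply has_deriv_const].
- reflexivity.
- intros z; ring.
Qed.

Lemma has_deriv_shift (f f' : C -> C) (c : C) : has_deriv f f' ->
  has_deriv (fun z => f (z + c)%C) (fun z => f' (z + c)%C).
Proof.
intros Hf.
apply (has_deriv_ext (fun z => f (1 * z + c)%C) _ (fun z => 1 * f' (1 * z + c))%C).
- apply (has_deriv_comp f _ f' (fun _ => RtoC 1)); [exact Hf|apply has_deriv_affine].
- intros z; f_equal; ring.
- intros z; rewrite Cmult_1_l; f_equal; ring.
Qed.

Lemma has_deriv_unique (f f1 f2 : C -> C) :
  has_deriv f f1 -> has_deriv f f2 -> forall z, f1 z = f2 z.
Proof. intros H1 H2 z; apply (cderiv_unique f z); auto. Qed.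

Lemma cderiv_cont (f : C -> C) (z l : C) (eps : R) : cderiv f z l -> 0 < eps ->
  exists d, 0 < d /\ forall w, Cmod (w - z) < d -> Cmod (f w - f z) < eps.
Proof.
intros H Heps; destruct (H 1 Rlt_0_1) as [d [Hd Hh]].
assert (Hl := Cmod_ge_0 l).
assert (Hq : 0 < eps / (2 + Cmod l)) by (apply Rdiv_lt_0_compat; lra).
exists (Rmin d (eps / (2 + Cmod l))); split; [apply Rmin_glb_lt; lra|].
intros w Hw.
assert (Hw1 := Rlt_le_trans _ _ _ Hw (Rmin_l _ _)).
assert (Hw2 := Rlt_le_trans _ _ _ Hw (Rmin_r _ _)).
specialize (Hh _ Hw1); rewrite Cplus_sub_cancel in Hh.
assert (Ht := Cmod_triangle (f w - f z - l * (w - z))%C (l * (w - z))%C).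
replace (f w - f z - l * (w - z) + l * (w - z))%C with (f w - f z)%C in Ht by ring.
rewrite Cmod_mult in Ht.
assert (Cmod (w - z) * (2 + Cmod l) < eps).
{ apply (Rmult_lt_compat_r (2 + Cmod l)) in Hw2; [|lra].
  replace (eps / (2 + Cmod l) * (2 + Cmod l)) with eps in Hw2 by (field; lra); exact Hw2. }
assert (Hwz := Cmod_ge_0 (w - z)); nra.
Qed.

(** * The exponential *)

Lemma Cexp_plus (z w : C) : Cexp (z + w) = (Cexp z * Cexp w)%C.
Proof.
unfold Cexp; destruct z as [a b], w as [c d]; simpl.
rewrite exp_plus, cos_plus, sin_plus; unfold Cmult; simpl; f_equal; ring.
Qed.

Lemma Cexp_0 : Cexp 0 = 1%C.
Proof. unfold Cexp; simpl; rewrite exp_0, cos_0, sin_0; unfold RtoC; f_equal; ring. Qed.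

Lemma Cmod_Cexp (z : C) : Cmod (Cexp z) = exp (Re z).
Proof.
unfold Cmod, Cexp; simpl fst; simpl snd.
replace ((exp (Re z) * cos (Im z)) ^ 2 + (exp (Re z) * sin (Im z)) ^ 2) with (exp (Re z) ^ 2 * (Rsqr (sin (Im z)) + Rsqr (cos (Im z)))) by (unfold Rsqr; ring).
rewrite sin2_cos2, Rmult_1_r; apply sqrt_pow2; left; apply exp_pos.
Qed.

Lemma Cexp_neq_0 (z : C) : Cexp z <> 0%C.
Proof. apply Cmod_gt_0; rewrite Cmod_Cexp; apply exp_pos. Qed.

Lemma Cexp_opp (z : C) : (Cexp z * Cexp (- z) = 1)%C.
Proof. rewrite <- Cexp_plus, <- Cexp_0; f_equal; ring. Qed.

Lemma Cmod_pair_le (x y : R) : Cmod (x, y) <= Rabs x + Rabs y.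
Proof.
replace (x, y) with (RtoC x + Ci * RtoC y)%C by (unfold Ci, RtoC, Cplus, Cmult; simpl; f_equal; ring).
apply (Rle_trans _ _ _ (Cmod_triangle _ _)).
rewrite Cmod_mult, !Cmod_R, Cmod_Ci; lra.
Qed.

Lemma im_le_Cmod (z : C) : Rabs (Im z) <= Cmod z.
Proof. exact (Rle_trans _ _ _ (Rmax_r _ _) (Rmax_Cmod z)). Qed.

(** The inequality [1 + u <= exp u] at [u = x] and at [u = - x] squeezes [exp x] between [1 + x] and
    [1 / (1 - x)]. *)
Lemma exp_taylor1 (x : R) : Rabs x <= 1 / 2 -> Rabs (exp x - 1 - x) <= 2 * x ^ 2.
Proof.
intros Hx; apply Rabs_le_between in Hx.
assert (H1 : 1 + x <= exp x) by (destruct (Req_dec x 0) as [->|Hn]; [rewrite exp_0; lra|left; apply exp_ineq1; exact Hn]).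
assert (H2 : 1 - x <= exp (- x)) by (destruct (Req_dec x 0) as [->|Hn]; [rewrite Ropp_0, exp_0; lra|assert (H := exp_ineq1 (- x)); lra]).
rewrite exp_Ropp in H2.
assert (He := exp_pos x).
assert (H3 : exp x * (1 - x) <= 1).
{ apply (Rmult_le_compat_l (exp x)) in H2; [|lra]. rewrite Rinv_r in H2; lra. }
apply Rabs_le_between; split; nra.
Qed.

(** From [1 - cos y = 2 sin (y / 2)^2] and [|sin u| <= |u|]. *)
Lemma cos_taylor0 (y : R) : Rabs (cos y - 1) <= y ^ 2.
Proof.
assert (H : 1 - cos y = 2 * Rsqr (sin (y / 2))).
{ replace y with (2 * (y / 2)) at 1 by field; rewrite cos_2a_sin; unfold Rsqr; ring. }
assert (Hs : Rabs (sin (y / 2)) <= Rabs (y / 2)).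
{ destruct (MVT_gen sin 0 (y / 2) cos) as [c [_ Hc]].
  - intros; apply is_derive_Reals, derivable_pt_lim_sin.
  - intros; apply continuity_sin.
  - rewrite sin_0, !Rminus_0_r in Hc; rewrite Hc, Rabs_mult.
    assert (Rabs (cos c) <= 1) by (apply Rabs_le_between, COS_bound).
    assert (Hy0 := Rabs_pos (y / 2)); nra. }
apply Rsqr_le_abs_1 in Hs.
rewrite Rabs_minus_sym, Rabs_right; unfold Rsqr in *; nra.
Qed.

Lemma sin_taylor1 (y : R) : Rabs y <= 1 -> Rabs (sin y - y) <= y ^ 2.
Proof.
intros Hy.
destruct (MVT_gen (fun x => sin x - x) 0 y (fun x => cos x - 1)) as [c [Hc1 Hc]].
- intros; auto_derive; [exact I|ring].
- intros; apply continuity_pt_minus; [apply continuity_sin|apply continuity_pt_id].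
- rewrite sin_0, !Rminus_0_r in Hc; rewrite Hc, Rabs_mult.
  assert (Hcy : Rabs c <= Rabs y).
  { revert Hc1; unfold Rmin, Rmax; destruct (Rle_dec 0 y); intros Hc1;
      unfold Rabs; destruct (Rcase_abs c), (Rcase_abs y); lra. }
  assert (H := cos_taylor0 c).
  rewrite <- (pow2_abs c) in H; rewrite <- (pow2_abs y).
  assert (H0 := Rabs_pos y); assert (H1 := Rabs_pos c).
  assert (Rabs c ^ 2 <= Rabs y) by nra; nra.
Qed.

(** The quadratic remainder that yields the derivative of [Cexp]. The constant is 4 + 6, the bounds
    for the real and the imaginary part. *)
Lemma Cexp_taylor1 (h : C) : Cmod h <= 1 / 2 -> Cmod (Cexp h - 1 - h) <= 10 * Cmod h ^ 2.
Proof.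
destruct h as [x y]; intros Hh.
assert (Hx := re_le_Cmod (x, y)); assert (Hy := im_le_Cmod (x, y)); simpl in Hx, Hy.
set (r := Cmod (x, y)) in *.
assert (H1 := exp_taylor1 x ltac:(lra)); assert (H2 := cos_taylor0 y).
assert (H3 := sin_taylor1 y ltac:(lra)).
rewrite <- (pow2_abs x) in H1; rewrite <- (pow2_abs y) in H2, H3.
assert (Hx0 := Rabs_pos x); assert (Hy0 := Rabs_pos y).
assert (Rabs x ^ 2 <= r ^ 2) by nra.
assert (Rabs y ^ 2 <= r ^ 2) by nra.
assert (Rabs x * Rabs y <= r ^ 2) by nra.
assert (He : Rabs (exp x - 1) <= 2 * Rabs x).
{ assert (Ht := Rabs_triang (exp x - 1 - x) x); replace (exp x - 1 - x + x) with (exp x - 1) in Ht by ring; nra. }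
assert (He2 : exp x <= 2).
{ apply Rabs_le_between in He; lra. }
assert (He3 := exp_pos x).
replace (Cexp (x, y) - 1 - (x, y))%C with
  ((exp x * (cos y - 1) + (exp x - 1 - x))%R, ((exp x - 1) * sin y + (sin y - y))%R)
  by (unfold Cexp, RtoC, Cminus, Cplus, Copp; simpl; f_equal; ring).
apply (Rle_trans _ _ _ (Cmod_pair_le _ _)).
assert (Ha : Rabs (exp x * (cos y - 1) + (exp x - 1 - x)) <= 4 * r ^ 2).
{ apply (Rle_trans _ _ _ (Rabs_triang _ _)); rewrite Rabs_mult, (Rabs_right (exp x)); [nra|lra]. }
assert (Hs : Rabs (sin y) <= 2 * Rabs y).
{ assert (Ht := Rabs_triang (sin y - y) y); replace (sin y - y + y) with (sin y) in Ht by ring; nra. }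
assert (Hb : Rabs ((exp x - 1) * sin y + (sin y - y)) <= 6 * r ^ 2).
{ apply (Rle_trans _ _ _ (Rabs_triang _ _)); rewrite Rabs_mult.
  assert (Rabs (exp x - 1) * Rabs (sin y) <= (2 * Rabs x) * (2 * Rabs y)) by (apply Rmult_le_compat; auto; apply Rabs_pos).
  nra. }
lra.
Qed.

Lemma has_deriv_Cexp : has_deriv Cexp Cexp.
Proof.
intros z eps Heps.
assert (He : 0 < exp (Re z)) by apply exp_pos.
assert (Hq : 0 < eps / (10 * exp (Re z))) by (apply Rdiv_lt_0_compat; lra).
exists (Rmin (1 / 2) (eps / (10 * exp (Re z)))); split; [apply Rmin_glb_lt; lra|].
intros h Hh.
assert (Hh1 := Rlt_le_trans _ _ _ Hh (Rmin_l _ _)).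
assert (Hh2 := Rlt_le_trans _ _ _ Hh (Rmin_r _ _)).
replace (Cexp (z + h) - Cexp z - Cexp z * h)%C with (Cexp z * (Cexp h - 1 - h))%C by (rewrite Cexp_plus; ring).
rewrite Cmod_mult, Cmod_Cexp.
assert (Ht := Cexp_taylor1 h ltac:(lra)).
assert (H0 := Cmod_ge_0 h).
apply (Rmult_lt_compat_r (10 * exp (Re z))) in Hh2; [|lra].
replace (eps / (10 * exp (Re z)) * (10 * exp (Re z))) with eps in Hh2 by (field; lra).
apply Rle_trans with (exp (Re z) * (10 * Cmod h ^ 2)); [apply Rmult_le_compat_l; lra|].
nra.
Qed.

Lemma has_deriv_exp (c : C) : has_deriv (fun z => Cexp (c * z)) (fun z => c * Cexp (c * z))%C.
Proof.
apply (has_deriv_ext (fun z => Cexp (c * z + 0)) _ (fun z => c * Cexp (c * z + 0))%C).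
- apply (has_deriv_comp Cexp _ Cexp (fun _ => c)); [apply has_deriv_Cexp|apply has_deriv_affine].
- intros z; f_equal; ring.
- intros z; do 2 f_equal; ring.
Qed.

(** The arc cosine of [x / r] gives the angle in the upper half-plane, and its reflection
    [2 * PI - acos] the one in the lower. The range of [t] is the interval of integration in
    [nevanlinna_T]. *)
Lemma polar (z : C) : exists t : R, 0 <= t <= 2 * PI /\ z = (Cmod z * cos t, Cmod z * sin t)%R.
Proof.
assert (Hpi := PI_RGT_0).
destruct (Req_dec (Cmod z) 0) as [H0|H0].
- exists 0; split; [lra|]; rewrite H0, !Rmult_0_l; exact (Cmod_eq_0 z H0).
- destruct z as [x y]; set (r := Cmod (x, y)) in *.
  assert (Hr : 0 < r) by (assert (H := Cmod_ge_0 (x, y)); fold r in H; lra).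
  assert (Hr2 : r ^ 2 = x ^ 2 + y ^ 2) by (unfold r; rewrite Cmod2_alt; reflexivity).
  assert (Hx : Rabs x <= r) by exact (re_le_Cmod (x, y)).
  apply Rabs_le_between in Hx.
  assert (Hb : -1 <= x / r <= 1) by (split; apply Rmult_le_reg_r with r; unfold Rdiv; rewrite ?Rmult_assoc, ?Rinv_l; lra).
  assert (Hc := cos_acos _ Hb); assert (Ha := acos_bound (x / r)).
  assert (Hs : 0 <= sin (acos (x / r))) by (apply sin_ge_0; lra).
  assert (Hs2 := sin2_cos2 (acos (x / r))); rewrite Hc in Hs2; unfold Rsqr in Hs2.
  set (s := sin (acos (x / r))) in *.
  assert (Hrs : (r * s) * (r * s) = y * y).
  { replace (r * s * (r * s)) with (r ^ 2 * (s * s)) by ring.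
    replace (s * s) with (1 - x / r * (x / r)) by lra. 
    replace (r ^ 2 * (1 - x / r * (x / r))) with (r ^ 2 - x ^ 2) by (field; lra). lra. }
  destruct (Rle_dec 0 y) as [Hy|Hy].
  + exists (acos (x / r)); split; [lra|]; rewrite Hc; fold s; f_equal; [field; lra|].
    symmetry; apply Rsqr_inj; [nra|exact Hy|exact Hrs].
  + exists (2 * PI - acos (x / r)); split; [lra|].
    replace (2 * PI - acos (x / r)) with (- acos (x / r) + 2 * INR 1 * PI) by (simpl; ring).
    rewrite cos_period, sin_period, cos_neg, sin_neg, Hc; fold s; f_equal; [field; lra|].
    assert (r * s = - y) by (apply Rsqr_inj; [nra|lra|unfold Rsqr; lra]); lra.
Qed.

Lemma Cexp_surj (w : C) : w <> 0%C -> exists z, Cexp z = w.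
Proof.
intros Hw; apply Cmod_gt_0 in Hw.
destruct (polar w) as [t [_ Ht]].
exists (ln (Cmod w), t); unfold Cexp; simpl; rewrite exp_ln by exact Hw; symmetry; exact Ht.
Qed.

Lemma Cexp_2PI (n : nat) : Cexp (0, 2 * INR n * PI) = 1%C.
Proof.
unfold Cexp; simpl.
rewrite exp_0; replace (2 * INR n * PI) with (0 + 2 * INR n * PI) by ring.
rewrite cos_period, sin_period, cos_0, sin_0; unfold RtoC; f_equal; ring.
Qed.

(** * Integrals of complex functions along segments *)

(** Distances are measured by [Cmod], as in [cderiv]; [rcont_continuous] passes to the uniform
    structure in which [RInt] works. *)
Definition rcont (g : R -> C) : Prop := forall t eps : R, 0 < eps ->
  exists d, 0 < d /\ forall s, Rabs (s - t) < d -> Cmod (g s - g t) < eps.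

Definition ccont (f : C -> C) : Prop := forall (z : C) (eps : R), 0 < eps ->
  exists d, 0 < d /\ forall w, Cmod (w - z) < d -> Cmod (f w - f z) < eps.

Definition Cint (g : R -> C) (a b : R) : C := @RInt C_R_CompleteNormedModule g a b.

Lemma has_deriv_ccont (f f' : C -> C) : has_deriv f f' -> ccont f.
Proof. intros H z eps; apply (cderiv_cont f z (f' z)), H. Qed.

Lemma rcont_comp (f : C -> C) (g : R -> C) : ccont f -> rcont g -> rcont (fun t => f (g t)).
Proof.
intros Hf Hg t eps Heps; destruct (Hf (g t) eps Heps) as [d [Hd H1]].
destruct (Hg t d Hd) as [e [He H2]]; exists e; auto.
Qed.

Lemma rcont_lip (g : R -> C) : (forall s t, Cmod (g s - g t) <= Rabs (s - t)) -> rcont g.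
Proof.
intros H t eps Heps; exists eps; split; [exact Heps|]; intros s Hs.
exact (Rle_lt_trans _ _ _ (H s t) Hs).
Qed.

Lemma rcont_mult (f g : R -> C) : rcont f -> rcont g -> rcont (fun t => f t * g t)%C.
Proof.
intros Hf Hg t eps Heps.
assert (Hf0 := Cmod_ge_0 (f t)); assert (Hg0 := Cmod_ge_0 (g t)).
set (M := 1 + Cmod (f t) + Cmod (g t)).
assert (HM : 0 < M) by (unfold M; lra).
assert (He : 0 < Rmin 1 (eps / (2 * M))) by (apply Rmin_glb_lt; [lra|apply Rdiv_lt_0_compat; lra]).
set (e := Rmin 1 (eps / (2 * M))) in *.
assert (He1 : e <= 1) by apply Rmin_l.
assert (HeM : e * (2 * M) <= eps).
{ assert (H : e <= eps / (2 * M)) by apply Rmin_r.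
  apply (Rmult_le_compat_r (2 * M)) in H; [|lra].
  replace (eps / (2 * M) * (2 * M)) with eps in H by (field; lra); exact H. }
destruct (Hf t e He) as [d1 [Hd1 H1]]; destruct (Hg t e He) as [d2 [Hd2 H2]].
exists (Rmin d1 d2); split; [apply Rmin_glb_lt; lra|]; intros s Hs.
specialize (H1 s (Rlt_le_trans _ _ _ Hs (Rmin_l _ _))).
specialize (H2 s (Rlt_le_trans _ _ _ Hs (Rmin_r _ _))).
replace (f s * g s - f t * g t)%C with ((f s - f t) * g t + (f t * (g s - g t) + (f s - f t) * (g s - g t)))%C by ring.
assert (Ht1 := Cmod_triangle ((f s - f t) * g t)%C (f t * (g s - g t) + (f s - f t) * (g s - g t))%C).
assert (Ht2 := Cmod_triangle (f t * (g s - g t))%C ((f s - f t) * (g s - g t))%C).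
rewrite !Cmod_mult in *.
assert (Hp1 := Cmod_ge_0 (f s - f t)); assert (Hp2 := Cmod_ge_0 (g s - g t)).
unfold M in *; nra.
Qed.

Lemma rcont_const (k : C) : rcont (fun _ => k).
Proof.
apply rcont_lip; intros s t; replace (k - k)%C with (RtoC 0) by ring.
rewrite Cmod_0; apply Rabs_pos.
Qed.

Lemma rcont_plus (f g : R -> C) : rcont f -> rcont g -> rcont (fun t => f t + g t)%C.
Proof.
intros Hf Hg t e He.
destruct (Hf t (e / 2) ltac:(lra)) as [d1 [Hd1 K1]]; destruct (Hg t (e / 2) ltac:(lra)) as [d2 [Hd2 K2]].
exists (Rmin d1 d2); split; [apply Rmin_glb_lt; lra|]; intros s Hs.
specialize (K1 s (Rlt_le_trans _ _ _ Hs (Rmin_l _ _))).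
specialize (K2 s (Rlt_le_trans _ _ _ Hs (Rmin_r _ _))).
replace (f s + g s - (f t + g t))%C with ((f s - f t) + (g s - g t))%C by ring.
assert (T := Cmod_triangle (f s - f t) (g s - g t)); lra.
Qed.

Lemma rcont_ext (f g : R -> C) : (forall t, f t = g t) -> rcont f -> rcont g.
Proof.
intros E Hf t e He; destruct (Hf t e He) as [d [Hd H]]; exists d; split; [exact Hd|].
intros s Hs; rewrite <- !E; auto.
Qed.

Lemma rcont_minus (f g : R -> C) : rcont f -> rcont g -> rcont (fun t => f t - g t)%C.
Proof.
intros Hf Hg; apply (rcont_ext (fun t => f t + (-1) * g t)%C); [intros t; ring|].
apply rcont_plus; [exact Hf|]; apply rcont_mult; [apply rcont_const|exact Hg].
Qed.

Lemma rcont_continuous (g : R -> C) (t : R) : rcont g -> @continuous R_UniformSpace C_R_CompleteNormedModule g t.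
Proof.
intros H; apply filterlim_locally; intros eps.
destruct (H t eps (cond_pos eps)) as [d [Hd Hh]].
exists (mkposreal d Hd); intros s Hs.
apply C_NormedModule_mixin_compat1, Hh; exact Hs.
Qed.

Lemma Cint_correct (g : R -> C) (a b : R) : rcont g -> @is_RInt C_R_CompleteNormedModule g a b (Cint g a b).
Proof.
intros H; apply (RInt_correct (V := C_R_CompleteNormedModule)), ex_RInt_continuous.
intros; apply rcont_continuous, H.
Qed.

Lemma norm_C_R (z : C) : @norm R_AbsRing C_R_NormedModule z = Cmod z.
Proof.
unfold Cmod, norm; simpl; unfold prod_norm.
f_equal; f_equal; apply pow2_abs.
Qed.

Lemma Cint_norm_le (g : R -> C) (a b M : R) : rcont g -> a <= b ->
  (forall t, a <= t <= b -> Cmod (g t) <= M) -> Cmod (Cint g a b) <= (b - a) * M.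
Proof.
intros Hg Hab HM; rewrite <- norm_C_R.
apply (norm_RInt_le_const (V := C_R_NormedModule) g a b _ M Hab).
- intros t Ht; rewrite norm_C_R; auto.
- apply (Cint_correct g a b Hg).
Qed.

Lemma Cint_unique (g : R -> C) (a b : R) (l : C) :
  @is_RInt C_R_CompleteNormedModule g a b l -> Cint g a b = l.
Proof. apply (is_RInt_unique (V := C_R_CompleteNormedModule)). Qed.

Lemma Cint_minus (f g : R -> C) (a b : R) : rcont f -> rcont g ->
  Cint (fun t => f t - g t)%C a b = (Cint f a b - Cint g a b)%C.
Proof.
intros Hf Hg; apply Cint_unique.
apply (is_RInt_minus (V := C_R_NormedModule) f g); apply Cint_correct; assumption.
Qed.

Lemma Cint_const (c : C) (a b : R) : Cint (fun _ => c) a b = (RtoC (b - a) * c)%C.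
Proof.
apply Cint_unique; rewrite <- scal_R_Cmult.
apply (is_RInt_const (V := C_R_NormedModule)).
Qed.

Lemma Cint_ext (f g : R -> C) (a b : R) : (forall t, f t = g t) -> Cint f a b = Cint g a b.
Proof. intros H; apply (RInt_ext (V := C_R_CompleteNormedModule)); intros; apply H. Qed.

Lemma Cint_Chasles (g : R -> C) (a b c : R) : rcont g -> (Cint g a b + Cint g b c = Cint g a c)%C.
Proof.
intros Hg; apply (RInt_Chasles (V := C_R_CompleteNormedModule)); apply ex_RInt_continuous;
  intros; apply rcont_continuous, Hg.
Qed.

(** [Cint] is an integral in a real vector space, so its rules give real linearity; a complex factor
    is treated through real and imaginary parts. *)
Lemma Cint_scal (c : C) (g : R -> C) (a b : R) : rcont g ->
  Cint (fun t => c * g t)%C a b = (c * Cint g a b)%C.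
Proof.
intros Hg; apply Cint_unique.
assert (H := Cint_correct g a b Hg).
assert (H1 := is_RInt_fct_extend_fst (U := R_NormedModule) (V := R_NormedModule) g a b _ H).
assert (H2 := is_RInt_fct_extend_snd (U := R_NormedModule) (V := R_NormedModule) g a b _ H).
apply (is_RInt_fct_extend_pair (U := R_NormedModule) (V := R_NormedModule)).
- apply (is_RInt_minus (V := R_NormedModule) (fun t => fst c * fst (g t)) (fun t => snd c * snd (g t)));
    apply (is_RInt_scal (V := R_NormedModule)); assumption.
- apply (is_RInt_plus (V := R_NormedModule) (fun t => fst c * snd (g t)) (fun t => snd c * fst (g t)));
    apply (is_RInt_scal (V := R_NormedModule)); assumption.
Qed.

(** * Bisection and Goursat's lemma *)

(* If [P] failed on a rectangle, it would fail on a nested sequence of quarters, hence on small rectangles around their common point. *)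
Lemma rect_induction (P : R -> R -> R -> R -> Prop) :
  (forall x y l m, P x y (l / 2) (m / 2) -> P (x + l / 2) y (l / 2) (m / 2) ->
     P x (y + m / 2) (l / 2) (m / 2) -> P (x + l / 2) (y + m / 2) (l / 2) (m / 2) -> P x y l m) ->
  (forall a b, exists d, 0 < d /\ forall x y l m, x <= a <= x + l -> y <= b <= y + m ->
     l < d -> m < d -> P x y l m) ->
  forall x y l m, 0 <= l -> 0 <= m -> P x y l m.
Proof.
intros Hsub Hloc x0 y0 l m Hl Hm; apply NNPP; intros Hbad.
set (Q n (p : R * R) := ~ P (fst p) (snd p) (l / 2 ^ n) (m / 2 ^ n)).
(* The hypothesis [Q n p] stands below the existential quantifier so that the choice function [F] is
   total. *)
assert (Hstep : forall n p, exists p', Q n p -> Q (S n) p' /\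
  fst p <= fst p' <= fst p + l / 2 ^ S n /\ snd p <= snd p' <= snd p + m / 2 ^ S n).
{ intros n [x y]; destruct (classic (Q n (x, y))) as [HQ|HQ]; [|exists (x, y); tauto].
  apply NNPP; intros Hno; apply HQ; simpl.
  assert (E2 : forall c, c / 2 ^ S n = c / 2 ^ n / 2).
  { intros c; simpl; field; apply pow_nonzero; lra. }
  assert (Hp : 0 < / 2 ^ S n) by (apply Rinv_0_lt_compat, pow_lt; lra).
  assert (Hl1 : 0 <= l / 2 ^ S n) by (unfold Rdiv; nra).
  assert (Hm1 : 0 <= m / 2 ^ S n) by (unfold Rdiv; nra).
  assert (Hq : forall p', fst (x, y) <= fst p' <= fst (x, y) + l / 2 ^ S n ->
    snd (x, y) <= snd p' <= snd (x, y) + m / 2 ^ S n -> P (fst p') (snd p') (l / 2 ^ n / 2) (m / 2 ^ n / 2)).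
  { intros p' H1 H2; rewrite <- !E2; apply NNPP; intros HP; apply Hno; exists p'; intros _; auto. }
  simpl fst in Hq; simpl snd in Hq; rewrite !E2 in *.
  apply Hsub.
  - apply (Hq (x, y)); simpl; lra.
  - apply (Hq (x + l / 2 ^ n / 2, y)); simpl; lra.
  - apply (Hq (x, y + m / 2 ^ n / 2)); simpl; lra.
  - apply (Hq (x + l / 2 ^ n / 2, y + m / 2 ^ n / 2)); simpl; lra. }
set (F n p := proj1_sig (constructive_indefinite_description _ (Hstep n p))).
assert (HF : forall n p, Q n p -> Q (S n) (F n p) /\ fst p <= fst (F n p) <= fst p + l / 2 ^ S n /\
  snd p <= snd (F n p) <= snd p + m / 2 ^ S n).
{ intros n p; unfold F; destruct (constructive_indefinite_description _ (Hstep n p)) as [p' Hp']; exact Hp'. }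
set (u := fix u n := match n with O => (x0, y0) | S k => F k (u k) end).
assert (HQ : forall n, Q n (u n)).
{ induction n as [|n IH]; simpl.
  - unfold Q; simpl; rewrite !Rdiv_1_r; exact Hbad.
  - exact (proj1 (HF n (u n) IH)). }
assert (Hinc : forall n, fst (u n) <= fst (u (S n)) <= fst (u n) + l / 2 ^ S n /\
   snd (u n) <= snd (u (S n)) <= snd (u n) + m / 2 ^ S n).
{ intros n; exact (proj2 (HF n (u n) (HQ n))). }
(* Nested intervals: the left ends [v n] increase, the right ends [v n + c / 2 ^ n] decrease, and
   the supremum of the left ends lies in all of them. *)
assert (Hlim : forall (v : nat -> R) c, 0 <= c -> (forall n, v n <= v (S n) <= v n + c / 2 ^ S n) ->
  exists a, forall n, v n <= a <= v n + c / 2 ^ n).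
{ intros v c Hc Hv.
  assert (Hdec : forall n k, v (n + k)%nat + c / 2 ^ (n + k) <= v n + c / 2 ^ n).
  { intros n; induction k as [|k IH]; [rewrite Nat.add_0_r; lra|].
    rewrite Nat.add_succ_r; destruct (Hv (n + k)%nat) as [_ H].
    assert (E : c / 2 ^ (n + k) = 2 * (c / 2 ^ S (n + k))).
    { simpl; field; apply pow_nonzero; lra. }
    lra. }
  assert (Hmono : forall n k, v n <= v (n + k)%nat).
  { intros n; induction k as [|k IH]; [rewrite Nat.add_0_r; lra|].
    rewrite Nat.add_succ_r; destruct (Hv (n + k)%nat); lra. }
  assert (Hc0 : forall n, 0 <= c / 2 ^ n).
  { intros n; unfold Rdiv; assert (0 < / 2 ^ n) by (apply Rinv_0_lt_compat, pow_lt; lra); nra. }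
  destruct (completeness (fun r => exists n, r = v n)) as [a [Ha1 Ha2]].
  - exists (v O + c / 2 ^ 0); intros r [n ->].
    specialize (Hdec O n); specialize (Hc0 n); rewrite Nat.add_0_l in Hdec; lra.
  - exists (v O); exists O; reflexivity.
  - exists a; intros n; split; [apply Ha1; exists n; reflexivity|].
    apply Ha2; intros r [k ->].
    destruct (Nat.le_ge_cases k n) as [Hk|Hk].
    + specialize (Hmono k (n - k)%nat); replace (k + (n - k))%nat with n in Hmono by lia.
      specialize (Hc0 n); lra.
    + specialize (Hdec n (k - n)%nat); replace (n + (k - n))%nat with k in Hdec by lia.
      specialize (Hc0 k); lra. }
destruct (Hlim (fun n => fst (u n)) l Hl) as [a Ha]; [intros n; apply Hinc|].
destruct (Hlim (fun n => snd (u n)) m Hm) as [b Hb]; [intros n; apply Hinc|].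
destruct (Hloc a b) as [d [Hd Hsm]].
destruct (pow_lt_1_zero (/ 2) ltac:(rewrite Rabs_right; lra) (d / (1 + l + m))) as [N HN].
{ apply Rdiv_lt_0_compat; lra. }
specialize (HN N (le_n _)).
rewrite Rabs_right in HN by (apply Rle_ge, pow_le; lra).
assert (HN2 : / 2 ^ N * (1 + l + m) < d).
{ rewrite <- pow_inv. apply (Rmult_lt_compat_r (1 + l + m)) in HN; [|lra].
  replace (d / (1 + l + m) * (1 + l + m)) with d in HN by (field; lra); exact HN. }
assert (Hp : 0 < / 2 ^ N) by (apply Rinv_0_lt_compat, pow_lt; lra).
apply (HQ N), Hsm; [apply Ha|apply Hb| |]; unfold Rdiv; nra.
Qed.

Lemma rcont_hor (y : R) : rcont (fun u => (u, y)).
Proof.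
apply rcont_lip; intros s t.
replace ((s, y) - (t, y))%C with (RtoC (s - t)) by (unfold RtoC, Cminus, Cplus, Copp; simpl; f_equal; ring).
rewrite Cmod_R; apply Rle_refl.
Qed.

Lemma rcont_ver (x : R) : rcont (fun v => (x, v)).
Proof.
apply rcont_lip; intros s t.
replace ((x, s) - (x, t))%C with (Ci * RtoC (s - t))%C by (unfold Ci, RtoC, Cmult, Cminus, Cplus, Copp; simpl; f_equal; ring).
rewrite Cmod_mult, Cmod_Ci, Cmod_R; lra.
Qed.

(** The contour integral of [G] counterclockwise around the rectangle with lower left corner
    [(x, y)] and sides [l], [m]. *)
Definition rect_int (G : C -> C) (x y l m : R) : C :=
  (Cint (fun u => G (u, y)) x (x + l) - Cint (fun u => G (u, y + m)%R) x (x + l)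
   + Ci * (Cint (fun v => G (x + l, v)%R) y (y + m) - Cint (fun v => G (x, v)) y (y + m)))%C.

Lemma rect_int_split (G : C -> C) (x y l m : R) : ccont G ->
  rect_int G x y l m =
  (rect_int G x y (l / 2) (m / 2) + rect_int G (x + l / 2) y (l / 2) (m / 2)
   + (rect_int G x (y + m / 2) (l / 2) (m / 2)
      + rect_int G (x + l / 2) (y + m / 2) (l / 2) (m / 2)))%C.
Proof.
intros HG; unfold rect_int.
replace (x + l / 2 + l / 2) with (x + l) by field.
replace (y + m / 2 + m / 2) with (y + m) by field.
assert (Hh : forall w, rcont (fun u => G (u, w))) by (intros w; apply rcont_comp; [exact HG|apply rcont_hor]).
assert (Hv : forall w, rcont (fun u => G (w, u))) by (intros w; apply rcont_comp; [exact HG|apply rcont_ver]).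
rewrite <- !(Cint_Chasles _ x (x + l / 2) (x + l) (Hh _)).
rewrite <- !(Cint_Chasles _ y (y + m / 2) (y + m) (Hv _)).
ring.
Qed.

(** The bound [2 * eps * (l + m) ^ 2] reproduces itself under bisection, since the four quarters
    each have a quarter of it. Near a point, [G] differs from its affine approximation by [eps]
    times the distance, and the affine part integrates to 0 around a rectangle. *)
Lemma goursat (G G' : C -> C) (x y l m : R) : has_deriv G G' -> 0 <= l -> 0 <= m ->
  rect_int G x y l m = 0%C.
Proof.
intros HG Hl Hm.
assert (HGc := has_deriv_ccont _ _ HG).
apply Cmod_eq_0, Rle_antisym; [|apply Cmod_ge_0].
apply le_epsilon; intros e0 He0.
set (eps := e0 / (2 * (1 + l + m) ^ 2)).
assert (Hlm : 0 < (1 + l + m) ^ 2) by (apply pow_lt; lra).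
assert (Heps : 0 < eps) by (apply Rdiv_lt_0_compat; lra).
assert (Hmain : Cmod (rect_int G x y l m) <= 2 * eps * (l + m) ^ 2).
{ apply (rect_induction (fun x y l m => Cmod (rect_int G x y l m) <= 2 * eps * (l + m) ^ 2)); [| |exact Hl|exact Hm].
  - clearbody eps; clear - HGc; intros x y l m H1 H2 H3 H4; rewrite rect_int_split by exact HGc.
    set (A := rect_int G x y _ _) in *; set (B := rect_int G (x + _) y _ _) in *.
    set (D := rect_int G x (y + _) _ _) in *; set (E := rect_int G (x + _) (y + _) _ _) in *.
    assert (T1 := Cmod_triangle (A + B)%C (D + E)%C); assert (T2 := Cmod_triangle A B); assert (T3 := Cmod_triangle D E).
    replace (l + m) with (2 * (l / 2 + m / 2)) by field; lra.
  - clearbody eps; clear - HG HGc Heps; intros a b.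
    destruct (HG (a, b) eps Heps) as [d [Hd Hh]].
    exists (d / 2); split; [lra|]; intros x y l m Ha Hb Hld Hmd.
    assert (Hl : 0 <= l) by lra; assert (Hm : 0 <= m) by lra.
    set (c := (a, b) : C) in *; set (q := G' c) in *.
    set (err := fun w : C => (G w - G c - q * (w - c))%C).
    assert (Herr : forall u v, x <= u <= x + l -> y <= v <= y + m -> Cmod (err (u, v)) <= eps * (l + m)).
    { intros u v Hu Hv.
      assert (Hs : Cmod ((u, v) - c) <= l + m).
      { unfold c, Cminus, Cplus, Copp; simpl; apply (Rle_trans _ _ _ (Cmod_pair_le _ _)).
        apply Rplus_le_compat; apply Rabs_le_between; lra. }
      assert (H := Hh ((u, v) - c)%C ltac:(lra)); rewrite Cplus_sub_cancel in H.
      unfold err; nra. }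
    assert (Hh' : forall w, rcont (fun u => G (u, w))) by (intros w; apply rcont_comp; [exact HGc|apply rcont_hor]).
    assert (Hv' : forall w, rcont (fun u => G (w, u))) by (intros w; apply rcont_comp; [exact HGc|apply rcont_ver]).
    (* Opposite sides are paired. The affine part of [G] differs by [- i q m] between bottom and top
       and by [q l] between right and left; these two constants cancel in the contour integral. *)
    set (A := Cint (fun u => G (u, y) - G (u, y + m)%R - (- (Ci * q * m)))%C x (x + l)).
    set (B := Cint (fun v => G (x + l, v)%R - G (x, v) - q * l)%C y (y + m)).
    assert (HJ : rect_int G x y l m = (A + Ci * B)%C).
    { unfold A, B, rect_int; rewrite !Cint_minus by auto using rcont_minus, rcont_const; rewrite !Cint_const.
      replace (x + l - x) with l by ring; replace (y + m - y) with m by ring; ring. }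
    rewrite HJ; clear HJ.
    assert (HA : Cmod A <= (x + l - x) * (2 * (eps * (l + m)))).
    { apply Cint_norm_le; [auto using rcont_minus, rcont_const|lra|]; intros u Hu.
      replace (G (u, y) - G (u, y + m)%R - (- (Ci * q * m)))%C with (err (u, y) - err (u, y + m)%R)%C.
      - assert (T := Cmod_triangle_minus (err (u, y)) (err (u, y + m)%R)).
        assert (K1 := Herr u y Hu ltac:(lra)); assert (K2 := Herr u (y + m) Hu ltac:(lra)); lra.
      - unfold err; replace ((u, y + m)%R : C) with ((u, y) + Ci * m)%C by (unfold Ci, RtoC, Cmult, Cplus; simpl; f_equal; ring).
        ring. }
    assert (HB : Cmod B <= (y + m - y) * (2 * (eps * (l + m)))).
    { apply Cint_norm_le; [auto using rcont_minus, rcont_const|lra|]; intros v Hv.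
      replace (G (x + l, v)%R - G (x, v) - q * l)%C with (err (x + l, v)%R - err (x, v))%C.
      - assert (T := Cmod_triangle_minus (err (x + l, v)%R) (err (x, v))).
        assert (K1 := Herr x v ltac:(lra) Hv); assert (K2 := Herr (x + l) v ltac:(lra) Hv); lra.
      - unfold err; replace ((x + l, v)%R : C) with ((x, v) + l)%C by (unfold RtoC, Cmult, Cplus; simpl; f_equal; ring).
        ring. }
    assert (T := Cmod_triangle A (Ci * B)); rewrite Cmod_mult, Cmod_Ci in T; nra. }
rewrite Rplus_0_l; apply (Rle_trans _ _ _ Hmain).
apply Rle_trans with (2 * eps * (1 + l + m) ^ 2); [apply Rmult_le_compat_l; [lra|apply pow_incr; lra]|].
unfold eps; apply Req_le; field; lra.
Qed.

Lemma Ci_sqr : (Ci * Ci = - RtoC 1)%C.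
Proof. unfold Ci, Cmult, RtoC, Copp; simpl; f_equal; ring. Qed.

(** * Cauchy's formula for the derivative *)

(** Goursat on a rectangle of height [2 * PI], whose horizontal sides cancel by periodicity. In the
    coordinate [exp w] vertical segments are circles, so this is independence of the radius. *)
Lemma periodic_vertical_integral (G G' : C -> C) (s l : R) : has_deriv G G' ->
  (forall u, G (u, 2 * PI) = G (u, 0)) -> 0 <= l ->
  Cint (fun v => G (s + l, v)%R) 0 (2 * PI) = Cint (fun v => G (s, v)) 0 (2 * PI).
Proof.
intros HG Hper Hl; assert (Hpi := PI_RGT_0).
assert (H := goursat G G' s 0 l (2 * PI) HG Hl ltac:(lra)); unfold rect_int in H.
rewrite !Rplus_0_l in H.
rewrite (Cint_ext (fun u => G (u, 2 * PI)) (fun u => G (u, 0)) _ _ Hper) in H.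
set (A := Cint (fun v => G (s + l, v)%R) _ _) in *; set (B := Cint (fun v => G (s, v)) _ _) in *.
set (D := Cint (fun u => G (u, 0)) _ _) in H.
replace A with (B + (- Ci) * (D - D + Ci * (A - B)))%C.
- rewrite H; ring.
- replace (B + - Ci * (D - D + Ci * (A - B)))%C with (B + (- (Ci * Ci)) * (A - B))%C by ring.
  rewrite Ci_sqr; ring.
Qed.

Lemma has_deriv_Cexp_opp : has_deriv (fun w => Cexp (- w)) (fun w => - Cexp (- w))%C.
Proof.
apply (has_deriv_ext (fun w => Cexp ((-1) * w)) _ (fun w => (-1) * Cexp ((-1) * w))%C).
- apply has_deriv_exp.
- intros z; f_equal; ring.
- intros z; replace ((-1) * z)%C with (- z)%C by ring; ring.
Qed.

Lemma Cexp_period_ver (s : R) : Cexp (s, 2 * PI) = Cexp (s, 0).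
Proof.
replace ((s, 2 * PI) : C) with ((s, 0) + (0, 2 * INR 1 * PI)%R)%C by (unfold Cplus; simpl; f_equal; ring).
rewrite Cexp_plus, Cexp_2PI; ring.
Qed.

Lemma Cexp_opp_period_ver (s : R) : Cexp (- (s, 2 * PI)) = Cexp (- (s, 0)).
Proof.
assert (H1 := Cexp_opp (s, 2 * PI)); assert (H2 := Cexp_opp (s, 0)).
rewrite Cexp_period_ver in H1.
apply (f_equal (Cmult (Cexp (- (s, 0))))) in H1.
rewrite Cmult_assoc, (Cmult_comm _ (Cexp (s, 0))), H2, Cmult_1_l, Cmult_1_r in H1; exact H1.
Qed.

Lemma Cmod_Cexp_opp (s v : R) : Cmod (Cexp (- (s, v))) = exp (- s).
Proof. rewrite Cmod_Cexp; reflexivity. Qed.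

Lemma rcont_Cexp_opp (s : R) : rcont (fun v => Cexp (- (s, v))).
Proof.
apply (rcont_comp (fun w => Cexp (- w))); [|apply rcont_ver].
exact (has_deriv_ccont _ _ has_deriv_Cexp_opp).
Qed.

(** Shifting the segment by 1 leaves the integral unchanged but multiplies the integrand by
    [exp (-1)], so the integral is 0. *)
Lemma Cint_Cexp_opp (s : R) : Cint (fun v => Cexp (- (s, v))) 0 (2 * PI) = 0%C.
Proof.
assert (Hpi := PI_RGT_0).
assert (H := periodic_vertical_integral _ _ s 1 has_deriv_Cexp_opp Cexp_opp_period_ver ltac:(lra)).
rewrite (Cint_ext _ (fun v => RtoC (exp (-1)) * Cexp (- (s, v)))%C) in H.
- rewrite Cint_scal in H by apply rcont_Cexp_opp.
  set (A := Cint _ _ _) in *.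
  apply Cmod_eq_0; apply (f_equal Cmod) in H; rewrite Cmod_mult, Cmod_R, Rabs_right in H by (left; apply exp_pos).
  assert (He : exp (-1) < 1) by (rewrite <- exp_0; apply exp_increasing; lra).
  assert (H0 := Cmod_ge_0 A); nra.
- intros v.
  replace (- (s + 1, v)%R)%C with (RtoC (- (1)) + - (s, v))%C by (unfold RtoC, Cplus, Copp; simpl; f_equal; ring).
  rewrite Cexp_plus; f_equal.
  unfold Cexp, RtoC; simpl; rewrite cos_0, sin_0; rewrite Rmult_0_r, Rmult_1_r; f_equal; f_equal; ring.
Qed.

Lemma cauchy_integrand_cont (f : C -> C) (z : C) (s : R) : ccont f ->
  rcont (fun v => f (z + Cexp (s, v)) * Cexp (- (s, v)))%C.
Proof.
intros Hf; apply (rcont_mult (fun v => f (z + Cexp (s, v))%C)); [|apply rcont_Cexp_opp].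
apply rcont_comp; [exact Hf|]; apply rcont_plus; [apply rcont_const|].
apply rcont_comp; [exact (has_deriv_ccont _ _ has_deriv_Cexp)|apply rcont_ver].
Qed.

(* The circle [z + exp (s + i v)] is parametrised by a vertical segment; since [f (z + exp w) * exp (- w)] is entire and periodic, its integral does not depend on the radius, and the limit of small radii gives the derivative. *)
Lemma cauchy_formula (f f' : C -> C) (z : C) (s : R) : has_deriv f f' ->
  Cint (fun v => f (z + Cexp (s, v)) * Cexp (- (s, v)))%C 0 (2 * PI) = (RtoC (2 * PI) * f' z)%C.
Proof.
intros Hf; assert (Hpi := PI_RGT_0); assert (Hfc := has_deriv_ccont _ _ Hf).
set (G := fun w => (f (z + Cexp w) * Cexp (- w))%C).
assert (HG : exists G', has_deriv G G').
{ eexists; apply (has_deriv_mult (fun w => f (z + Cexp w)%C)); [|apply has_deriv_Cexp_opp].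
  apply (has_deriv_comp f (fun w => z + Cexp w)%C); [exact Hf|].
  apply has_deriv_plus; [apply has_deriv_const|apply has_deriv_Cexp]. }
destruct HG as [G' HG].
assert (Hper : forall u, G (u, 2 * PI) = G (u, 0)).
{ intros u; unfold G; rewrite Cexp_period_ver, Cexp_opp_period_ver; reflexivity. }
change (Cint (fun v => G (s, v)) 0 (2 * PI) = (RtoC (2 * PI) * f' z)%C).
apply Ceq_minus, Cmod_eq_0, Rle_antisym; [|apply Cmod_ge_0].
apply le_epsilon; intros e He; rewrite Rplus_0_l.
assert (He2 : 0 < e / (2 * PI)) by (apply Rdiv_lt_0_compat; lra).
destruct (Hf z _ He2) as [d [Hd Hh]].
(* The radius [exp s0] must be below [d], and [s0 <= s] because the segment is moved to the right
   only. *)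
set (s0 := Rmin s (ln d - 1)).
assert (Hs0 : exp s0 < d).
{ rewrite <- (exp_ln d) by exact Hd; apply exp_increasing; assert (H := Rmin_r s (ln d - 1)); fold s0 in H; lra. }
assert (Hs : s0 <= s) by apply Rmin_l.
replace s with (s0 + (s - s0)) by ring.
rewrite (periodic_vertical_integral G G' s0 (s - s0) HG Hper) by lra.
(* The constant term [f z] contributes 0 to the integral, so it may be subtracted; what remains is
   the difference quotient. *)
set (g := fun v => (f z * Cexp (- (s0, v)))%C).
assert (Hg : rcont g) by (apply (rcont_mult (fun _ => f z)); [apply rcont_const|apply rcont_Cexp_opp]).
assert (HGc : rcont (fun v => G (s0, v))) by (apply cauchy_integrand_cont, Hfc).
assert (E : (Cint (fun v => G (s0, v)) 0 (2 * PI) - RtoC (2 * PI) * f' z)%C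
  = Cint (fun v => G (s0, v) - g v - f' z)%C 0 (2 * PI)).
{ rewrite (Cint_minus (fun v => G (s0, v) - g v)%C) by (auto using rcont_minus, rcont_const).
  rewrite (Cint_minus (fun v => G (s0, v))) by auto.
  rewrite Cint_const; unfold g at 1; rewrite Cint_scal by apply rcont_Cexp_opp.
  rewrite Cint_Cexp_opp, Rminus_0_r; ring. }
rewrite E; replace e with ((2 * PI - 0) * (e / (2 * PI))) by (field; lra).
apply Cint_norm_le; [auto using rcont_minus, rcont_const|lra|].
intros v _; unfold G, g; set (h := Cexp (s0, v)).
assert (Hm : Cmod h = exp s0) by apply Cmod_Cexp.
assert (Hinv : (h * Cexp (- (s0, v)) = 1)%C) by apply Cexp_opp.
replace (f (z + h)%C * Cexp (- (s0, v)) - f z * Cexp (- (s0, v)) - f' z)%C with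
  ((f (z + h)%C - f z - f' z * h) * Cexp (- (s0, v)))%C.
- rewrite Cmod_mult, Cmod_Cexp_opp.
  assert (K := Hh h ltac:(lra)); rewrite Hm in K.
  assert (Hp := exp_pos (- s0)).
  apply (Rmult_le_compat_r (exp (- s0))) in K; [|lra].
  rewrite Rmult_assoc, <- exp_plus, Rplus_opp_r, exp_0, Rmult_1_r in K; exact K.
- replace (f' z) with (f' z * (h * Cexp (- (s0, v))))%C at 2 by (rewrite Hinv; ring); ring.
Qed.

Lemma cauchy_estimate (f f' : C -> C) (z : C) (r M : R) : has_deriv f f' -> 0 < r ->
  (forall u, Cmod u = r -> Cmod (f (z + u)%C) <= M) -> Cmod (f' z) <= M / r.
Proof.
intros Hf Hr HM; assert (Hpi := PI_RGT_0).
assert (H := cauchy_formula f f' z (ln r) Hf).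
assert (K : Cmod (Cint (fun v => f (z + Cexp (ln r, v)) * Cexp (- (ln r, v)))%C 0 (2 * PI)) <= (2 * PI - 0) * (M / r)).
{ apply Cint_norm_le; [apply cauchy_integrand_cont, (has_deriv_ccont _ _ Hf)|lra|].
  intros v _; rewrite Cmod_mult, Cmod_Cexp_opp, exp_Ropp, exp_ln by exact Hr.
  apply Rmult_le_compat_r; [left; apply Rinv_0_lt_compat, Hr|].
  apply HM; rewrite Cmod_Cexp; exact (exp_ln r Hr). }
rewrite H, Cmod_mult, Cmod_R, Rabs_right in K by lra.
apply Rmult_le_reg_l with (2 * PI); lra.
Qed.

(** * Local bounds, the mean value inequality and higher derivatives *)

(** Compactness of a square by bisection: four bounds combine to their maximum, and continuity gives
    a bound near each point. *)
Lemma ccont_loc_bounded (f : C -> C) (r : R) : ccont f ->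
  exists M, forall w, Cmod w <= r -> Cmod (f w) <= M.
Proof.
intros Hf.
destruct (Rle_dec 0 r) as [Hr|Hr].
2:{ exists 0; intros w Hw; assert (H := Cmod_ge_0 w); lra. }
destruct (rect_induction (fun x y l m => exists M, forall u v, x <= u <= x + l -> y <= v <= y + m -> Cmod (f (u, v)) <= M)) with (- r) (- r) (2 * r) (2 * r) as [M HM].
- intros x y l m [M1 H1] [M2 H2] [M3 H3] [M4 H4].
  exists (Rmax (Rmax M1 M2) (Rmax M3 M4)); intros u v Hu Hv.
  destruct (Rle_dec u (x + l / 2)) as [Hu2|Hu2]; destruct (Rle_dec v (y + m / 2)) as [Hv2|Hv2].
  + apply (Rle_trans _ M1); [apply H1; lra|]; exact (Rle_trans _ _ _ (Rmax_l _ _) (Rmax_l _ _)).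
  + apply (Rle_trans _ M3); [apply H3; lra|]; exact (Rle_trans _ _ _ (Rmax_l _ _) (Rmax_r _ _)).
  + apply (Rle_trans _ M2); [apply H2; lra|]; exact (Rle_trans _ _ _ (Rmax_r _ _) (Rmax_l _ _)).
  + apply (Rle_trans _ M4); [apply H4; lra|]; exact (Rle_trans _ _ _ (Rmax_r _ _) (Rmax_r _ _)).
- intros a b; destruct (Hf (a, b) 1 Rlt_0_1) as [d [Hd H]].
  exists (d / 2); split; [lra|]; intros x y l m Ha Hb Hl Hm.
  exists (Cmod (f (a, b)) + 1); intros u v Hu Hv.
  assert (Hs : Cmod ((u, v) - (a, b)) < d).
  { unfold Cminus, Cplus, Copp; simpl; apply (Rle_lt_trans _ _ _ (Cmod_pair_le _ _)).
    replace d with (d / 2 + d / 2) by field.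
    apply Rplus_lt_compat; apply Rabs_def1; lra. }
  assert (K := H _ Hs); assert (T := Cmod_triangle (f (a, b)) (f (u, v) - f (a, b))).
  replace (f (a, b) + (f (u, v) - f (a, b)))%C with (f (u, v)) in T by ring; lra.
- lra.
- lra.
- exists M; intros [u v] Hw.
  assert (H1 := re_le_Cmod (u, v)); assert (H2 := im_le_Cmod (u, v)); simpl in H1, H2.
  assert (K1 : - r <= u <= r) by (apply Rabs_le_between; lra).
  assert (K2 : - r <= v <= r) by (apply Rabs_le_between; lra).
  apply HM; lra.
Qed.

Lemma Re_deriv (F F' : C -> C) (t : R) : has_deriv F F' ->
  derivable_pt_lim (fun t => Re (F t)) t (Re (F' t)).
Proof.
intros HF eps Heps.
destruct (HF (RtoC t) (eps / 2) ltac:(lra)) as [d [Hd H]].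
exists (mkposreal d Hd); intros h Hh Hhd; simpl in Hhd.
assert (Hm : Cmod (RtoC h) = Rabs h) by apply Cmod_R.
assert (K := H (RtoC h) ltac:(lra)); rewrite Hm in K.
assert (Hp := Rabs_pos_lt h Hh).
apply Rmult_lt_reg_r with (Rabs h); [exact Hp|].
rewrite <- Rabs_mult.
replace (((Re (F (RtoC (t + h))) - Re (F (RtoC t))) / h - Re (F' (RtoC t))) * h)
  with (Re (F (RtoC t + RtoC h)%C - F (RtoC t) - F' (RtoC t) * RtoC h)%C).
- assert (K2 := re_le_Cmod (F (RtoC t + RtoC h)%C - F (RtoC t) - F' (RtoC t) * RtoC h)%C); nra.
- rewrite <- RtoC_plus; unfold Cminus; rewrite !re_plus, !re_opp, re_scal_r; field; exact Hh.
Qed.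

(** The mean value theorem has no equality for complex values, so [f] is first projected: it is
    applied to the real part of [Cconj (f b - f a) * f] along the segment, whose increment is the
    square of [Cmod (f b - f a)]. *)
Lemma mean_value_ineq (f f' : C -> C) (a b : C) (M : R) : has_deriv f f' ->
  (forall t, 0 <= t <= 1 -> Cmod (f' (a + RtoC t * (b - a))%C) <= M) ->
  Cmod (f b - f a) <= M * Cmod (b - a).
Proof.
intros Hf HM.
set (u := (f b - f a)%C).
set (F := fun w => (Cconj u * f ((b - a) * w + a))%C).
set (F' := fun w => (Cconj u * ((b - a) * f' ((b - a) * w + a)))%C).
assert (HF : has_deriv F F').
{ apply has_deriv_scal, (has_deriv_comp f (fun w => (b - a) * w + a)%C f' (fun _ => b - a)%C Hf), has_deriv_affine. }
destruct (MVT_cor2 (fun t => Re (F (RtoC t))) (fun t => Re (F' (RtoC t))) 0 1 Rlt_0_1) as [c [Hc1 Hc2]].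
{ intros c _; apply Re_deriv, HF. }
assert (E : Re (F (RtoC 1)) - Re (F (RtoC 0)) = Cmod u ^ 2).
{ unfold F; rewrite Cmult_1_r, Cmult_0_r, Cplus_0_l.
  replace (b - a + a)%C with b by ring.
  replace (Re (Cconj u * f b) - Re (Cconj u * f a)) with (Re (Cconj u * u)).
  - rewrite Cmult_comm, <- Cmod2_conj; apply re_RtoC.
  - replace (Cconj u * u)%C with (Cconj u * f b + - (Cconj u * f a))%C by (unfold u at 4; ring).
    rewrite re_plus, re_opp; ring. }
rewrite E, Rminus_0_r, Rmult_1_r in Hc1.
assert (K := HM c ltac:(lra)).
assert (K2 := Rle_trans _ _ _ (Rle_abs _) (re_le_Cmod (F' (RtoC c)))).
rewrite <- Hc1 in K2; unfold F' in K2; rewrite !Cmod_mult, Cmod_conj in K2.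
replace ((b - a) * RtoC c + a)%C with (a + RtoC c * (b - a))%C in K2 by ring.
assert (H0 := Cmod_ge_0 u); assert (H1 := Cmod_ge_0 (b - a)).
destruct (Req_dec (Cmod u) 0) as [Hu|Hu].
- rewrite Hu; assert (H2 := Cmod_ge_0 (f' (a + RtoC c * (b - a))%C)); nra.
- apply Rmult_le_reg_l with (Cmod u); [lra|].
  apply Rle_trans with (Cmod u * (Cmod (b - a) * Cmod (f' (a + RtoC c * (b - a))%C))); [lra|].
  apply Rmult_le_compat_l; [exact H0|]; rewrite Rmult_comm; apply Rmult_le_compat_r; assumption.
Qed.

Lemma Cmod_segment (a b : C) (t r : R) : 0 <= t <= 1 -> Cmod a <= r -> Cmod b <= r ->
  Cmod (a + RtoC t * (b - a)) <= r.
Proof.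
intros Ht Ha Hb.
replace (a + RtoC t * (b - a))%C with (RtoC (1 - t) * a + RtoC t * b)%C by (rewrite RtoC_minus; ring).
apply (Rle_trans _ _ _ (Cmod_triangle _ _)).
rewrite !Cmod_mult, !Cmod_R, !Rabs_right by lra; nra.
Qed.

(** No second derivative is at hand yet. The difference of [f'] at two points is, by Cauchy's
    formula on unit circles, an average of differences of [f], to which the mean value inequality
    applies. *)
Lemma deriv_lipschitz (f f' : C -> C) (r : R) : has_deriv f f' ->
  exists L, 0 <= L /\ forall w1 w2, Cmod w1 <= r -> Cmod w2 <= r -> Cmod (f' w1 - f' w2) <= L * Cmod (w1 - w2).
Proof.
intros Hf; assert (Hpi := PI_RGT_0); assert (Hfc := has_deriv_ccont _ _ Hf).
(* Unit circles are used twice: around points of the disc of radius [r], and again to bound [f'] on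
   the disc of radius [r + 1]. *)
destruct (ccont_loc_bounded f (r + 2) Hfc) as [M HM].
exists (Rmax 0 M); split; [apply Rmax_l|]; intros w1 w2 H1 H2.
assert (Hd : forall w, Cmod w <= r + 1 -> Cmod (f' w) <= Rmax 0 M).
{ intros w Hw; replace (Rmax 0 M) with (Rmax 0 M / 1) by field.
  apply (cauchy_estimate f); [exact Hf|lra|].
  intros u Hu; apply Rle_trans with M; [apply HM|apply Rmax_r].
  assert (T := Cmod_triangle w u); lra. }
assert (E : (RtoC (2 * PI) * (f' w1 - f' w2))%C =
  Cint (fun v => f (w1 + Cexp (0, v)) * Cexp (- (0, v)) - f (w2 + Cexp (0, v)) * Cexp (- (0, v)))%C 0 (2 * PI)).
{ rewrite Cint_minus by (apply cauchy_integrand_cont, Hfc).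
  rewrite !(cauchy_formula f f') by exact Hf; ring. }
apply Rmult_le_reg_l with (2 * PI); [lra|].
replace (2 * PI * Cmod (f' w1 - f' w2)) with (Cmod (RtoC (2 * PI) * (f' w1 - f' w2)))
  by (rewrite Cmod_mult, Cmod_R, Rabs_right; lra).
rewrite E; replace (2 * PI) with (2 * PI - 0) at 2 by ring.
apply Cint_norm_le; [apply rcont_minus; apply cauchy_integrand_cont, Hfc|lra|].
intros v _; set (e := Cexp (0, v)).
assert (He : Cmod e = 1) by (unfold e; rewrite Cmod_Cexp; apply exp_0).
replace (f (w1 + e) * Cexp (- (0, v)) - f (w2 + e) * Cexp (- (0, v)))%C with ((f (w1 + e) - f (w2 + e)) * Cexp (- (0, v)))%C by ring.
rewrite Cmod_mult, Cmod_Cexp_opp, Ropp_0, exp_0, Rmult_1_r.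
replace (w1 - w2)%C with (w1 + e - (w2 + e))%C by ring.
apply (mean_value_ineq f f'); [exact Hf|]; intros t Ht; apply Hd.
apply Cmod_segment; [exact Ht| |].
- assert (T := Cmod_triangle w2 e); lra.
- assert (T := Cmod_triangle w1 e); lra.
Qed.

Lemma deriv_ccont (f f' : C -> C) : has_deriv f f' -> ccont f'.
Proof.
intros Hf z eps Heps.
destruct (deriv_lipschitz f f' (Cmod z + 1) Hf) as [L [HL H]].
assert (Hq : 0 < eps / (L + 1)) by (apply Rdiv_lt_0_compat; lra).
exists (Rmin 1 (eps / (L + 1))); split; [apply Rmin_glb_lt; lra|]; intros w Hw.
assert (Hw1 := Rlt_le_trans _ _ _ Hw (Rmin_l _ _)).
assert (Hw2 := Rlt_le_trans _ _ _ Hw (Rmin_r _ _)).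
assert (T := Cmod_triangle z (w - z)); rewrite Cplus_sub_cancel in T.
assert (K := H w z ltac:(lra) ltac:(lra)).
apply (Rmult_lt_compat_r (L + 1)) in Hw2; [|lra].
replace (eps / (L + 1) * (L + 1)) with eps in Hw2 by (field; lra).
assert (H0 := Cmod_ge_0 (w - z)); nra.
Qed.

(** Differentiation under the integral sign in Cauchy's formula for [f']; the candidate for the
    second derivative is the same formula with [f'] in place of [f]. *)
Lemma deriv_has_deriv (f f' : C -> C) : has_deriv f f' -> exists f'', has_deriv f' f''.
Proof.
intros Hf; assert (Hpi := PI_RGT_0).
assert (Hfc := has_deriv_ccont _ _ Hf); assert (Hfc' := deriv_ccont _ _ Hf).
exists (fun z => RtoC (/ (2 * PI)) * Cint (fun v => f' (z + Cexp (0, v)) * Cexp (- (0, v))) 0 (2 * PI))%C.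
intros z eps Heps.
destruct (deriv_lipschitz f f' (Cmod z + 2) Hf) as [L [HL H]].
assert (Hq : 0 < eps / (L + 1)) by (apply Rdiv_lt_0_compat; lra).
exists (Rmin 1 (eps / (L + 1))); split; [apply Rmin_glb_lt; lra|]; intros h Hh.
assert (Hh1 := Rlt_le_trans _ _ _ Hh (Rmin_l _ _)).
assert (Hh2 := Rlt_le_trans _ _ _ Hh (Rmin_r _ _)).
apply (Rmult_lt_compat_r (L + 1)) in Hh2; [|lra].
replace (eps / (L + 1) * (L + 1)) with eps in Hh2 by (field; lra).
assert (H0 := Cmod_ge_0 h).
set (I2 := Cint (fun v => f' (z + Cexp (0, v)) * Cexp (- (0, v)))%C 0 (2 * PI)).
assert (E : (RtoC (2 * PI) * (f' (z + h)%C - f' z - RtoC (/ (2 * PI)) * I2 * h))%C =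
  Cint (fun v => f (z + h + Cexp (0, v)) * Cexp (- (0, v)) - f (z + Cexp (0, v)) * Cexp (- (0, v))
    - h * (f' (z + Cexp (0, v)) * Cexp (- (0, v))))%C 0 (2 * PI)).
{ assert (C1 := cauchy_integrand_cont f (z + h) 0 Hfc).
  assert (C2 := cauchy_integrand_cont f z 0 Hfc).
  assert (C3 := cauchy_integrand_cont f' z 0 Hfc').
  rewrite (Cint_minus (fun v => f (z + h + Cexp (0, v)) * Cexp (- (0, v)) - f (z + Cexp (0, v)) * Cexp (- (0, v)))%C).
  - rewrite Cint_minus, Cint_scal by assumption.
    rewrite !(cauchy_formula f f') by exact Hf; fold I2.
    replace (RtoC (2 * PI) * (f' (z + h)%C - f' z - RtoC (/ (2 * PI)) * I2 * h))%C with
      (RtoC (2 * PI) * f' (z + h)%C - RtoC (2 * PI) * f' z - (RtoC (2 * PI) * RtoC (/ (2 * PI))) * I2 * h)%C by ring.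
    rewrite <- (RtoC_mult (2 * PI)), Rinv_r by lra; ring.
  - apply rcont_minus; assumption.
  - apply rcont_mult; [apply rcont_const|assumption]. }
apply Rmult_le_reg_l with (2 * PI); [lra|].
replace (2 * PI * Cmod (f' (z + h)%C - f' z - RtoC (/ (2 * PI)) * I2 * h)) with
  (Cmod (RtoC (2 * PI) * (f' (z + h)%C - f' z - RtoC (/ (2 * PI)) * I2 * h))%C)
  by (rewrite Cmod_mult, Cmod_R, Rabs_right; lra).
rewrite E; replace (2 * PI) with (2 * PI - 0) at 2 by ring.
apply Cint_norm_le; [|lra|].
{ apply rcont_minus; [apply rcont_minus; apply cauchy_integrand_cont, Hfc|].
  apply rcont_mult; [apply rcont_const|apply cauchy_integrand_cont, Hfc']. }
intros v _; set (e := Cexp (0, v)).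
assert (He : Cmod e = 1) by (unfold e; rewrite Cmod_Cexp; apply exp_0).
set (w := (z + e)%C).
assert (Hw : Cmod w <= Cmod z + 1) by (unfold w; assert (T := Cmod_triangle z e); lra).
replace (f (z + h + e) * Cexp (- (0, v)) - f w * Cexp (- (0, v)) - h * (f' w * Cexp (- (0, v))))%C
  with ((f (w + h) - f' w * (w + h) - (f w - f' w * w)) * Cexp (- (0, v)))%C
  by (unfold w; replace (z + h + e)%C with (z + e + h)%C by ring; ring).
rewrite Cmod_mult, Cmod_Cexp_opp, Ropp_0, exp_0, Rmult_1_r.
(* The first-order error of [f] at [w] is the increment of [f x - f' w * x], whose derivative is at
   most [L |h|] on the segment; this gives an error quadratic in [h]. *)
assert (K : Cmod (f (w + h) - f' w * (w + h) - (f w - f' w * w))%C <= (L * Cmod h) * Cmod (w + h - w)).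
{ apply (mean_value_ineq (fun x => f x - f' w * x)%C (fun x => f' x - f' w)%C).
  - apply has_deriv_minus; [exact Hf|].
    apply (has_deriv_ext (fun x => f' w * x)%C _ (fun _ => f' w * 1)%C); [apply has_deriv_scal, has_deriv_id|reflexivity|intros; ring].
  - intros t Ht; replace (w + h - w)%C with h by ring.
    assert (Hth : Cmod (RtoC t * h) <= Cmod h) by (rewrite Cmod_mult, Cmod_R, Rabs_right; nra).
    assert (T := Cmod_triangle w (RtoC t * h)%C).
    assert (K := H (w + RtoC t * h)%C w ltac:(lra) ltac:(lra)).
    replace (w + RtoC t * h - w)%C with (RtoC t * h)%C in K by ring.
    apply (Rle_trans _ _ _ K), Rmult_le_compat_l; assumption. }
replace (w + h - w)%C with h in K by ring; nra.
Qed.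

(** * Pointwise growth from the hyper-order *)

Lemma hyper_order_bound (f : C -> C) : Rbar_lt (hyper_order f) (Finite 1) ->
  exists c R0 : R, c < 1 /\ forall r, R0 < r -> ln (ln (nevanlinna_T f r)) / ln r <= c.
Proof.
intros H; apply NNPP; intros Hno.
unfold hyper_order in H.
set (E := fun c : R => exists R0 : R, forall r : R, R0 < r -> ln (ln (nevanlinna_T f r)) / ln r <= c) in H.
destruct (Glb_Rbar_correct E) as [_ Hglb].
assert (H1 : Rbar_le (Finite 1) (Glb_Rbar E)).
{ apply Hglb; intros c [R0 Hc]; simpl; apply Rnot_lt_le; intros Hc1; apply Hno; exists c, R0; auto. }
exact (Rbar_lt_not_le _ _ H H1).
Qed.

Lemma ln_div (x y : R) : 0 < x -> 0 < y -> ln (x / y) = ln x - ln y.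
Proof.
intros Hx Hy; unfold Rdiv; rewrite ln_mult, ln_Rinv by (try apply Rinv_0_lt_compat; assumption); ring.
Qed.

Lemma logplus_eq (x : R) : logplus x = ln (Rmax 1 x).
Proof.
unfold logplus; destruct (Rle_dec x 1) as [H|H].
- rewrite (Rmax_left 1 x H), ln_1; apply Rmax_left.
  destruct (Rle_dec x 0) as [H0|H0].
  (* [ln] takes the default value 0 at arguments that are not positive. *)
  + unfold ln; destruct (Rlt_dec 0 x) as [Hp|_]; [elim (Rle_not_lt _ _ H0 Hp)|apply Rle_refl].
  + rewrite <- ln_1; apply ln_le; lra.
- rewrite (Rmax_right 1 x) by lra; apply Rmax_right.
  rewrite <- ln_1; apply ln_le; lra.
Qed.

Lemma logplus_ge_0 (x : R) : 0 <= logplus x.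
Proof. apply Rmax_l. Qed.

Lemma ln_le_sub_1 (x : R) : 0 < x -> ln x <= x - 1.
Proof.
intros Hx; rewrite <- (exp_ln x Hx) at 2.
destruct (Req_dec (ln x) 0) as [->|Hn]; [rewrite exp_0; lra|].
assert (H := exp_ineq1 (ln x) Hn); lra.
Qed.

Lemma logplus_lipschitz (x y : R) : Rabs (logplus x - logplus y) <= Rabs (x - y).
Proof.
assert (Hle : forall a b, a <= b -> 0 <= logplus b - logplus a <= b - a).
{ intros a b Hab; rewrite !logplus_eq.
  assert (Ha := Rmax_l 1 a); assert (Hb : Rmax 1 a <= Rmax 1 b) by (apply Rle_max_compat_l, Hab).
  set (A := Rmax 1 a) in *; set (B := Rmax 1 b) in *.
  assert (HBA : B - A <= b - a).
  { unfold A, B, Rmax; destruct (Rle_dec 1 a), (Rle_dec 1 b); lra. }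
  split; [assert (H := ln_le A B ltac:(lra) Hb); lra|].
  rewrite <- ln_div by lra.
  apply Rle_trans with (B / A - 1); [apply ln_le_sub_1, Rdiv_lt_0_compat; lra|].
  apply Rmult_le_reg_r with A; [lra|].
  replace ((B / A - 1) * A) with (B - A) by (field; lra); nra. }
destruct (Rle_lt_dec x y) as [H|H].
- specialize (Hle x y H); rewrite (Rabs_minus_sym x y), (Rabs_minus_sym (logplus x)), !Rabs_right; lra.
- specialize (Hle y x ltac:(lra)); rewrite !Rabs_right; lra.
Qed.

Lemma Cmod_lipschitz (x y : C) : Rabs (Cmod x - Cmod y) <= Cmod (x - y).
Proof.
assert (H1 := Cmod_triangle_rev x (y - x)); rewrite Cplus_sub_cancel in H1.
assert (H2 := Cmod_triangle_rev y (x - y)); rewrite Cplus_sub_cancel in H2.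
rewrite Cmod_minus_sym in H1; apply Rabs_le_between; lra.
Qed.

Lemma circle_point (r t : R) : ((r * cos t, r * sin t)%R : C) = (RtoC r * Cexp (0, t))%C.
Proof.
unfold Cexp, RtoC, Cmult; simpl; rewrite exp_0; f_equal; ring.
Qed.

Lemma Cexp_arc (s t : R) : Cmod (Cexp (0, s) - Cexp (0, t)) <= Rabs (s - t).
Proof.
replace (Rabs (s - t)) with (1 * Cmod ((0, s) - (0, t))).
- apply (mean_value_ineq Cexp Cexp); [apply has_deriv_Cexp|].
  intros u _; rewrite Cmod_Cexp.
  replace (Re _) with 0 by (unfold RtoC, Cplus, Cmult, Cminus, Copp; simpl; ring).
  rewrite exp_0; apply Rle_refl.
- replace ((0, s) - (0, t))%C with (Ci * RtoC (s - t))%C by (unfold Ci, RtoC, Cmult, Cminus, Cplus, Copp; simpl; f_equal; ring).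
  rewrite Cmod_mult, Cmod_Ci, Cmod_R; ring.
Qed.

Lemma rcont_Cexp_ver : rcont (fun t => Cexp (0, t)).
Proof. apply rcont_lip, Cexp_arc. Qed.

(** The disc of radius [d] about [w] contains an arc of angle [d / Cmod w] of the circle through [w]
    about 0. There the integrand is at least [L], and elsewhere it is nonnegative. *)
Lemma nevanlinna_T_lower (f : C -> C) (w : C) (d L : R) : ccont f -> 0 < d -> d <= Cmod w -> 0 <= L ->
  (forall u, Cmod (u - w) <= d -> L <= logplus (Cmod (f u))) ->
  d * L / (2 * PI * Cmod w) <= nevanlinna_T f (Cmod w).
Proof.
intros Hf Hd Hdw HL H; assert (Hpi := PI_RGT_0).
assert (Hpi2 := PI2_1); set (r := Cmod w) in *.
set (g := fun t => logplus (Cmod (f (r * cos t, r * sin t)%R))).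
assert (Hpath : rcont (fun t => f (r * cos t, r * sin t)%R)).
{ apply (rcont_comp f); [exact Hf|].
  apply (rcont_ext (fun t => RtoC r * Cexp (0, t))%C); [intros t; symmetry; apply circle_point|].
  apply rcont_mult; [apply rcont_const|apply rcont_Cexp_ver]. }
assert (Hg : forall t, continuous g t).
{ intros t; apply filterlim_locally; intros eps.
  destruct (Hpath t eps (cond_pos eps)) as [e [He K]].
  exists (mkposreal e He); intros s Hs.
  apply (Rle_lt_trans _ _ _ (logplus_lipschitz _ _)).
  apply (Rle_lt_trans _ _ _ (Cmod_lipschitz _ _)), K, Hs. }
assert (Hex : forall a b, ex_RInt g a b).
{ intros a b; apply (ex_RInt_continuous (V := R_CompleteNormedModule)); intros; apply Hg. }
destruct (polar w) as [th [Hth Hw]]; fold r in Hw.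
assert (Hdr0 : 0 < d / r) by (apply Rdiv_lt_0_compat; lra).
assert (Hdr : d / r <= 1).
{ apply Rmult_le_reg_r with r; [lra|]; unfold Rdiv; rewrite Rmult_assoc, Rinv_l; lra. }
(* The arc starts or ends at [th], on the side that keeps it inside the interval of integration. *)
assert (Hab : exists a, 0 <= a /\ a + d / r <= 2 * PI /\ a <= th <= a + d / r).
{ destruct (Rle_dec th PI); [exists th|exists (th - d / r)]; lra. }
destruct Hab as [a [Ha [Hb Hath]]].
assert (Hlow : forall t, a <= t <= a + d / r -> L <= g t).
{ intros t Ht; apply H; rewrite Hw, !circle_point.
  replace (RtoC r * Cexp (0, t) - RtoC r * Cexp (0, th))%C with (RtoC r * (Cexp (0, t) - Cexp (0, th)))%C by ring.
  rewrite Cmod_mult, Cmod_R, Rabs_right by lra.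
  assert (K := Cexp_arc t th).
  assert (K2 : Rabs (t - th) <= d / r) by (apply Rabs_le_between; lra).
  apply Rle_trans with (r * (d / r)); [apply Rmult_le_compat_l; lra|right; field; lra]. }
assert (HI : d / r * L <= RInt g 0 (2 * PI)).
{ rewrite <- (RInt_Chasles g 0 a (2 * PI)) by apply Hex.
  rewrite <- (RInt_Chasles g a (a + d / r) (2 * PI)) by apply Hex.
  assert (I1 : 0 <= RInt g 0 a) by (apply RInt_ge_0; [lra|apply Hex|intros; apply logplus_ge_0]).
  assert (I3 : 0 <= RInt g (a + d / r) (2 * PI)) by (apply RInt_ge_0; [lra|apply Hex|intros; apply logplus_ge_0]).
  assert (I2 : RInt (fun _ => L) a (a + d / r) <= RInt g a (a + d / r)).
  { apply RInt_le; [lra|apply ex_RInt_const|apply Hex|intros; apply Hlow; lra]. }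
  rewrite RInt_const in I2; unfold scal in I2; simpl in I2; unfold mult in I2; simpl in I2.
  replace (a + d / r - a) with (d / r) in I2 by ring.
  unfold plus; simpl; lra. }
unfold nevanlinna_T; change (d * L / (2 * PI * r) <= / (2 * PI) * RInt g 0 (2 * PI)).
replace (d * L / (2 * PI * r)) with (/ (2 * PI) * (d / r * L)) by (field; split; lra).
apply Rmult_le_compat_l; [left; apply Rinv_0_lt_compat; lra|exact HI].
Qed.

(** At [r = Cmod (z0 + n)] the characteristic is at least a multiple of [2 ^ n / r], so
    [ln T > X / 4] for [X = n + Cmod z0]. A hyper-order below 1 would give
    [ln (ln T) <= c * ln X <= ln (X / 8)] for large [n]. *)
Lemma double_exp_not_hyper_order_lt_1 (f : C -> C) (z0 : C) (d : R) : ccont f -> 0 < d ->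
  (forall (n : nat) u, Cmod (u - z0) <= d -> 2 ^ n <= logplus (Cmod (f (u + RtoC (INR n))%C))) ->
  ~ Rbar_lt (hyper_order f) (Finite 1).
Proof.
intros Hf Hd Hgr Hlt; assert (Hpi := PI_RGT_0).
destruct (hyper_order_bound f Hlt) as [c0 [R0 [Hc0 HT]]].
(* Nonnegative, so that [c * ln r <= c * ln X] follows from [r <= X]. *)
set (c := Rmax c0 0).
assert (Hc1 : c < 1) by (unfold c; apply Rmax_lub_lt; lra).
assert (Hc2 : 0 <= c) by apply Rmax_r.
assert (Hcc : c0 <= c) by apply Rmax_l.
set (a := Cmod z0); assert (Ha : 0 <= a) by apply Cmod_ge_0.
set (K := ln (2 * PI / d) + ln 8 + a + 1).
(* The last summand secures [ln 8 <= (1 - c) * ln X]; the others make [r] and [X] exceed the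
   thresholds met on the way. *)
set (B := Rabs R0 + 1 + d + 4 * a + 8 * Rabs K + 8 + exp (ln 8 / (1 - c))).
destruct (INR_unbounded B) as [n Hn].
assert (HK := Rle_abs K); assert (HK0 := Rabs_pos K).
assert (HR := Rle_abs R0); assert (HR0 := Rabs_pos R0).
assert (He := exp_pos (ln 8 / (1 - c))).
set (w := (z0 + RtoC (INR n))%C); set (r := Cmod w).
assert (HINR : Cmod (RtoC (INR n)) = INR n) by (rewrite Cmod_R; apply Rabs_right, Rle_ge, pos_INR).
assert (Hr1 : r <= INR n + a) by (unfold r, w; assert (T := Cmod_triangle z0 (RtoC (INR n))); unfold a; lra).
assert (Hr2 : INR n - a <= r).
{ assert (T := Cmod_triangle_rev (RtoC (INR n)) z0); rewrite Cplus_comm in T; fold w r a in T; lra. }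
set (X := INR n + a) in *.
assert (HTn : d * 2 ^ n / (2 * PI * r) <= nevanlinna_T f r).
{ apply nevanlinna_T_lower; [exact Hf|exact Hd|fold r; unfold B in Hn; lra|apply pow_le; lra|].
  intros u Hu.
  replace u with (u - RtoC (INR n) + RtoC (INR n))%C by ring; apply Hgr.
  replace (u - RtoC (INR n) - z0)%C with (u - w)%C by (unfold w; ring); exact Hu. }
assert (Hr0 : 1 < r) by (unfold B in Hn; lra).
set (T := nevanlinna_T f r) in *.
assert (H2n : 0 < 2 ^ n) by (apply pow_lt; lra).
assert (Hq0 : 0 < d * 2 ^ n / (2 * PI * r)) by (apply Rdiv_lt_0_compat; nra).
assert (Hln : INR n * ln 2 - ln (2 * PI / d) - ln r <= ln T).
{ apply Rle_trans with (ln (d * 2 ^ n / (2 * PI * r))); [|apply ln_le; assumption].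
  replace (d * 2 ^ n / (2 * PI * r)) with (2 ^ n / ((2 * PI / d) * r)) by (field; repeat split; lra).
  assert (Hpd : 0 < 2 * PI / d) by (apply Rdiv_lt_0_compat; lra).
  assert (Hpr : 0 < 2 * PI / d * r) by (apply Rmult_lt_0_compat; lra).
  rewrite (ln_div (2 ^ n)), (ln_mult (2 * PI / d) r), ln_pow by lra; lra. }
assert (HX8 : ln r <= X / 8 - 1 + ln 8).
{ apply Rle_trans with (ln X); [apply ln_le; lra|].
  replace X with (X / 8 * 8) at 1 by field; rewrite ln_mult by lra.
  assert (T1 := ln_le_sub_1 (X / 8) ltac:(lra)); lra. }
assert (Hl2 := ln_lt_2).
assert (HnX : INR n * / 2 <= INR n * ln 2) by (apply Rmult_le_compat_l; [apply pos_INR|lra]).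
assert (Hy : X / 4 < ln T).
{ assert (INR n / 2 - K - X / 8 <= ln T) by (unfold K; lra).
  unfold B in Hn; unfold X in *; lra. }
assert (Hlnr : 0 < ln r) by (rewrite <- ln_1; apply ln_increasing; lra).
assert (Hcon := HT r ltac:(unfold B in Hn; lra)); fold T in Hcon.
assert (Hll : ln (ln T) <= c * ln r).
{ apply (Rmult_le_compat_r (ln r)) in Hcon; [|lra].
  unfold Rdiv in Hcon; rewrite Rmult_assoc, Rinv_l, Rmult_1_r in Hcon by lra; nra. }
assert (HX0 : 0 < X) by lra.
assert (HXe : exp (ln 8 / (1 - c)) <= X) by (unfold B in Hn; unfold X; lra).
assert (HlX : ln 8 / (1 - c) <= ln X).
{ rewrite <- (ln_exp (ln 8 / (1 - c))); apply ln_le; [apply exp_pos|exact HXe]. }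
assert (HlX2 : ln 8 <= (1 - c) * ln X).
{ apply (Rmult_le_compat_r (1 - c)) in HlX; [|lra].
  replace (ln 8 / (1 - c) * (1 - c)) with (ln 8) in HlX by (field; lra); lra. }
assert (HrX : ln r <= ln X) by (apply ln_le; lra).
assert (Hfin : ln (X / 4) <= ln (X / 8)).
{ apply Rle_trans with (ln (ln T)); [apply ln_le; lra|].
  apply Rle_trans with (c * ln X); [nra|].
  rewrite ln_div by lra; lra. }
assert (Hfin2 : ln (X / 8) < ln (X / 4)) by (apply ln_increasing; lra).
lra.
Qed.

(* If [f] were much larger than [W] at one point it would be so on a small disc, and by iteration [Cmod (f (u + n))] would be at least [exp (2 ^ n)] on the translates of that disc. *)
Lemma pointwise_bound (f : C -> C) (W : C -> R) (B D : R) : ccont f ->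
  (forall z, 1 <= W z) -> (forall z u, Cmod u <= 1 -> W (z + u)%C <= D * W z) ->
  exp 1 <= B -> 1 <= D <= B ->
  (forall z, B * W z <= Cmod (f z) -> Cmod (f z) ^ 2 <= Cmod (f (z + 1)%C)) ->
  Rbar_lt (hyper_order f) (Finite 1) ->
  forall z, Cmod (f z) <= 2 * B * D * W z.
Proof.
intros Hf HW1 HWD HB [HD HDB] Hstep Hho z0; apply Rnot_lt_le; intros Hz0.
assert (He1 := exp_pos 1).
assert (HW0 := HW1 z0).
assert (HBD : 1 <= B * D) by (assert (H := exp_ineq1 1 ltac:(lra)); nra).
assert (Hpos : 0 < Cmod (f z0) / 2) by nra.
destruct (Hf z0 _ Hpos) as [d1 [Hd1 H1]].
set (d := Rmin d1 1 / 2).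
assert (Hmin : 0 < Rmin d1 1) by (apply Rmin_glb_lt; lra).
assert (L1 := Rmin_l d1 1); assert (L2 := Rmin_r d1 1).
assert (Hdisc : forall u, Cmod (u - z0) <= d -> B * W u <= Cmod (f u)).
{ intros u Hu; unfold d in Hu.
  assert (K1 := H1 u ltac:(lra)); assert (K2 := HWD z0 (u - z0)%C ltac:(lra)).
  rewrite Cplus_sub_cancel in K2.
  assert (K3 := Cmod_lipschitz (f u) (f z0)).
  apply Rabs_le_between in K3.
  assert (K4 : B * W u <= B * (D * W z0)) by (apply Rmult_le_compat_l; lra); lra. }
apply (double_exp_not_hyper_order_lt_1 f z0 d Hf); [unfold d; lra| |exact Hho].
intros n u Hu.
(* The first conjunct keeps the step applicable: with [v = u + n], the square of [Cmod (f v)] is at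
   least [D * (B * W v)], as [Cmod (f v) >= D], and this dominates [B * W (v + 1)]. *)
assert (Hit : B * W (u + RtoC (INR n))%C <= Cmod (f (u + RtoC (INR n))%C) /\ exp (2 ^ n) <= Cmod (f (u + RtoC (INR n))%C)).
{ induction n as [|n [IH1 IH2]].
  - simpl INR; rewrite Cplus_0_r; simpl pow; assert (K := Hdisc u Hu); split; [exact K|].
    assert (K1 := HW1 u); nra.
  - rewrite S_INR, RtoC_plus, Cplus_assoc; set (v := (u + RtoC (INR n))%C) in *.
    assert (K1 := Hstep _ IH1); split; apply Rle_trans with (2 := K1).
    + assert (K2 := HWD v (RtoC 1) ltac:(rewrite Cmod_1; lra)); assert (K3 := HW1 v).
      assert (K4 : B * W (v + 1)%C <= B * (D * W v)) by (apply Rmult_le_compat_l; lra).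
      assert (D <= Cmod (f v)) by nra; nra.
    + replace (exp (2 ^ S n)) with (exp (2 ^ n) ^ 2).
      * apply pow_incr; split; [left; apply exp_pos|exact IH2].
      * simpl; rewrite Rmult_1_r, <- exp_plus; f_equal; ring. }
apply Rle_trans with (ln (Cmod (f (u + RtoC (INR n))%C))); [|apply Rmax_r].
rewrite <- (ln_exp (2 ^ n)); apply ln_le; [apply exp_pos|apply Hit].
Qed.

(** * Entire functions of polynomial growth *)

Definition has_derivative (F : C -> C) : Prop := exists F', has_deriv F F'.

(** These are the polynomials of degree at most [m]. Characterising them by growth lets inductions
    on the degree proceed by differentiation. *)
Definition poly_growth (m : nat) (F : C -> C) : Prop :=
  has_derivative F /\ exists K, 0 <= K /\ forall z, Cmod (F z) <= K * (1 + Cmod z) ^ m.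

Lemma one_plus_Cmod (z : C) : 1 <= 1 + Cmod z.
Proof. assert (H := Cmod_ge_0 z); lra. Qed.

Lemma pow_ge_1 (x : R) (m : nat) : 1 <= x -> 1 <= x ^ m.
Proof. intros Hx; rewrite <- (pow1 m); apply pow_incr; lra. Qed.

Lemma zero_deriv_const (F : C -> C) : has_deriv F (fun _ => RtoC 0) -> forall z, F z = F (RtoC 0).
Proof.
intros H z; apply Ceq_minus, Cmod_eq_0, Rle_antisym; [|apply Cmod_ge_0].
apply Rle_trans with (0 * Cmod (z - 0)); [|right; ring].
apply (mean_value_ineq F (fun _ => RtoC 0)); [exact H|].
intros; rewrite Cmod_0; apply Rle_refl.
Qed.

(** Cauchy's estimate on the circle of radius [1 + Cmod z] gains one power, since there [1 + Cmod]
    at most doubles. *)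
Lemma poly_growth_deriv (m : nat) (F F' : C -> C) :
  poly_growth (S m) F -> has_deriv F F' -> poly_growth m F'.
Proof.
intros [_ [K [HK H]]] HF; split; [exact (deriv_has_deriv F F' HF)|].
exists (K * 2 ^ S m); split; [apply Rmult_le_pos; [exact HK|apply pow_le; lra]|]; intros z.
assert (Hz := one_plus_Cmod z); set (r := 1 + Cmod z) in *.
replace (K * 2 ^ S m * r ^ m) with (K * (2 * r) ^ S m / r) by (rewrite Rpow_mult_distr; simpl; field; lra).
apply (cauchy_estimate F); [exact HF|lra|]; intros u Hu.
apply (Rle_trans _ _ _ (H _)), Rmult_le_compat_l; [exact HK|].
assert (T := Cmod_triangle z u); assert (T0 := Cmod_ge_0 (z + u)).
apply pow_incr; unfold r in *; lra.
Qed.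

Lemma liouville (F : C -> C) : poly_growth 0 F -> forall z, F z = F (RtoC 0).
Proof.
intros [[F' HF] [K [HK H]]]; apply zero_deriv_const.
apply (has_deriv_ext F F F'); [exact HF|reflexivity|]; intros z.
apply Cmod_eq_0, Rle_antisym; [|apply Cmod_ge_0].
apply le_epsilon; intros e He; rewrite Rplus_0_l.
apply Rle_trans with (K / ((K + 1) / e)).
- apply (cauchy_estimate F); [exact HF|apply Rdiv_lt_0_compat; lra|].
  intros u _; assert (Hu := H (z + u)%C); simpl in Hu; lra.
- replace (K / ((K + 1) / e)) with (e * (K / (K + 1))) by (field; lra).
  rewrite <- (Rmult_1_r e) at 2; apply Rmult_le_compat_l; [lra|].
  apply Rmult_le_reg_r with (K + 1); [lra|]; unfold Rdiv; rewrite Rmult_assoc, Rinv_l; lra.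
Qed.

(** * Growth classes adapted to a half-plane *)

(** [A] and [B] are the exponential rates on the two sides of the line [Re (a * z) = 0]; a negative
    rate means decay away from that line. *)
Definition weight (a : C) (A B : R) (z : C) : R :=
  exp (A * Rmax 0 (Re (a * z)) + B * Rmax 0 (- Re (a * z))).

Definition growth (a : C) (A B : R) (F : C -> C) : Prop :=
  has_derivative F /\
  exists K m, 0 <= K /\ forall z, Cmod (F z) <= K * (1 + Cmod z) ^ m * weight a A B z.

Lemma weight_pos (a : C) (A B : R) (z : C) : 0 < weight a A B z.
Proof. apply exp_pos. Qed.

Lemma weight_mult (a : C) (A B A' B' : R) (z : C) :
  weight a A B z * weight a A' B' z = weight a (A + A') (B + B') z.
Proof. unfold weight; rewrite <- exp_plus; f_equal; ring. Qed.

Lemma exp_le (x y : R) : x <= y -> exp x <= exp y.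
Proof. intros [H| ->]; [left; apply exp_increasing, H|apply Rle_refl]. Qed.

Lemma exp_ge_1 (x : R) : 0 <= x -> 1 <= exp x.
Proof. intros Hx; rewrite <- exp_0; apply exp_le, Hx. Qed.

Lemma weight_mono (a : C) (A B A' B' : R) (z : C) : A <= A' -> B <= B' -> weight a A B z <= weight a A' B' z.
Proof.
intros HA HB; apply exp_le.
assert (H1 := Rmax_l 0 (Re (a * z))); assert (H2 := Rmax_l 0 (- Re (a * z))); nra.
Qed.

Lemma weight_right (a : C) (A B : R) (z : C) : 0 <= Re (a * z) -> weight a A B z = exp (A * Re (a * z)).
Proof. intros H; unfold weight; rewrite Rmax_right, Rmax_left by lra; f_equal; ring. Qed.

Lemma weight_left (a : C) (A B : R) (z : C) : Re (a * z) <= 0 -> weight a A B z = exp (B * - Re (a * z)).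
Proof. intros H; unfold weight; rewrite Rmax_left, Rmax_right by lra; f_equal; ring. Qed.

(** The maps [x -> max 0 x] and [x -> max 0 (- x)] are 1-Lipschitz. This makes the growth classes
    stable under unit shifts, hence under derivatives and [fdiff]. *)
Lemma weight_shift (a : C) (A B : R) (z u : C) :
  weight a A B (z + u) <= exp ((Rabs A + Rabs B) * (Cmod a * Cmod u)) * weight a A B z.
Proof.
unfold weight; rewrite <- exp_plus; apply exp_le.
assert (H : Rabs (Re (a * u)) <= Cmod a * Cmod u) by (rewrite <- Cmod_mult; apply re_le_Cmod).
rewrite Cmult_plus_distr_l, re_plus.
set (x := Re (a * z)); set (y := Re (a * u)) in *; set (s := Cmod a * Cmod u) in *.
apply Rabs_le_between in H.
assert (Hl : forall c p, Rabs (Rmax 0 (p + c) - Rmax 0 p) <= Rabs c).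
{ intros c p; unfold Rmax; destruct (Rle_dec 0 (p + c)), (Rle_dec 0 p); unfold Rabs;
    repeat destruct Rcase_abs; lra. }
assert (H1 := Hl y x); assert (H2 := Hl (- y) (- x)); rewrite Rabs_Ropp in H2.
replace (- x + - y) with (- (x + y)) in H2 by ring.
assert (Hy : Rabs y <= s) by (apply Rabs_le_between; lra).
set (p := Rmax 0 (x + y)) in *; set (p0 := Rmax 0 x) in *.
set (n := Rmax 0 (- (x + y))) in *; set (n0 := Rmax 0 (- x)) in *.
assert (K : forall c d, Rabs d <= s -> c * d <= Rabs c * s).
{ intros c d Hd; apply (Rle_trans _ _ _ (Rle_abs _)); rewrite Rabs_mult; apply Rmult_le_compat_l; [apply Rabs_pos|exact Hd]. }
assert (K1 := K A (p - p0) ltac:(lra)); assert (K2 := K B (n - n0) ltac:(lra)); lra.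
Qed.

Lemma growth_weaken (a : C) (A B A' B' : R) (F : C -> C) : growth a A B F -> A <= A' -> B <= B' -> growth a A' B' F.
Proof.
intros [HF [K [m [HK H]]]] HA HB; split; [exact HF|]; exists K, m; split; [exact HK|]; intros z.
apply (Rle_trans _ _ _ (H z)), Rmult_le_compat_l; [|apply weight_mono; assumption].
apply Rmult_le_pos; [exact HK|apply pow_le; assert (Hz := one_plus_Cmod z); lra].
Qed.

Lemma growth_ext (a : C) (A B : R) (F G : C -> C) : growth a A B F -> (forall z, F z = G z) -> growth a A B G.
Proof.
intros [[F' HF] [K [m [HK H]]]] E; split.
- exists F'; exact (has_deriv_ext F G F' F' HF E (fun _ => eq_refl)).
- exists K, m; split; [exact HK|]; intros z; rewrite <- E; apply H.
Qed.

Lemma growth_plus (a : C) (A B : R) (F G : C -> C) :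
  growth a A B F -> growth a A B G -> growth a A B (fun z => F z + G z)%C.
Proof.
intros [[F' HF] [K [m [HK H]]]] [[G' HG] [K' [m' [HK' H']]]]; split.
- eexists; apply has_deriv_plus; [exact HF|exact HG].
- exists (K + K'), (m + m')%nat; split; [lra|]; intros z.
  apply (Rle_trans _ _ _ (Cmod_triangle _ _)).
  assert (Hz := one_plus_Cmod z); specialize (H z); specialize (H' z).
  assert (Hw := weight_pos a A B z); set (w := weight a A B z) in *; set (r := 1 + Cmod z) in *.
  rewrite pow_add; assert (H1 := pow_ge_1 r m Hz); assert (H2 := pow_ge_1 r m' Hz).
  assert (0 <= K * r ^ m * w) by (apply Rmult_le_pos; [apply Rmult_le_pos; lra|lra]).
  assert (0 <= K' * r ^ m' * w) by (apply Rmult_le_pos; [apply Rmult_le_pos; lra|lra]).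
  replace ((K + K') * (r ^ m * r ^ m') * w) with (K * r ^ m * w * r ^ m' + K' * r ^ m' * w * r ^ m) by ring.
  nra.
Qed.

Lemma growth_mult (a : C) (A B A' B' : R) (F G : C -> C) :
  growth a A B F -> growth a A' B' G -> growth a (A + A') (B + B') (fun z => F z * G z)%C.
Proof.
intros [[F' HF] [K [m [HK H]]]] [[G' HG] [K' [m' [HK' H']]]]; split.
- eexists; apply has_deriv_mult; [exact HF|exact HG].
- exists (K * K'), (m + m')%nat; split; [apply Rmult_le_pos; assumption|]; intros z.
  rewrite Cmod_mult, <- weight_mult, pow_add.
  apply Rle_trans with ((K * (1 + Cmod z) ^ m * weight a A B z) * (K' * (1 + Cmod z) ^ m' * weight a A' B' z)); [|right; ring].
  apply Rmult_le_compat; [apply Cmod_ge_0|apply Cmod_ge_0|apply H|apply H'].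
Qed.

Lemma poly_growth_growth (a : C) (m : nat) (F : C -> C) : poly_growth m F -> growth a 0 0 F.
Proof.
intros [HF [K [HK H]]]; split; [exact HF|]; exists K, m; split; [exact HK|]; intros z.
unfold weight; rewrite !Rmult_0_l, Rplus_0_l, exp_0, Rmult_1_r; apply H.
Qed.

Lemma growth_poly_growth (a : C) (F : C -> C) : growth a 0 0 F -> exists m, poly_growth m F.
Proof.
intros [HF [K [m [HK H]]]]; exists m; split; [exact HF|]; exists K; split; [exact HK|]; intros z.
specialize (H z); unfold weight in H; rewrite !Rmult_0_l, Rplus_0_l, exp_0, Rmult_1_r in H; exact H.
Qed.

Lemma growth_const (a c : C) : growth a 0 0 (fun _ => c).
Proof.
apply (poly_growth_growth a 0); split; [exists (fun _ => RtoC 0); apply has_deriv_const|].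
exists (Cmod c); split; [apply Cmod_ge_0|]; intros z; simpl; lra.
Qed.

Lemma growth_scal (a c : C) (A B : R) (F : C -> C) : growth a A B F -> growth a A B (fun z => c * F z)%C.
Proof.
intros H; assert (K := growth_mult a 0 0 A B (fun _ => c) F (growth_const a c) H).
rewrite !Rplus_0_l in K; exact K.
Qed.

Lemma growth_minus (a : C) (A B : R) (F G : C -> C) :
  growth a A B F -> growth a A B G -> growth a A B (fun z => F z - G z)%C.
Proof.
intros HF HG; apply (growth_ext a A B (fun z => F z + (-1) * G z)%C).
- apply growth_plus; [exact HF|apply growth_scal, HG].
- intros z; ring.
Qed.

Lemma growth_shift_bound (a : C) (A B : R) (F : C -> C) : growth a A B F ->
  exists K m, 0 <= K /\ forall z u, Cmod u <= 1 -> Cmod (F (z + u)%C) <= K * (1 + Cmod z) ^ m * weight a A B z.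
Proof.
intros [_ [K [m [HK H]]]].
set (c := exp ((Rabs A + Rabs B) * (Cmod a * 1))).
assert (Hc : 0 < c) by apply exp_pos.
exists (K * 2 ^ m * c), m; split.
{ apply Rmult_le_pos; [apply Rmult_le_pos; [exact HK|apply pow_le; lra]|lra]. }
intros z u Hu; apply (Rle_trans _ _ _ (H _)).
assert (Hz := one_plus_Cmod z); assert (T := Cmod_triangle z u); assert (T0 := Cmod_ge_0 (z + u)).
assert (Hw := weight_pos a A B z).
replace (K * 2 ^ m * c * (1 + Cmod z) ^ m * weight a A B z) with (K * (2 * (1 + Cmod z)) ^ m * (c * weight a A B z)) by (rewrite Rpow_mult_distr; ring).
apply Rmult_le_compat.
- apply Rmult_le_pos; [exact HK|apply pow_le; lra].
- left; apply weight_pos.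
- apply Rmult_le_compat_l; [exact HK|apply pow_incr; lra].
- apply (Rle_trans _ _ _ (weight_shift a A B z u)), Rmult_le_compat_r; [lra|].
  apply exp_le, Rmult_le_compat_l; [assert (H1 := Rabs_pos A); assert (H2 := Rabs_pos B); lra|].
  apply Rmult_le_compat_l; [apply Cmod_ge_0|exact Hu].
Qed.

Lemma growth_deriv (a : C) (A B : R) (F F' : C -> C) : growth a A B F -> has_deriv F F' -> growth a A B F'.
Proof.
intros HG HF; split; [exact (deriv_has_deriv F F' HF)|].
destruct (growth_shift_bound a A B F HG) as [K [m [HK H]]].
exists K, m; split; [exact HK|]; intros z.
replace (K * (1 + Cmod z) ^ m * weight a A B z) with (K * (1 + Cmod z) ^ m * weight a A B z / 1) by field.
apply (cauchy_estimate F); [exact HF|lra|]; intros u Hu; apply H; lra.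
Qed.

Lemma growth_fdiff (a : C) (A B : R) (F : C -> C) : growth a A B F -> growth a A B (fdiff F).
Proof.
intros HG; apply (growth_minus a A B (fun z => F (z + 1)%C) F); [|exact HG].
split.
- destruct HG as [[F' HF] _]; eexists; apply has_deriv_shift, HF.
- destruct (growth_shift_bound a A B F HG) as [K [m [HK H]]].
  exists K, m; split; [exact HK|]; intros z; apply H; rewrite Cmod_1; lra.
Qed.

Definition cexp (a : C) (s : R) (z : C) : C := Cexp (RtoC s * (a * z)).

Lemma cexp_mult (a : C) (s t : R) (z : C) : (cexp a s z * cexp a t z)%C = cexp a (s + t) z.
Proof. unfold cexp; rewrite <- Cexp_plus; f_equal; rewrite RtoC_plus; ring. Qed.

Lemma cexp_0 (a z : C) : cexp a 0 z = 1%C.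
Proof. unfold cexp; rewrite <- Cexp_0; f_equal; ring. Qed.

Lemma cexp_neq_0 (a : C) (s : R) (z : C) : cexp a s z <> 0%C.
Proof. apply Cexp_neq_0. Qed.

Lemma Cmod_cexp (a : C) (s : R) (z : C) : Cmod (cexp a s z) = exp (s * Re (a * z)).
Proof. unfold cexp; rewrite Cmod_Cexp, re_scal_l; reflexivity. Qed.

Lemma has_deriv_cexp (a : C) (s : R) : has_deriv (cexp a s) (fun z => RtoC s * a * cexp a s z)%C.
Proof.
apply (has_deriv_ext (fun z => Cexp (RtoC s * a * z)) _ (fun z => RtoC s * a * Cexp (RtoC s * a * z))%C).
- apply has_deriv_exp.
- intros z; unfold cexp; f_equal; ring.
- intros z; unfold cexp; do 2 f_equal; ring.
Qed.

Lemma growth_cexp (a : C) (s : R) : growth a s (- s) (cexp a s).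
Proof.
split; [eexists; apply has_deriv_cexp|].
exists 1, O; split; [lra|]; intros z; rewrite Cmod_cexp, pow_O, !Rmult_1_l.
destruct (Rle_lt_dec 0 (Re (a * z))) as [Hx|Hx]; [rewrite weight_right by exact Hx|rewrite weight_left by lra];
  apply exp_le; lra.
Qed.

(** By induction on [m], half of the exponent pays for one factor [1 + x] and the other half for the
    rest. *)
Lemma one_plus_pow_le_exp (m : nat) (d : R) : 0 < d ->
  exists K, 0 < K /\ forall x, 0 <= x -> (1 + x) ^ m <= K * exp (d * x).
Proof.
revert d; induction m as [|m IH]; intros d Hd.
- exists 1; split; [lra|]; intros x Hx; simpl; rewrite Rmult_1_l.
  rewrite <- exp_0; apply exp_le; nra.
- destruct (IH (d / 2) ltac:(lra)) as [K [HK H]].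
  exists ((1 + 2 / d) * K); split.
  { apply Rmult_lt_0_compat; [|exact HK]; assert (0 < 2 / d) by (apply Rdiv_lt_0_compat; lra); lra. }
  intros x Hx; simpl.
  replace ((1 + 2 / d) * K * exp (d * x)) with (((1 + 2 / d) * exp (d / 2 * x)) * (K * exp (d / 2 * x))).
  + apply Rmult_le_compat; [lra|apply pow_le; lra| |apply H, Hx].
    assert (He : 1 + d / 2 * x <= exp (d / 2 * x)).
    { destruct (Req_dec x 0) as [->|Hn]; [rewrite Rmult_0_r, exp_0; lra|left; apply exp_ineq1; nra]. }
    assert (Hdd : 0 < 2 / d) by (apply Rdiv_lt_0_compat; lra).
    apply Rle_trans with ((1 + 2 / d) * (1 + d / 2 * x)); [|apply Rmult_le_compat_l; lra].
    replace ((1 + 2 / d) * (1 + d / 2 * x)) with (1 + x + (2 / d + d / 2 * x)) by (field; lra); nra.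
  + rewrite Rmult_assoc, (Rmult_comm (exp (d / 2 * x)) (K * _)), <- (Rmult_assoc (1 + 2 / d)), <- (Rmult_assoc (1 + 2 / d) K), Rmult_assoc, <- exp_plus.
    f_equal; f_equal; field.
Qed.

Lemma ray_point (a : C) (s : R) : a <> 0%C -> 0 <= s ->
  exists z, Re (a * z) = s /\ Cmod z = s / Cmod a.
Proof.
intros Ha Hs; assert (Ha0 := proj1 (Cmod_gt_0 a) Ha).
exists (RtoC s / a)%C; split.
- replace (a * (RtoC s / a))%C with (RtoC s) by (field; exact Ha); apply re_RtoC.
- rewrite Cmod_div, Cmod_R, Rabs_right by (assumption || lra); reflexivity.
Qed.

(** On the ray where [a * z = s >= 0], half of the decay absorbs the polynomial factor, leaving
    [Cmod c <= Q * exp (A / 2 * s)]. The linear lower bound for [exp] replaces a limit. *)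
Lemma growth_neg_const (a c : C) (A B : R) : a <> 0%C -> A < 0 -> growth a A B (fun _ => c) -> c = 0%C.
Proof.
intros Ha HA [_ [K [m [HK H]]]]; apply NNPP; intros Hc; apply Cmod_gt_0 in Hc.
assert (Ha0 := proj1 (Cmod_gt_0 a) Ha).
set (q := 1 + / Cmod a).
assert (Hq : 1 <= q) by (unfold q; assert (0 < / Cmod a) by (apply Rinv_0_lt_compat, Ha0); lra).
destruct (one_plus_pow_le_exp m (- A / 2) ltac:(lra)) as [K1 [HK1 HE]].
set (Q := K * (q ^ m * K1)).
assert (HQ : 0 <= Q) by (unfold Q; apply Rmult_le_pos; [exact HK|apply Rmult_le_pos; [apply pow_le; lra|lra]]).
assert (Hall : forall s, 0 <= s -> Cmod c * (1 + - A / 2 * s) <= Q).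
{ intros s Hs; destruct (ray_point a s Ha Hs) as [z [Hz1 Hz2]].
  assert (Hs2 := H z); rewrite weight_right, Hz1, Hz2 in Hs2 by (rewrite Hz1; exact Hs).
  assert (Hp : (1 + s / Cmod a) ^ m <= q ^ m * (K1 * exp (- A / 2 * s))).
  { apply Rle_trans with (q ^ m * (1 + s) ^ m).
    - rewrite <- Rpow_mult_distr; apply pow_incr.
      assert (0 < / Cmod a) by (apply Rinv_0_lt_compat, Ha0).
      unfold q, Rdiv; split; nra.
    - apply Rmult_le_compat_l; [apply pow_le; lra|apply HE, Hs]. }
  assert (He : Cmod c <= Q * exp (A / 2 * s)).
  { apply (Rle_trans _ _ _ Hs2).
    apply Rle_trans with (K * (q ^ m * (K1 * exp (- A / 2 * s))) * exp (A * s)).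
    - apply Rmult_le_compat_r; [left; apply exp_pos|apply Rmult_le_compat_l; assumption].
    - right; unfold Q; replace (exp (A / 2 * s)) with (exp (- A / 2 * s) * exp (A * s)) by (rewrite <- exp_plus; f_equal; field); ring. }
  apply Rle_trans with (Cmod c * exp (- A / 2 * s)).
  - apply Rmult_le_compat_l; [lra|].
    destruct (Req_dec s 0) as [->|Hn]; [rewrite Rmult_0_r, exp_0; lra|left; apply exp_ineq1; nra].
  - apply (Rmult_le_compat_r (exp (- A / 2 * s))) in He; [|left; apply exp_pos].
    rewrite Rmult_assoc, <- exp_plus in He.
    replace (A / 2 * s + - A / 2 * s) with 0 in He by field; rewrite exp_0 in He; lra. }
(* For this [s] the inequality [Hall] reads [Cmod c + Q <= Q]. *)
set (s := 2 * Q / (- A * Cmod c)).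
assert (Hs : 0 <= s).
{ unfold s; apply Rmult_le_pos; [lra|left; apply Rinv_0_lt_compat; nra]. }
assert (Hf := Hall s Hs).
replace (Cmod c * (1 + - A / 2 * s)) with (Cmod c + Q) in Hf by (unfold s; field; split; lra); lra.
Qed.

(* Induction on the degree of the polynomial bound: the derivative decays too and has smaller degree. *)
Lemma poly_decay_zero (a : C) (A B : R) (m : nat) (F : C -> C) : a <> 0%C -> A < 0 ->
  poly_growth m F -> growth a A B F -> forall z, F z = 0%C.
Proof.
intros Ha HA; revert F.
assert (Hc : forall F, growth a A B F -> (forall z, F z = F (RtoC 0)) -> forall z, F z = 0%C).
{ intros F HG Hcst z; rewrite Hcst; apply (growth_neg_const a _ A B Ha HA).
  exact (growth_ext a A B F _ HG Hcst). }
induction m as [|m IH]; intros F HP HG; apply Hc; try exact HG.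
- apply liouville, HP.
- destruct HP as [[F' HF] HP]; apply zero_deriv_const.
  apply (has_deriv_ext F F F'); [exact HF|reflexivity|].
  apply IH; [|exact (growth_deriv a A B F F' HG HF)].
  apply (poly_growth_deriv m F); [split; [exists F'; exact HF|exact HP]|exact HF].
Qed.

Lemma growth_decay_zero (a : C) (A B : R) (F : C -> C) : a <> 0%C -> A < 0 ->
  growth a 0 0 F -> growth a A B F -> forall z, F z = 0%C.
Proof.
intros Ha HA HP; destruct (growth_poly_growth a F HP) as [m Hm]; apply (poly_decay_zero a A B m F); assumption.
Qed.

(** The device for comparing exponentials: the remaining terms of an identity supply the rate
    [mu < s], and multiplication by [cexp a (- s)] leaves [F] decaying on the right. *)
Lemma leading_coeff_zero (a : C) (s mu B : R) (F : C -> C) : a <> 0%C -> mu < s ->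
  growth a 0 0 F -> growth a mu B (fun z => F z * cexp a s z)%C -> forall z, F z = 0%C.
Proof.
intros Ha Hs HP HG; apply (growth_decay_zero a (mu + - s) (B + - - s) F Ha ltac:(lra) HP).
apply (growth_ext a _ _ (fun z => F z * cexp a s z * cexp a (- s) z)%C).
- apply growth_mult; [exact HG|apply growth_cexp].
- intros z; rewrite <- Cmult_assoc, cexp_mult, Rplus_opp_r, cexp_0; ring.
Qed.

Lemma leading_const_zero (a c : C) (s mu B : R) : a <> 0%C -> mu < s ->
  growth a mu B (fun z => c * cexp a s z)%C -> c = 0%C.
Proof.
intros Ha Hs HG; exact (leading_coeff_zero a s mu B (fun _ => c) Ha Hs (growth_const a c) HG (RtoC 0)).
Qed.

(** * First-order linear equations *)

Lemma exp_ode (F F' : C -> C) (mu : C) : has_deriv F F' -> (forall z, F' z = mu * F z)%C ->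
  exists c, forall z, F z = (c * Cexp (mu * z))%C.
Proof.
intros HF E; exists (F (RtoC 0)); intros z.
assert (H : has_deriv (fun z => F z * Cexp (- mu * z))%C (fun _ => RtoC 0)).
{ apply (has_deriv_ext (fun z => F z * Cexp (- mu * z))%C _ (fun z => F' z * Cexp (- mu * z) + F z * (- mu * Cexp (- mu * z)))%C).
  - apply has_deriv_mult; [exact HF|apply has_deriv_exp].
  - reflexivity.
  - intros w; rewrite E; ring. }
assert (K := zero_deriv_const _ H z); simpl in K.
rewrite Cmult_0_r, Cexp_0, Cmult_1_r in K; rewrite <- K, <- Cmult_assoc, <- Cexp_plus.
replace (- mu * z + mu * z)%C with (RtoC 0) by ring; rewrite Cexp_0; ring.
Qed.

(** Induction on the degree bound: if [P] solves the equation for [M'], then [(P - M) / mu] solves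
    it for [M]. *)
Lemma poly_ode (mu : C) (m : nat) (M : C -> C) : mu <> 0%C -> poly_growth m M ->
  exists P P', (exists k, poly_growth k P) /\ has_deriv P P' /\ forall z, (P' z - mu * P z = M z)%C.
Proof.
intros Hmu; revert M; induction m as [|m IH]; intros M HM.
- exists (fun _ => - M (RtoC 0) / mu)%C, (fun _ => RtoC 0); split; [|split].
  + destruct (growth_poly_growth (RtoC 1) _ (growth_const (RtoC 1) (- M (RtoC 0) / mu)%C)) as [k Hk]; exists k; exact Hk.
  + apply has_deriv_const.
  + intros z; rewrite (liouville M HM z); field; exact Hmu.
- assert (HM2 := HM); destruct HM2 as [[M' HM'] _].
  destruct (IH M' (poly_growth_deriv m M M' HM HM')) as [P [P' [[k Hk] [HP E]]]].
  exists (fun z => / mu * (P z - M z))%C, (fun z => / mu * (P' z - M' z))%C; split; [|split].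
  + apply (growth_poly_growth (RtoC 1)), growth_scal, growth_minus; eapply poly_growth_growth; eassumption.
  + apply has_deriv_scal, has_deriv_minus; assumption.
  + intros z; replace (M' z) with (P' z - mu * P z)%C by apply E; field; exact Hmu.
Qed.

Lemma affine_exp_ode (a mu : C) (F F' M : C -> C) : mu <> 0%C -> growth a 0 0 M -> has_deriv F F' ->
  (forall z, F' z - mu * F z = M z)%C ->
  exists c P, growth a 0 0 P /\ forall z, F z = (c * Cexp (mu * z) + P z)%C.
Proof.
intros Hmu HM HF E; destruct (growth_poly_growth a M HM) as [m Hm].
destruct (poly_ode mu m M Hmu Hm) as [P [P' [[k Hk] [HP EP]]]].
destruct (exp_ode (fun z => F z - P z)%C (fun z => F' z - P' z)%C mu) as [c Hc].
- apply has_deriv_minus; assumption.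
- intros z; replace (F' z) with (mu * F z + (F' z - mu * F z))%C by ring.
  replace (P' z) with (mu * P z + (P' z - mu * P z))%C by ring; rewrite E, EP; ring.
- exists c, P; split; [exact (poly_growth_growth a k P Hk)|].
  intros z; rewrite <- Hc; ring.
Qed.

(** * Division by a function of size [exp (x / 3)] *)

(** The threshold for [exp (Re (a * z))] is a power of [1 + Cmod z], because the equation bounds [f]
    from below only where the leading exponential beats the polynomial factors of the other
    terms. *)
Definition large_right (a : C) (f : C -> C) : Prop :=
  exists c K m, 0 < c /\ 1 <= K /\ forall z, 0 <= Re (a * z) ->
    K * (1 + Cmod z) ^ m <= exp (Re (a * z)) -> c * exp (Re (a * z) / 3) <= Cmod (f z).

(* Where [exp x] is below the polynomial threshold of [large_right], all exponentials in [x] are polynomially bounded and the a priori bound on [F] suffices. *)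
Lemma growth_div (a : C) (f F : C -> C) (A B n B' : R) : large_right a f -> growth a A B F ->
  growth a n B' (fun z => f z * F z)%C -> growth a (n - 1 / 3) B F.
Proof.
intros [c [K [m [Hc [HK Hf]]]]] [HF [K1 [m1 [HK1 H1]]]] [_ [K2 [m2 [HK2 H2]]]]; split; [exact HF|].
(* Below the threshold, the surplus of the rate [A] over [n - 1 / 3] costs at most the [k]-th power
   of [K * (1 + Cmod z) ^ m]. *)
destruct (INR_unbounded (A - (n - 1 / 3))) as [k Hk].
exists (K1 * K ^ k + K2 / c), (m1 + m * k + m2)%nat; split.
{ apply Rplus_le_le_0_compat; apply Rmult_le_pos; try assumption; [apply pow_le; lra|left; apply Rinv_0_lt_compat, Hc]. }
intros z; assert (Hz := one_plus_Cmod z); specialize (H1 z); specialize (H2 z).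
set (r := 1 + Cmod z) in *; set (x := Re (a * z)) in *.
assert (P1 := pow_ge_1 r m1 Hz); assert (P2 := pow_ge_1 r m2 Hz); assert (P3 := pow_ge_1 r (m * k) Hz).
assert (P4 := pow_ge_1 K k HK).
assert (Hc' : 0 <= K2 / c) by (apply Rmult_le_pos; [exact HK2|left; apply Rinv_0_lt_compat, Hc]).
rewrite !pow_add.
set (R1 := r ^ m1) in *; set (R2 := r ^ m2) in *; set (R3 := r ^ (m * k)) in *.
assert (Pr : R1 <= R1 * R3 /\ R1 <= R1 * R3 * R2 /\ R2 <= R1 * R3 * R2 /\ R1 * R3 <= R1 * R3 * R2).
{ assert (1 <= R1 * R3) by nra; repeat split; nra. }
destruct Pr as [Pr1 [Pr2 [Pr3 Pr4]]].
destruct (Rle_lt_dec 0 x) as [Hx|Hx].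
2:{ rewrite weight_left in * by (fold x; lra); fold x in H1 |- *.
  assert (He := exp_pos (B * - x)).
  apply (Rle_trans _ _ _ H1), Rmult_le_compat_r; [lra|].
  apply Rle_trans with (K1 * (R1 * R3 * R2)); [apply Rmult_le_compat_l; assumption|].
  apply Rmult_le_compat_r; [lra|nra]. }
rewrite weight_right in * by (fold x; exact Hx); fold x in H1, H2 |- *.
assert (He := exp_pos ((n - 1 / 3) * x)).
destruct (Rle_lt_dec (K * r ^ m) (exp x)) as [Hbig|Hsmall].
- assert (Hfz := Hf z Hx Hbig); fold x in Hfz; rewrite Cmod_mult in H2.
  assert (He3 := exp_pos (x / 3)); assert (HFz := Cmod_ge_0 (F z)).
  assert (L : c * exp (x / 3) * Cmod (F z) <= K2 * R2 * exp (n * x)) by nra.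
  assert (L2 : Cmod (F z) <= K2 / c * R2 * exp ((n - 1 / 3) * x)).
  { apply Rmult_le_reg_l with (c * exp (x / 3)); [nra|].
    replace (c * exp (x / 3) * (K2 / c * R2 * exp ((n - 1 / 3) * x))) with
      (K2 * R2 * (exp (x / 3) * exp ((n - 1 / 3) * x))) by (field; lra).
    rewrite <- exp_plus; replace (x / 3 + (n - 1 / 3) * x) with (n * x) by field; exact L. }
  apply (Rle_trans _ _ _ L2), Rmult_le_compat_r; [lra|].
  apply Rle_trans with (K2 / c * (R1 * R3 * R2)); [apply Rmult_le_compat_l; assumption|].
  apply Rmult_le_compat_r; [lra|nra].
- assert (L : exp (A * x) <= K ^ k * R3 * exp ((n - 1 / 3) * x)).
  { apply Rle_trans with (exp (INR k * x) * exp ((n - 1 / 3) * x)).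
    - rewrite <- exp_plus; apply exp_le; nra.
    - apply Rmult_le_compat_r; [lra|].
      replace (K ^ k * R3) with ((K * r ^ m) ^ k) by (unfold R3; rewrite Rpow_mult_distr, pow_mult; reflexivity).
      replace (exp (INR k * x)) with (exp x ^ k); [apply pow_incr; split; [left; apply exp_pos|lra]|].
      clear; induction k as [|k IH]; [simpl; rewrite Rmult_0_l, exp_0; reflexivity|].
      rewrite S_INR; simpl; rewrite IH, <- exp_plus; f_equal; ring. }
  apply (Rle_trans _ _ _ H1).
  apply Rle_trans with (K1 * R1 * (K ^ k * R3 * exp ((n - 1 / 3) * x))); [apply Rmult_le_compat_l; [nra|exact L]|].
  replace (K1 * R1 * (K ^ k * R3 * exp ((n - 1 / 3) * x))) with (K1 * K ^ k * (R1 * R3) * exp ((n - 1 / 3) * x)) by ring.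
  apply Rmult_le_compat_r; [lra|].
  assert (0 <= K1 * K ^ k) by nra.
  apply Rle_trans with (K1 * K ^ k * (R1 * R3 * R2)); [apply Rmult_le_compat_l; assumption|].
  apply Rmult_le_compat_r; [lra|lra].
Qed.

Lemma growth_id (a : C) : growth a 0 0 (fun z => z).
Proof.
apply (poly_growth_growth a 1); split; [eexists; apply has_deriv_id|].
exists 1; split; [lra|]; intros z; simpl; lra.
Qed.

Lemma growth_polynomial (a : C) (q : C -> C) : is_polynomial q -> growth a 0 0 q.
Proof.
intros [n [c Hq]].
assert (Hpow : forall i, growth a 0 0 (fun z : C => @pow_n C_Ring z i)).
{ induction i as [|i IH].
  - exact (growth_const a (RtoC 1)).
  - assert (K := growth_mult a 0 0 0 0 _ _ (growth_id a) IH); rewrite !Rplus_0_l in K; exact K. }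
apply (growth_ext a 0 0 (fun z => sum_n (fun i => mult (c i) (pow_n z i)) n)); [|intros z; symmetry; apply Hq].
clear Hq; induction n as [|n IH].
- apply (growth_ext a 0 0 (fun z : C => c O * @pow_n C_Ring z 0)%C); [apply growth_scal, Hpow|].
  intros z; rewrite sum_O; reflexivity.
- apply (growth_ext a 0 0 (fun z : C => sum_n (fun i => mult (c i) (pow_n z i)) n + c (S n) * @pow_n C_Ring z (S n))%C).
  + apply growth_plus; [exact IH|apply growth_scal, Hpow].
  + intros z; rewrite sum_Sn; reflexivity.
Qed.

(** * The a priori bound on solutions *)

Definition two_exp_weight (a1 a2 : C) (z : C) : R :=
  1 + exp (Re (a1 * z) / 3) + exp (Re (a2 * z) / 3).

Lemma two_exp_weight_shift (a1 a2 z u : C) : Cmod u <= 1 ->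
  two_exp_weight a1 a2 (z + u) <= exp ((Cmod a1 + Cmod a2) / 3) * two_exp_weight a1 a2 z.
Proof.
intros Hu; unfold two_exp_weight.
assert (Hb : forall a, Re (a * (z + u)) <= Re (a * z) + Cmod a).
{ intros a; rewrite Cmult_plus_distr_l, re_plus.
  assert (H := Rle_trans _ _ _ (Rle_abs _) (re_le_Cmod (a * u))); rewrite Cmod_mult in H.
  assert (Ha := Cmod_ge_0 a); nra. }
assert (H1 := Hb a1); assert (H2 := Hb a2); assert (C1 := Cmod_ge_0 a1); assert (C2 := Cmod_ge_0 a2).
rewrite !Rmult_plus_distr_l, Rmult_1_r, <- !exp_plus.
assert (E0 : 1 <= exp ((Cmod a1 + Cmod a2) / 3)) by (apply exp_ge_1; lra).
assert (E1 : exp (Re (a1 * (z + u)) / 3) <= exp ((Cmod a1 + Cmod a2) / 3 + Re (a1 * z) / 3)) by (apply exp_le; lra).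
assert (E2 : exp (Re (a2 * (z + u)) / 3) <= exp ((Cmod a1 + Cmod a2) / 3 + Re (a2 * z) / 3)) by (apply exp_le; lra).
lra.
Qed.

Lemma two_exp_weight_ge_1 (a1 a2 z : C) : 1 <= two_exp_weight a1 a2 z.
Proof.
unfold two_exp_weight; assert (H1 := exp_pos (Re (a1 * z) / 3)); assert (H2 := exp_pos (Re (a2 * z) / 3)); lra.
Qed.

Lemma exp_cube (x : R) : exp x = exp (x / 3) ^ 3.
Proof. simpl; rewrite Rmult_1_r, <- !exp_plus; f_equal; field. Qed.

Lemma two_exp_weight_cube (a1 a2 p1 p2 z : C) :
  Cmod (p1 * Cexp (a1 * z) + p2 * Cexp (a2 * z)) <= (Cmod p1 + Cmod p2) * two_exp_weight a1 a2 z ^ 3.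
Proof.
apply (Rle_trans _ _ _ (Cmod_triangle _ _)); rewrite !Cmod_mult, !Cmod_Cexp, !(exp_cube (Re _)).
unfold two_exp_weight; assert (H1 := exp_pos (Re (a1 * z) / 3)); assert (H2 := exp_pos (Re (a2 * z) / 3)).
assert (C1 := Cmod_ge_0 p1); assert (C2 := Cmod_ge_0 p2).
rewrite Rmult_plus_distr_r; apply Rplus_le_compat; apply Rmult_le_compat_l; try assumption; apply pow_incr; lra.
Qed.

(** Where [|f| >= B W], the summands [4 * P] and [4 * Q] of [B] make the right-hand side at most
    [|f|^3 / 4] and [|q|] at most [|f| / 4]. The equation then gives
    [|f (z + 1)| >= 3 |f|^2 - |f| >= |f|^2], as [pointwise_bound] requires. *)
Lemma solution_bound (q f p : C -> C) (a1 a2 : C) (P : R) : (exists m, poly_growth m q) -> has_derivative f ->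
  Rbar_lt (hyper_order f) (Finite 1) -> 0 <= P ->
  (forall z, Cmod (p z) <= P * two_exp_weight a1 a2 z ^ 3) ->
  (forall z, (f z * f z * f z + q z * fdiff f z)%C = p z) ->
  exists K m, 0 <= K /\ forall z, Cmod (f z) <= K * (1 + Cmod z) ^ m * two_exp_weight a1 a2 z.
Proof.
intros [m [_ [Q [HQ Hq]]]] [f' Hf] Hho HP Hp Heq.
set (e := exp ((Cmod a1 + Cmod a2) / 3)).
assert (C1 := Cmod_ge_0 a1); assert (C2 := Cmod_ge_0 a2).
assert (He : 1 <= e) by (unfold e; apply exp_ge_1; lra).
set (D := 2 ^ m * e).
assert (H2m := pow_ge_1 2 m ltac:(lra)).
assert (HD : 1 <= D) by (unfold D; nra).
assert (He1 := exp_pos 1).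
set (B := D + exp 1 + 4 * P + 4 * Q).
set (W := fun z => (1 + Cmod z) ^ m * two_exp_weight a1 a2 z).
assert (HW : forall z, 1 <= (1 + Cmod z) ^ m /\ (1 + Cmod z) ^ m <= W z /\ two_exp_weight a1 a2 z <= W z /\ 1 <= W z).
{ intros z; assert (K1 := pow_ge_1 _ m (one_plus_Cmod z)); assert (K2 := two_exp_weight_ge_1 a1 a2 z).
  unfold W; repeat split; nra. }
exists (2 * B * D), m; split; [unfold B; apply Rmult_le_pos; lra|].
intros z; rewrite Rmult_assoc; change (Cmod (f z) <= 2 * B * D * W z); revert z.
apply (pointwise_bound f W B D (has_deriv_ccont f f' Hf)); [intros z; apply HW| |unfold B; lra|unfold B; lra| |exact Hho].
- intros z u Hu; unfold W, D.
  replace (2 ^ m * e * ((1 + Cmod z) ^ m * two_exp_weight a1 a2 z)) with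
    ((2 * (1 + Cmod z)) ^ m * (e * two_exp_weight a1 a2 z)) by (rewrite Rpow_mult_distr; ring).
  assert (T := Cmod_triangle z u); assert (T0 := Cmod_ge_0 (z + u)); assert (T1 := Cmod_ge_0 z).
  apply Rmult_le_compat; [apply pow_le; lra|assert (K := two_exp_weight_ge_1 a1 a2 (z + u)); lra| |apply two_exp_weight_shift, Hu].
  apply pow_incr; lra.
- intros z Hz; destruct (HW z) as [W1 [W2 [W3 W4]]].
  set (F := Cmod (f z)) in *; set (F1 := Cmod (f (z + 1)%C)).
  assert (HF1 : 0 <= F1) by apply Cmod_ge_0.
  assert (HB : 1 <= B) by (unfold B; lra).
  assert (HF : 1 <= F) by nra.
  assert (Hmain : F ^ 3 <= P * two_exp_weight a1 a2 z ^ 3 + Q * (1 + Cmod z) ^ m * (F1 + F)).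
  { replace (F ^ 3) with (Cmod (f z * f z * f z)) by (rewrite !Cmod_mult; fold F; ring).
    replace (f z * f z * f z)%C with (p z - q z * fdiff f z)%C by (rewrite <- Heq; ring).
    apply (Rle_trans _ _ _ (Cmod_triangle_minus _ _)), Rplus_le_compat; [apply Hp|].
    rewrite Cmod_mult; apply Rmult_le_compat; [apply Cmod_ge_0|apply Cmod_ge_0|apply Hq|apply Cmod_triangle_minus]. }
  set (S := two_exp_weight a1 a2 z) in *; set (r := (1 + Cmod z) ^ m) in *.
  assert (HS : B * S <= F) by nra; assert (Hr : B * r <= F) by nra.
  assert (HS0 : 1 <= S) by apply two_exp_weight_ge_1.
  assert (I1 : 4 * (P * S ^ 3) <= F ^ 3).
  { apply Rle_trans with (B * S ^ 3); [unfold B; assert (0 <= S ^ 3) by (apply pow_le; lra); nra|].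
    apply Rle_trans with ((B * S) ^ 3); [|apply pow_incr; nra].
    rewrite Rpow_mult_distr; apply Rmult_le_compat_r; [apply pow_le; lra|]; simpl; nra. }
  assert (I2 : 4 * (Q * r * (F1 + F)) <= F * (F1 + F)).
  { assert (4 * Q * r <= F) by (unfold B in *; nra); nra. }
  assert (I3 : F * (3 * F ^ 2 - F) <= F * F1) by (simpl in *; nra).
  apply Rmult_le_reg_l in I3; [|lra]; simpl in *; nra.
Qed.

Lemma deriv_bound_shift (h h' : C -> C) (a1 a2 : C) (K : R) (m : nat) : has_deriv h h' -> 0 <= K ->
  (forall z, Cmod (h z) <= K * (1 + Cmod z) ^ m * two_exp_weight a1 a2 z) ->
  exists K', 0 <= K' /\ (forall z u, Cmod u <= 1 -> Cmod (h (z + u)%C) <= K' * (1 + Cmod z) ^ m * two_exp_weight a1 a2 z) /\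
    (forall z, Cmod (h' z) <= K' * (1 + Cmod z) ^ m * two_exp_weight a1 a2 z).
Proof.
intros Hh HK H.
set (e := exp ((Cmod a1 + Cmod a2) / 3)).
assert (He : 0 < e) by apply exp_pos.
assert (Hsh : forall z u, Cmod u <= 1 -> Cmod (h (z + u)%C) <= K * 2 ^ m * e * (1 + Cmod z) ^ m * two_exp_weight a1 a2 z).
{ intros z u Hu; apply (Rle_trans _ _ _ (H _)).
  replace (K * 2 ^ m * e * (1 + Cmod z) ^ m * two_exp_weight a1 a2 z) with
    (K * (2 * (1 + Cmod z)) ^ m * (e * two_exp_weight a1 a2 z)) by (rewrite Rpow_mult_distr; ring).
  assert (T := Cmod_triangle z u); assert (T0 := Cmod_ge_0 (z + u)); assert (T1 := Cmod_ge_0 z).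
  apply Rmult_le_compat.
  - apply Rmult_le_pos; [exact HK|apply pow_le; lra].
  - assert (L := two_exp_weight_ge_1 a1 a2 (z + u)); lra.
  - apply Rmult_le_compat_l; [exact HK|apply pow_incr; lra].
  - apply two_exp_weight_shift, Hu. }
exists (K * 2 ^ m * e); split; [|split; [exact Hsh|]].
- apply Rmult_le_pos; [apply Rmult_le_pos; [exact HK|apply pow_le; lra]|lra].
- intros z; rewrite <- (Rdiv_1_r (_ * two_exp_weight a1 a2 z)).
  apply (cauchy_estimate h); [exact Hh|lra|]; intros u Hu; apply Hsh; lra.
Qed.

(** * Frequencies with non-real quotient *)

(* At the zeros of [p1 e^(a1 z) + p2 e^(a2 z)] lying in [Re (a1 z) > 0], the cube of [f] and hence its derivative [3 f^2 f'] are too small to match the derivative of the right-hand side. *)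
Lemma nonreal_quotient_contradiction (q f : C -> C) (p1 p2 a1 a2 : C) :
  (exists m, poly_growth m q) -> has_derivative f -> Rbar_lt (hyper_order f) (Finite 1) ->
  p1 <> 0%C -> p2 <> 0%C -> a1 <> a2 ->
  (forall z, (f z * f z * f z + q z * fdiff f z)%C = (p1 * Cexp (a1 * z) + p2 * Cexp (a2 * z))%C) ->
  Re (a1 * Ci / (a1 - a2)) = 0.
Proof.
intros Hq Hfd Hho Hp1 Hp2 Ha12 Heq; apply NNPP; intros Hne.
assert (Hd : (a1 - a2)%C <> 0%C) by (apply Cminus_eq_contra, Ha12).
assert (Hpi := PI_RGT_0).
destruct (solution_bound q f (fun z => p1 * Cexp (a1 * z) + p2 * Cexp (a2 * z))%C a1 a2 (Cmod p1 + Cmod p2) Hq Hfd Hho) with (3 := Heq) as [K [m [HK Hf]]].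
{ apply Rplus_le_le_0_compat; apply Cmod_ge_0. }
{ intros z; apply two_exp_weight_cube. }
destruct Hfd as [f' Hf'].
destruct (deriv_bound_shift f f' a1 a2 K m Hf' HK Hf) as [K' [HK' [Hsh Hfp]]].
destruct Hq as [mq [[q' Hq'] [Q [HQ Hq]]]].
set (N := fun z => (q z * fdiff f z)%C).
set (N' := fun z => (q' z * fdiff f z + q z * (f' (z + 1) - f' z))%C).
assert (HN' : has_deriv N N').
{ apply has_deriv_mult; [exact Hq'|]; apply (has_deriv_minus (fun z => f (z + 1)%C)); [apply has_deriv_shift, Hf'|exact Hf']. }
assert (HNb : forall z, Cmod (N z) <= Q * (2 * K') * (1 + Cmod z) ^ (mq + m) * two_exp_weight a1 a2 z).
{ intros z; unfold N; rewrite Cmod_mult, pow_add.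
  replace (Q * (2 * K') * ((1 + Cmod z) ^ mq * (1 + Cmod z) ^ m) * two_exp_weight a1 a2 z) with
    ((Q * (1 + Cmod z) ^ mq) * (2 * (K' * (1 + Cmod z) ^ m * two_exp_weight a1 a2 z))) by ring.
  apply Rmult_le_compat; [apply Cmod_ge_0|apply Cmod_ge_0|apply Hq|].
  apply (Rle_trans _ _ _ (Cmod_triangle_minus _ _)).
  assert (L1 := Hsh z (RtoC 1) ltac:(rewrite Cmod_1; lra)).
  assert (L2 := Hsh z (RtoC 0) ltac:(rewrite Cmod_0; lra)); rewrite Cplus_0_r in L2; lra. }
destruct (deriv_bound_shift N N' a1 a2 (Q * (2 * K')) (mq + m)%nat HN' ltac:(apply Rmult_le_pos; lra) HNb) as [K2 [HK2 [HN2 HNp]]].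
assert (Hderiv : forall z, (3 * (f z * f z) * f' z + N' z = p1 * (a1 * Cexp (a1 * z)) + p2 * (a2 * Cexp (a2 * z)))%C).
{ intros z; refine (has_deriv_unique (fun z => p1 * Cexp (a1 * z) + p2 * Cexp (a2 * z))%C
    (fun z => 3 * (f z * f z) * f' z + N' z)%C
    (fun z => p1 * (a1 * Cexp (a1 * z)) + p2 * (a2 * Cexp (a2 * z)))%C _ _ z).
  - apply (has_deriv_ext (fun z => f z * f z * f z + N z)%C _ (fun z => (f' z * f z + f z * f' z) * f z + f z * f z * f' z + N' z)%C).
    + apply has_deriv_plus; [|exact HN']; apply (has_deriv_mult (fun z => f z * f z)%C); [apply has_deriv_mult|]; exact Hf'.
    + intros w; exact (Heq w).
    + intros w; ring.
  - apply has_deriv_plus; apply has_deriv_scal, has_deriv_exp. }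
destruct (Cexp_surj (- p2 / p1)) as [L HL].
{ intros E; apply Hp2; replace p2 with (- (- p2 / p1) * p1)%C by (field; exact Hp1); rewrite E; ring. }
set (sg := if Rlt_dec 0 (Re (a1 * Ci / (a1 - a2))) then 1 else -1).
assert (Hsg : 0 < sg * Re (a1 * Ci / (a1 - a2))) by (unfold sg; destruct Rlt_dec; lra).
(* Since [(a1 - a2) v] is [2 pi i] or [- 2 pi i] and [exp ((a1 - a2) u) = - p2 / p1], the points
   [u + n v] are zeros of the right-hand side. The sign [sg] makes [Re (a1 z)] increase along
   them. *)
set (v := (RtoC (sg * (2 * PI)) * (Ci / (a1 - a2)))%C); set (u := (L / (a1 - a2))%C).
set (b := Re (a1 * v)).
assert (Hb : 0 < b).
{ unfold b, v; replace (a1 * (RtoC (sg * (2 * PI)) * (Ci / (a1 - a2))))%C with (RtoC (sg * (2 * PI)) * (a1 * Ci / (a1 - a2)))%C by (field; exact Hd).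
  rewrite re_scal_l; nra. }
set (w := fun n : nat => (u + RtoC (INR n) * v)%C).
assert (Hzero : forall n, (p1 * Cexp (a1 * w n) = - (p2 * Cexp (a2 * w n)))%C).
{ intros n; replace (a1 * w n)%C with ((a1 - a2) * w n + a2 * w n)%C by ring; rewrite Cexp_plus.
  replace ((a1 - a2) * w n)%C with (L + RtoC (INR n) * (RtoC (sg * (2 * PI)) * Ci))%C by (unfold w, u, v; field; exact Hd).
  rewrite Cexp_plus, HL.
  replace (Cexp (RtoC (INR n) * (RtoC (sg * (2 * PI)) * Ci))) with (RtoC 1).
  - field; exact Hp1.
  - assert (E := Cexp_2PI n); unfold sg; destruct Rlt_dec.
    + rewrite <- E; f_equal; unfold Ci, RtoC, Cmult; simpl; f_equal; ring.
    + assert (E2 := Cexp_opp (0, 2 * INR n * PI)); rewrite E, Cmult_1_l in E2; rewrite <- E2.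
      f_equal; unfold Ci, RtoC, Cmult, Copp; simpl; f_equal; ring. }
set (X := fun n => Re (a1 * w n)).
assert (HX : forall n, X n = Re (a1 * u) + INR n * b).
{ intros n; unfold X, w, b; replace (a1 * (u + RtoC (INR n) * v))%C with (a1 * u + RtoC (INR n) * (a1 * v))%C by ring.
  rewrite re_plus, re_scal_l; reflexivity. }
set (k2 := Cmod p1 / Cmod p2).
assert (P1 := proj1 (Cmod_gt_0 p1) Hp1); assert (P2 := proj1 (Cmod_gt_0 p2) Hp2).
assert (Hk2 : 0 < k2) by (apply Rdiv_lt_0_compat; assumption).
(* At a zero the two exponentials have moduli in the fixed ratio [k2], so the weight is of order
   [exp (X / 3)] there. *)
assert (He2 : forall n, exp (Re (a2 * w n)) = k2 * exp (X n)).
{ intros n; assert (E := f_equal Cmod (Hzero n)); rewrite Cmod_opp, !Cmod_mult, !Cmod_Cexp in E; fold (X n) in E.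
  unfold k2; replace (Cmod p1 / Cmod p2 * exp (X n)) with (Cmod p1 * exp (X n) / Cmod p2) by (field; lra); rewrite E; field; lra. }
set (k3 := 3 + k2).
assert (HS : forall n, 0 <= X n -> two_exp_weight a1 a2 (w n) <= k3 * exp (X n / 3)).
{ intros n Hn; unfold two_exp_weight; fold (X n).
  assert (E1 : 1 <= exp (X n / 3)) by (apply exp_ge_1; lra).
  assert (E2 : exp (Re (a2 * w n) / 3) <= (1 + k2) * exp (X n / 3)).
  { apply Rnot_lt_le; intros Hlt.
    assert (E3 := He2 n); rewrite (exp_cube (Re _)), (exp_cube (X n)) in E3.
    assert (E4 : ((1 + k2) * exp (X n / 3)) ^ 3 < exp (Re (a2 * w n) / 3) ^ 3).
    { assert (0 < (1 + k2) * exp (X n / 3)) by nra.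
      set (s := (1 + k2) * exp (X n / 3)) in *; set (t := exp (Re (a2 * w n) / 3)) in *.
      assert (s * s < t * t) by nra; assert (s * (s * s) < t * (t * t)) by nra; simpl; lra. }
    rewrite E3, Rpow_mult_distr in E4.
    assert (0 < exp (X n / 3) ^ 3) by (apply pow_lt; lra).
    assert (k2 <= (1 + k2) ^ 3) by (simpl; nra); nra. }
  unfold k3; nra. }
set (M := (mq + m)%nat).
set (G := 1 + Cmod u + Cmod v).
assert (Cu := Cmod_ge_0 u); assert (Cv := Cmod_ge_0 v).
assert (Hw : forall n, 1 + Cmod (w n) <= G * (1 + INR n)).
{ intros n; assert (T := Cmod_triangle u (RtoC (INR n) * v)); rewrite Cmod_mult, Cmod_R, Rabs_right in T by (apply Rle_ge, pos_INR).
  fold (w n) in T; assert (Hn := pos_INR n); unfold G; nra. }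
(* Polynomial factors are charged [exp (X / 36)]: any rate [d] with [2 * (1 / 3 + d) < 1] would do,
   and here the sum is 13/18. *)
destruct (one_plus_pow_le_exp M (b / 36) ltac:(lra)) as [K3 [HK3 HE]].
set (c3 := G ^ M * K3 * exp (- Re (a1 * u) / 36)).
assert (Hc3 : 0 < c3).
{ unfold c3; apply Rmult_lt_0_compat; [apply Rmult_lt_0_compat; [apply pow_lt; unfold G; lra|exact HK3]|apply exp_pos]. }
assert (Hpoly : forall n, (1 + Cmod (w n)) ^ M <= c3 * exp (X n / 36)).
{ intros n; apply Rle_trans with (G ^ M * (1 + INR n) ^ M).
  - rewrite <- Rpow_mult_distr; apply pow_incr; split; [assert (K0 := one_plus_Cmod (w n)); lra|apply Hw].
  - unfold c3; rewrite !Rmult_assoc, <- exp_plus; apply Rmult_le_compat_l; [apply pow_le; unfold G; lra|].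
    apply (Rle_trans _ _ _ (HE (INR n) (pos_INR n))), Rmult_le_compat_l; [lra|].
    apply exp_le; rewrite HX; lra. }
(* [|N|, |N'|, |f'|] are all at most [c4 exp (X / 3 + X / 36)] at [w n]. *)
set (c4 := (Q * (2 * K') + K2 + K') * c3 * k3).
assert (Hc4 : 0 <= c4).
{ unfold c4; apply Rmult_le_pos; [apply Rmult_le_pos; [|lra]|unfold k3; lra].
  assert (0 <= Q * (2 * K')) by (apply Rmult_le_pos; lra); lra. }
assert (Hgen : forall h n, 0 <= X n -> 0 <= h -> h <= Q * (2 * K') + K2 + K' ->
  h * (1 + Cmod (w n)) ^ M * two_exp_weight a1 a2 (w n) <= c4 * exp (X n * (13 / 36))).
{ intros h n Hn Hh0 Hh; unfold c4.
  replace (X n * (13 / 36)) with (X n / 36 + X n / 3) by field; rewrite exp_plus.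
  replace ((Q * (2 * K') + K2 + K') * c3 * k3 * (exp (X n / 36) * exp (X n / 3))) with
    ((Q * (2 * K') + K2 + K') * (c3 * exp (X n / 36)) * (k3 * exp (X n / 3))) by ring.
  assert (L1 := one_plus_Cmod (w n)); assert (L2 := two_exp_weight_ge_1 a1 a2 (w n)).
  apply Rmult_le_compat; [apply Rmult_le_pos; [exact Hh0|apply pow_le; lra]|lra| |apply HS, Hn].
  apply Rmult_le_compat; [exact Hh0|apply pow_le; lra|exact Hh|apply Hpoly]. }
assert (HQK : 0 <= Q * (2 * K')) by (apply Rmult_le_pos; lra).
set (c5 := Cmod (a1 - a2) * Cmod p1).
assert (Hc5 : 0 < c5) by (apply Rmult_lt_0_compat; [apply Cmod_gt_0, Hd|exact P1]).
assert (Hfin : forall n, 0 <= X n -> c5 * exp (X n) <= (6 * (c4 + 1) ^ 2) * exp (X n * (13 / 18))).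
{ intros n Hn.
  assert (B1 := Rle_trans _ _ _ (HNb (w n)) (Hgen _ n Hn HQK ltac:(lra))).
  assert (B2 := Rle_trans _ _ _ (HNp (w n)) (Hgen _ n Hn HK2 ltac:(lra))).
  assert (B3 : Cmod (f' (w n)) <= c4 * exp (X n * (13 / 36))).
  { apply (Rle_trans _ _ _ (Hfp (w n))), Rle_trans with (2 := Hgen _ n Hn HK' ltac:(lra)).
    apply Rmult_le_compat_r; [assert (L0 := two_exp_weight_ge_1 a1 a2 (w n)); lra|].
    apply Rmult_le_compat_l; [exact HK'|].
    apply Rle_pow; [apply one_plus_Cmod|unfold M; lia]. }
  assert (E0 := Hderiv (w n)); assert (E1 := Heq (w n)); fold (N (w n)) in E1.
  rewrite (Hzero n) in E1.
  set (F := Cmod (f (w n))); assert (HF0 : 0 <= F) by apply Cmod_ge_0.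
  assert (F3 : F ^ 3 = Cmod (N (w n))).
  { replace (F ^ 3) with (Cmod (f (w n) * f (w n) * f (w n))) by (rewrite !Cmod_mult; unfold F; ring).
    replace (f (w n) * f (w n) * f (w n))%C with (- N (w n))%C; [apply Cmod_opp|].
    replace (- N (w n))%C with (- N (w n) + (f (w n) * f (w n) * f (w n) + N (w n)) - (- (p2 * Cexp (a2 * w n)) + p2 * Cexp (a2 * w n)))%C by (rewrite E1; ring); ring. }
  assert (E2 : ((a1 - a2) * p1 * Cexp (a1 * w n) = 3 * (f (w n) * f (w n)) * f' (w n) + N' (w n))%C).
  { rewrite E0; replace (p2 * (a2 * Cexp (a2 * w n)))%C with (- a2 * (- (p2 * Cexp (a2 * w n))))%C by ring.
    rewrite <- Hzero; ring. }
  assert (E3 := f_equal Cmod E2); rewrite !Cmod_mult, Cmod_Cexp in E3; fold (X n) c5 in E3.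
  rewrite E3; apply (Rle_trans _ _ _ (Cmod_triangle _ _)).
  rewrite !Cmod_mult, Cmod_R, (Rabs_right 3) by lra; fold F.
  set (y := exp (X n * (13 / 36))) in *.
  replace (exp (X n * (13 / 18))) with (y ^ 2) by (unfold y; simpl; rewrite Rmult_1_r, <- exp_plus; f_equal; field).
  assert (Hy : 1 <= y) by (unfold y; apply exp_ge_1; lra).
  set (s := (c4 + 1) * y).
  assert (Hs : 1 <= s) by (unfold s; nra).
  assert (B1' : F ^ 3 <= s) by (rewrite F3; unfold s; nra).
  assert (B2' : Cmod (N' (w n)) <= s) by (unfold s; nra).
  assert (B3' : Cmod (f' (w n)) <= s) by (unfold s; nra).
  (* A crude consequence of [F ^ 3 <= s] and [1 <= s]; it still bounds [3 f^2 f'] by a multiple of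
     [s ^ 2], of rate 13/18 below 1. *)
  assert (F2 : F * F <= s) by (destruct (Rle_lt_dec F 1); simpl in B1'; nra).
  replace (6 * (c4 + 1) ^ 2 * y ^ 2) with (6 * s ^ 2) by (unfold s; ring).
  assert (0 <= Cmod (f' (w n))) by apply Cmod_ge_0.
  assert (F * F * Cmod (f' (w n)) <= s * s) by (apply Rmult_le_compat; nra).
  simpl; nra. }
set (c6 := 6 * (c4 + 1) ^ 2 / c5).
assert (Hc6 : 0 < c6) by (unfold c6; apply Rdiv_lt_0_compat; [assert (0 < (c4 + 1) ^ 2) by (apply pow_lt; lra); lra|exact Hc5]).
destruct (INR_unbounded ((Rabs (Re (a1 * u)) + 18 * c6) / b)) as [n Hn].
assert (Hnb : Rabs (Re (a1 * u)) + 18 * c6 < INR n * b).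
{ apply (Rmult_lt_compat_r b) in Hn; [|exact Hb].
  replace ((Rabs (Re (a1 * u)) + 18 * c6) / b * b) with (Rabs (Re (a1 * u)) + 18 * c6) in Hn by (field; lra); exact Hn. }
assert (HXn : 18 * c6 < X n).
{ rewrite HX; assert (H := Rle_abs (- Re (a1 * u))); rewrite Rabs_Ropp in H; lra. }
assert (Hl := Hfin n ltac:(lra)).
assert (Hl2 : exp (X n * (5 / 18)) <= c6).
{ apply Rmult_le_reg_l with (c5 * exp (X n * (13 / 18))); [apply Rmult_lt_0_compat; [exact Hc5|apply exp_pos]|].
  replace (c5 * exp (X n * (13 / 18)) * exp (X n * (5 / 18))) with (c5 * exp (X n)).
  - replace (c5 * exp (X n * (13 / 18)) * c6) with (6 * (c4 + 1) ^ 2 * exp (X n * (13 / 18))) by (unfold c6; field; lra); exact Hl.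
  - rewrite Rmult_assoc, <- exp_plus; do 2 f_equal; field. }
assert (Hl3 := exp_ineq1 (X n * (5 / 18)) ltac:(lra)); lra.
Qed.

(** * Real quotient: common estimates *)

(** Comparing leading exponentials looks only to the right, where [Re (a * z)] is positive, so the
    rate on the left is hidden. *)
Definition rgrowth (a : C) (A : R) (F : C -> C) : Prop := exists B, growth a A B F.

Lemma rgrowth_plus (a : C) (A : R) (F G : C -> C) : rgrowth a A F -> rgrowth a A G -> rgrowth a A (fun z => F z + G z)%C.
Proof.
intros [B HF] [B' HG]; exists (Rmax B B'); apply growth_plus; eapply growth_weaken; try eassumption;
  (apply Rle_refl || apply Rmax_l || apply Rmax_r).
Qed.

Lemma rgrowth_scal (a c : C) (A : R) (F : C -> C) : rgrowth a A F -> rgrowth a A (fun z => c * F z)%C.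
Proof. intros [B HF]; exists B; apply growth_scal, HF. Qed.

Lemma rgrowth_term (a : C) (A s : R) (F : C -> C) : s <= A -> growth a 0 0 F -> rgrowth a A (fun z => F z * cexp a s z)%C.
Proof.
intros Hs HF; exists (0 + - s); apply (growth_weaken a (0 + s) (0 + - s)); [|lra|lra].
apply growth_mult; [exact HF|apply growth_cexp].
Qed.

Lemma rgrowth_ext (a : C) (A : R) (F G : C -> C) : rgrowth a A F -> (forall z, F z = G z) -> rgrowth a A G.
Proof. intros [B H] E; exists B; exact (growth_ext a A B F G H E). Qed.

Lemma poly_mult (a : C) (F G : C -> C) : growth a 0 0 F -> growth a 0 0 G -> growth a 0 0 (fun z => F z * G z)%C.
Proof. intros HF HG; assert (K := growth_mult a 0 0 0 0 F G HF HG); rewrite !Rplus_0_l in K; exact K. Qed.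

Definition exp_equation (a : C) (t : R) (p1 p2 : C) (q f : C -> C) : Prop :=
  forall z, (f z * f z * f z + q z * fdiff f z)%C = (p1 * cexp a 1 z + p2 * cexp a t z)%C.

(** As [t <= 1], the rate 1/3 dominates on the right. On the left, [exp (t * x / 3)] grows if
    [t < 0], and otherwise everything stays bounded by 1; hence the maximum. *)
Lemma growth_of_bound (a : C) (t K : R) (m : nat) (f : C -> C) : t <= 1 -> has_derivative f -> 0 <= K ->
  (forall z, Cmod (f z) <= K * (1 + Cmod z) ^ m * two_exp_weight a (RtoC t * a) z) ->
  growth a (1 / 3) (Rmax 0 (- t / 3)) f.
Proof.
intros Ht Hf HK H; split; [exact Hf|]; exists (3 * K), m; split; [lra|]; intros z.
apply (Rle_trans _ _ _ (H z)).
replace (3 * K * (1 + Cmod z) ^ m * weight a (1 / 3) (Rmax 0 (- t / 3)) z) with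
  (K * (1 + Cmod z) ^ m * (3 * weight a (1 / 3) (Rmax 0 (- t / 3)) z)) by ring.
apply Rmult_le_compat_l; [apply Rmult_le_pos; [exact HK|apply pow_le; assert (Hz := one_plus_Cmod z); lra]|].
unfold two_exp_weight; replace (RtoC t * a * z)%C with (RtoC t * (a * z))%C by ring; rewrite re_scal_l.
assert (M1 := Rmax_l 0 (- t / 3)); assert (M2 := Rmax_r 0 (- t / 3)).
set (b := Rmax 0 (- t / 3)) in *; set (x := Re (a * z)).
destruct (Rle_lt_dec 0 x) as [Hx|Hx].
- rewrite weight_right by exact Hx; fold x.
  assert (E1 : 1 <= exp (1 / 3 * x)) by (apply exp_ge_1; lra).
  assert (E2 : exp (x / 3) <= exp (1 / 3 * x)) by (apply exp_le; lra).
  assert (E3 : exp (t * x / 3) <= exp (1 / 3 * x)) by (apply exp_le; nra); lra.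
- rewrite weight_left by (fold x; lra); fold x.
  assert (E1 : 1 <= exp (b * - x)) by (apply exp_ge_1; nra).
  assert (E2 : exp (x / 3) <= exp (b * - x)) by (apply exp_le; nra).
  assert (E3 : exp (t * x / 3) <= exp (b * - x)) by (apply exp_le; nra); lra.
Qed.

Lemma exp_INR_mult (k : nat) (x : R) : exp (INR k * x) = exp x ^ k.
Proof.
induction k as [|k IH]; [simpl; rewrite Rmult_0_l, exp_0; reflexivity|].
rewrite S_INR; simpl; rewrite <- IH, <- exp_plus; f_equal; ring.
Qed.

(** Both [p2 * cexp a t] and [q * fdiff f] have rate at most [kap < 1], so beyond the threshold they
    take away at most half of [p1 * cexp a 1]. *)
Lemma solution_large_right (a : C) (t b : R) (p1 p2 : C) (q f : C -> C) : t < 1 -> p1 <> 0%C ->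
  growth a 0 0 q -> growth a (1 / 3) b f -> exp_equation a t p1 p2 q f -> large_right a f.
Proof.
intros Ht Hp1 Hq Hf Heq.
assert (P1 := proj1 (Cmod_gt_0 p1) Hp1); assert (P2 := Cmod_ge_0 p2).
set (kap := Rmax t (1 / 3)).
assert (M1 : t <= kap) by apply Rmax_l; assert (M2 : 1 / 3 <= kap) by apply Rmax_r.
assert (M3 : kap < 1) by (apply Rmax_lub_lt; lra).
assert (HN := growth_mult a _ _ _ _ _ _ Hq (growth_fdiff a _ _ f Hf)).
rewrite !Rplus_0_l in HN; destruct HN as [_ [K [m [HK HN]]]].
(* The natural threshold concerns [exp ((1 - kap) * x)]; its [k]-th power turns it into one for
   [exp x]. *)
destruct (INR_unbounded (/ (1 - kap))) as [k Hk].
assert (Hk1 : 1 <= INR k * (1 - kap)).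
{ apply (Rmult_lt_compat_r (1 - kap)) in Hk; [|lra]; rewrite Rinv_l in Hk; lra. }
set (K0 := 2 * (Cmod p2 + K) / Cmod p1 + 1).
assert (HK0 : 0 <= 2 * (Cmod p2 + K) / Cmod p1).
{ unfold Rdiv; apply Rmult_le_pos; [lra|left; apply Rinv_0_lt_compat, P1]. }
(* This [c] satisfies [c ^ 3 <= Cmod p1 / 2], which avoids a cube root. *)
exists (Rmin 1 (Cmod p1 / 2)), (K0 ^ k), (m * k)%nat; split; [apply Rmin_glb_lt; lra|split].
{ apply pow_ge_1; unfold K0; lra. }
intros z Hx Hbig; specialize (HN z); rewrite weight_right in HN by exact Hx.
set (x := Re (a * z)) in *; assert (Hz := one_plus_Cmod z); set (r := 1 + Cmod z) in *.
assert (Hr := pow_ge_1 r m Hz).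
rewrite pow_mult, <- Rpow_mult_distr in Hbig.
assert (Hthr : K0 * r ^ m <= exp ((1 - kap) * x)).
{ apply Rnot_lt_le; intros Hlt.
  assert (L1 : exp x <= exp ((1 - kap) * x) ^ k) by (rewrite <- exp_INR_mult; apply exp_le; nra).
  assert (L2 := exp_pos ((1 - kap) * x)).
  destruct k as [|k]; [simpl in Hk1; lra|].
  assert (L3 : exp ((1 - kap) * x) ^ S k < (K0 * r ^ m) ^ S k).
  { simpl; apply Rle_lt_trans with (exp ((1 - kap) * x) * (K0 * r ^ m) ^ k).
    - apply Rmult_le_compat_l; [lra|apply pow_incr; lra].
    - apply Rmult_lt_compat_r; [apply pow_lt; lra|exact Hlt]. }
  lra. }
assert (Hex := exp_pos (kap * x)); assert (Hex1 := exp_pos x).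
assert (HR : Cmod (p2 * cexp a t z - q z * fdiff f z) <= Cmod p1 / 2 * exp x).
{ apply (Rle_trans _ _ _ (Cmod_triangle_minus _ _)).
  rewrite (Cmod_mult p2), Cmod_cexp; fold x.
  assert (L1 : exp (t * x) <= exp (kap * x)) by (apply exp_le; nra).
  assert (L2 : exp (1 / 3 * x) <= exp (kap * x)) by (apply exp_le; nra).
  apply Rle_trans with ((Cmod p2 + K) * r ^ m * exp (kap * x)).
  - assert (Cmod p2 * exp (t * x) <= Cmod p2 * r ^ m * exp (kap * x)).
    { apply Rmult_le_compat; [exact P2|left; apply exp_pos|nra|exact L1]. }
    assert (K * r ^ m * exp (1 / 3 * x) <= K * r ^ m * exp (kap * x)) by (apply Rmult_le_compat_l; [nra|exact L2]).
    lra.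
  - apply Rle_trans with (Cmod p1 / 2 * (K0 * r ^ m) * exp (kap * x)).
    + apply Rmult_le_compat_r; [lra|]; unfold K0.
      replace (Cmod p1 / 2 * ((2 * (Cmod p2 + K) / Cmod p1 + 1) * r ^ m)) with ((Cmod p2 + K) * r ^ m + Cmod p1 / 2 * r ^ m) by (field; lra).
      nra.
    + replace (exp x) with (exp ((1 - kap) * x) * exp (kap * x)) by (rewrite <- exp_plus; f_equal; ring).
      apply Rle_trans with (Cmod p1 / 2 * exp ((1 - kap) * x) * exp (kap * x)); [|right; ring].
      apply Rmult_le_compat_r; [lra|]; apply Rmult_le_compat_l; lra. }
assert (HF : Cmod p1 / 2 * exp x <= Cmod (f z) ^ 3).
{ replace (Cmod (f z) ^ 3) with (Cmod (f z * f z * f z)) by (rewrite !Cmod_mult; ring).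
  replace (f z * f z * f z)%C with (p1 * cexp a 1 z + (p2 * cexp a t z - q z * fdiff f z))%C.
  - assert (T := Cmod_triangle_rev (p1 * cexp a 1 z) (p2 * cexp a t z - q z * fdiff f z)).
    rewrite (Cmod_mult p1), Cmod_cexp, Rmult_1_l in T; fold x in T; lra.
  - replace (p1 * cexp a 1 z + (p2 * cexp a t z - q z * fdiff f z))%C with (p1 * cexp a 1 z + p2 * cexp a t z - q z * fdiff f z)%C by ring.
    rewrite <- Heq; ring. }
apply Rnot_lt_le; intros Hlt.
set (c := Rmin 1 (Cmod p1 / 2)) in *.
assert (Hc1 : c <= 1) by apply Rmin_l; assert (Hc2 : c <= Cmod p1 / 2) by apply Rmin_r.
assert (Hc0 : 0 < c) by (apply Rmin_glb_lt; lra).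
assert (He3 := exp_pos (x / 3)); rewrite (exp_cube x) in HF.
set (e := exp (x / 3)) in *; set (F := Cmod (f z)) in *.
assert (HF0 : 0 <= F) by apply Cmod_ge_0.
assert (G1 : F * F <= (c * e) * (c * e)) by nra.
assert (G2 : F * (F * F) < (c * e) * ((c * e) * (c * e))).
{ apply Rle_lt_trans with (F * ((c * e) * (c * e))); [apply Rmult_le_compat_l; assumption|].
  apply Rmult_lt_compat_r; [|exact Hlt]; apply Rmult_lt_0_compat; nra. }
assert (G3 : c * (c * c) <= Cmod p1 / 2) by nra.
assert (G4 : 0 < e * (e * e)) by (apply Rmult_lt_0_compat; nra).
simpl in HF; nra.
Qed.

(* Differentiate the equation and eliminate [p1 e^(a z)]. *)
Lemma first_order_identity (a : C) (t : R) (p1 p2 : C) (q f f' N' : C -> C) : exp_equation a t p1 p2 q f ->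
  has_deriv f f' -> has_deriv (fun z => q z * fdiff f z)%C N' -> forall z,
  (3 * (f z * (f z * (f' z - a / 3 * f z))) =
   (RtoC t - 1) * a * p2 * cexp a t z - (N' z - a * (q z * fdiff f z)))%C.
Proof.
intros Heq Hf HN z.
assert (D : (f' z * f z * f z + f z * f' z * f z + f z * f z * f' z + N' z = p1 * (RtoC 1 * a * cexp a 1 z) + p2 * (RtoC t * a * cexp a t z))%C).
{ refine (has_deriv_unique (fun z => p1 * cexp a 1 z + p2 * cexp a t z)%C
    (fun z => f' z * f z * f z + f z * f' z * f z + f z * f z * f' z + N' z)%C
    (fun z => p1 * (RtoC 1 * a * cexp a 1 z) + p2 * (RtoC t * a * cexp a t z))%C _ _ z).
  - apply (has_deriv_ext (fun z => f z * f z * f z + q z * fdiff f z)%C _ (fun z => (f' z * f z + f z * f' z) * f z + f z * f z * f' z + N' z)%C).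
    + apply has_deriv_plus; [|exact HN]; apply (has_deriv_mult (fun z => f z * f z)%C); [apply has_deriv_mult|]; exact Hf.
    + exact Heq.
    + intros w; ring.
  - apply has_deriv_plus; apply has_deriv_scal, has_deriv_cexp. }
specialize (Heq z).
replace (3 * (f z * (f z * (f' z - a / 3 * f z))))%C with
  ((f' z * f z * f z + f z * f' z * f z + f z * f z * f' z + N' z) - N' z - a * (f z * f z * f z + q z * fdiff f z) + a * (q z * fdiff f z))%C.
- rewrite D, Heq; ring.
- field; intros E; apply RtoC_inj in E; lra.
Qed.

Lemma growth_scal_cancel (a c : C) (A B : R) (F : C -> C) : c <> 0%C -> growth a A B (fun z => c * F z)%C -> growth a A B F.
Proof.
intros Hc H; apply (growth_ext a A B (fun z => / c * (c * F z))%C).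
- apply growth_scal, H.
- intros z; field; exact Hc.
Qed.

Lemma C3_neq_0 : RtoC 3 <> 0%C.
Proof. intros E; apply RtoC_inj in E; lra. Qed.

(** The right-hand side of [first_order_identity] has rate [Rmax t (1 / 3)], and each of the two
    divisions by [f] lowers it by 1/3. *)
Lemma first_order_growth (a : C) (t b : R) (p1 p2 : C) (q f f' : C -> C) : t < 1 -> p1 <> 0%C ->
  growth a 0 0 q -> growth a (1 / 3) b f -> exp_equation a t p1 p2 q f -> has_deriv f f' ->
  growth a (Rmax t (1 / 3) - 2 / 3) b (fun z => f' z - a / 3 * f z)%C.
Proof.
intros Ht Hp1 Hq Hf Heq Hf'.
assert (HL := solution_large_right a t b p1 p2 q f Ht Hp1 Hq Hf Heq).
assert (HN := growth_mult a _ _ _ _ _ _ Hq (growth_fdiff a _ _ f Hf)).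
rewrite !Rplus_0_l in HN; assert (HN2 := HN); destruct HN2 as [[N' HN'] _].
assert (HNg := growth_deriv a _ _ _ _ HN HN').
assert (Hg : growth a (1 / 3) b (fun z => f' z - a / 3 * f z)%C).
{ apply growth_minus; [exact (growth_deriv a _ _ _ _ Hf Hf')|apply growth_scal, Hf]. }
assert (Hid := first_order_identity a t p1 p2 q f f' N' Heq Hf' HN').
set (B := Rmax b (- t)).
assert (H2 : growth a (Rmax t (1 / 3)) B (fun z => f z * (f z * (f' z - a / 3 * f z)))%C).
{ apply (growth_scal_cancel a 3 _ _ _ C3_neq_0).
  apply (growth_ext a _ _ (fun z => (RtoC t - 1) * a * p2 * cexp a t z - (N' z - a * (q z * fdiff f z)))%C); [|intros z; symmetry; apply Hid].
  apply growth_minus.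
  - apply growth_scal, (growth_weaken a t (- t)); [apply growth_cexp|apply Rmax_l|apply Rmax_r].
  - apply (growth_weaken a (1 / 3) b); [|apply Rmax_r|apply Rmax_l].
    apply growth_minus; [exact HNg|apply growth_scal, HN]. }
assert (H1 := growth_div a f _ _ _ _ _ HL (growth_mult a _ _ _ _ _ _ Hf Hg) H2).
assert (H0 := growth_div a f _ _ _ _ _ HL Hg H1).
apply (growth_weaken a _ _ _ _ _ H0); [|apply Rle_refl].
right; field.
Qed.

Lemma cexp_third_cube (a : C) (s : R) (z : C) : cexp a s z = (cexp a (s / 3) z * cexp a (s / 3) z * cexp a (s / 3) z)%C.
Proof. rewrite !cexp_mult; f_equal; field. Qed.

Lemma cexp_shift (a : C) (s : R) (z : C) : cexp a s (z + 1) = (cexp a s z * Cexp (RtoC s * a))%C.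
Proof. unfold cexp; rewrite <- Cexp_plus; f_equal; ring. Qed.

Lemma cube_neq_0 (c p : C) : (c * c * c = p)%C -> p <> 0%C -> c <> 0%C.
Proof. intros E Hp Hc; apply Hp; rewrite <- E, Hc; ring. Qed.

Lemma Cmult_integral_l (x y : C) : (x * y = 0)%C -> x <> 0%C -> y = 0%C.
Proof. intros E Hx; replace y with (/ x * (x * y))%C by (field; exact Hx); rewrite E; ring. Qed.

(** * Quotient in (0, 2/3] *)

Lemma small_quotient (a : C) (t : R) (p1 p2 : C) (q f : C -> C) : a <> 0%C -> 0 < t <= 2 / 3 -> p1 <> 0%C -> p2 <> 0%C ->
  growth a 0 0 q -> growth a (1 / 3) 0 f -> exp_equation a t p1 p2 q f ->
  t = 1 / 3 /\ exists c, (forall z, f z = c * cexp a (1 / 3) z)%C /\ (c * c * c = p1)%C /\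
    forall z, (c * (Cexp (a / 3) - 1) * q z = p2)%C.
Proof.
intros Ha [Ht0 Ht] Hp1 Hp2 Hq Hf Heq.
assert (Hf2 := Hf); destruct Hf2 as [[f' Hf'] _].
assert (Hg := first_order_growth a t 0 p1 p2 q f f' ltac:(lra) Hp1 Hq Hf Heq Hf').
assert (Hg0 : growth a 0 0 (fun z => f' z - a / 3 * f z)%C).
{ apply (growth_weaken a _ _ _ _ _ Hg); [|apply Rle_refl].
  assert (H : Rmax t (1 / 3) <= 2 / 3) by (apply Rmax_lub; lra); lra. }
destruct (affine_exp_ode a (a / 3) f f' _ ltac:(apply Cmult_neq_0; [exact Ha|intros E; apply C3_neq_0; replace (RtoC 3) with (RtoC 3 * RtoC 3 * / 3)%C by (field; apply C3_neq_0); rewrite E; ring]) Hg0 Hf' (fun z => eq_refl)) as [c [P [HP EP]]].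
assert (EP' : forall z, f z = (c * cexp a (1 / 3) z + P z)%C).
{ intros z; rewrite EP; unfold cexp; do 3 f_equal; rewrite RtoC_div by lra; field; apply C3_neq_0. }
clear EP; rename EP' into EP.
set (w := Cexp (a / 3)).
assert (Hw : forall z, fdiff f z = (c * (w - 1) * cexp a (1 / 3) z + fdiff P z)%C).
{ intros z; unfold fdiff; rewrite !EP, cexp_shift.
  replace (RtoC (1 / 3) * a)%C with (a / 3)%C by (rewrite RtoC_div by lra; field; apply C3_neq_0); fold w; ring. }
assert (HdP := growth_fdiff a 0 0 P HP).
assert (HP2 := poly_mult a _ _ HP HP).
set (X := cexp a (1 / 3)) in *.
assert (EX2 : forall z, cexp a (2 / 3) z = (X z * X z)%C) by (intros z; unfold X; rewrite cexp_mult; f_equal; field).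
assert (EX3 : forall z, cexp a 1 z = (X z * X z * X z)%C) by (intros z; apply cexp_third_cube).
assert (Hexp : forall z, ((c * c * c - p1) * (X z * X z * X z) + 3 * (c * c) * P z * (X z * X z)
  + (3 * c * (P z * P z) + c * (w - 1) * q z) * X z + (P z * (P z * P z) + q z * fdiff P z) = p2 * cexp a t z)%C).
{ intros z; assert (E := Heq z); rewrite Hw, EX3, EP in E.
  replace (p2 * cexp a t z)%C with (p1 * (X z * X z * X z) + p2 * cexp a t z - p1 * (X z * X z * X z))%C by ring.
  rewrite <- E; fold X; ring. }
assert (T0 : growth a 0 0 (fun z => P z * (P z * P z) + q z * fdiff P z)%C).
{ apply growth_plus; [exact (poly_mult a _ _ HP HP2)|exact (poly_mult a _ _ Hq HdP)]. }
assert (T1 : growth a 0 0 (fun z => 3 * c * (P z * P z) + c * (w - 1) * q z)%C).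
{ apply growth_plus; apply growth_scal; assumption. }
assert (T2 : growth a 0 0 (fun z => 3 * (c * c) * P z)%C) by (apply growth_scal, HP).
assert (G0 : forall A, 0 <= A -> rgrowth a A (fun z => P z * (P z * P z) + q z * fdiff P z)%C).
{ intros A HA; apply (rgrowth_ext a A _ _ (rgrowth_term a A 0 _ HA T0)); intros z; rewrite cexp_0; ring. }
assert (G1 : forall A, 1 / 3 <= A -> rgrowth a A (fun z => (3 * c * (P z * P z) + c * (w - 1) * q z) * X z)%C).
{ intros A HA; exact (rgrowth_term a A (1 / 3) _ HA T1). }
assert (G2 : forall A, 2 / 3 <= A -> rgrowth a A (fun z => 3 * (c * c) * P z * (X z * X z))%C).
{ intros A HA; apply (rgrowth_ext a A _ _ (rgrowth_term a A (2 / 3) _ HA T2)); intros z; rewrite EX2; reflexivity. }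
assert (Gt : forall A, t <= A -> rgrowth a A (fun z => p2 * cexp a t z)%C).
{ intros A HA; exact (rgrowth_term a A t _ HA (growth_const a p2)). }
assert (Hc3 : (c * c * c = p1)%C).
{ apply Ceq_minus.
  destruct (rgrowth_plus a (2 / 3) _ _ (Gt (2 / 3) Ht) (rgrowth_scal a (-1) _ _ (rgrowth_plus a _ _ _ (rgrowth_plus a _ _ _ (G2 (2 / 3) ltac:(lra)) (G1 (2 / 3) ltac:(lra))) (G0 (2 / 3) ltac:(lra))))) as [B HB].
  apply (leading_const_zero a _ 1 (2 / 3) B Ha ltac:(lra)).
  apply (growth_ext a _ _ _ _ HB); intros z; cbv beta; rewrite <- Hexp, EX3; ring. }
assert (Hc := cube_neq_0 c p1 Hc3 Hp1).
assert (Hexp2 : forall z, (3 * (c * c) * P z * (X z * X z)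
  + (3 * c * (P z * P z) + c * (w - 1) * q z) * X z + (P z * (P z * P z) + q z * fdiff P z) = p2 * cexp a t z)%C).
{ intros z; rewrite <- Hexp, Hc3; ring. }
destruct (Req_dec t (2 / 3)) as [Ht23|Ht23].
(* Only for [t = 2 / 3] can the right-hand side balance the [X^2] term. Then [P] is a nonzero
   constant [k], the [X] term vanishes, and the constant term gives [k^3 = 0]. *)
- exfalso; subst t.
  assert (HPc : forall z, (3 * (c * c) * P z - p2 = 0)%C).
  { destruct (rgrowth_scal a (-1) _ _ (rgrowth_plus a _ _ _ (G1 (1 / 3) ltac:(lra)) (G0 (1 / 3) ltac:(lra)))) as [B HB].
    apply (leading_coeff_zero a (2 / 3) (1 / 3) B (fun z => 3 * (c * c) * P z - p2)%C Ha ltac:(lra)).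
    - apply growth_minus; [exact T2|apply growth_const].
    - apply (growth_ext a _ _ _ _ HB); intros z; cbv beta.
      replace ((3 * (c * c) * P z - p2) * cexp a (2 / 3) z)%C with (3 * (c * c) * P z * cexp a (2 / 3) z - p2 * cexp a (2 / 3) z)%C by ring.
      rewrite <- Hexp2, EX2; ring. }
  set (k := (p2 / (3 * (c * c)))%C).
  assert (Hcc : (3 * (c * c))%C <> 0%C) by (apply Cmult_neq_0; [apply C3_neq_0|apply Cmult_neq_0; exact Hc]).
  assert (HPk : forall z, P z = k).
  { intros z; unfold k; replace p2 with (3 * (c * c) * P z - (3 * (c * c) * P z - p2))%C by ring.
    rewrite HPc; field; exact Hc. }
  assert (Hk : k <> 0%C).
  { intros E; apply Hp2; replace p2 with (3 * (c * c) * k)%C by (unfold k; field; exact Hc); rewrite E; ring. }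
  assert (HdPk : forall z, fdiff P z = 0%C) by (intros z; unfold fdiff; rewrite !HPk; ring).
  assert (Hexp3 : forall z, ((3 * c * (P z * P z) + c * (w - 1) * q z) * X z = - (k * (k * k)))%C).
  { intros z; assert (E := Hexp2 z); rewrite HdPk in E.
    assert (E1 := HPc z).
    replace ((3 * c * (P z * P z) + c * (w - 1) * q z) * X z)%C with
      (3 * (c * c) * P z * (X z * X z) + (3 * c * (P z * P z) + c * (w - 1) * q z) * X z + (P z * (P z * P z) + q z * 0) - (3 * (c * c) * P z - p2) * (X z * X z) - p2 * (X z * X z) - P z * (P z * P z))%C by ring.
    rewrite E, E1, EX2, HPk; ring. }
  assert (HT1 : forall z, (3 * c * (P z * P z) + c * (w - 1) * q z = 0)%C).
  { apply (leading_coeff_zero a (1 / 3) 0 0 (fun z => 3 * c * (P z * P z) + c * (w - 1) * q z)%C Ha ltac:(lra) T1).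
    apply (growth_ext a _ _ _ _ (growth_const a (- (k * (k * k)))%C)); intros z; symmetry; apply Hexp3. }
  assert (E := Hexp3 (RtoC 0)); rewrite HT1, Cmult_0_l in E.
  assert (E2 : (k * (k * k) = 0)%C) by (replace (k * (k * k))%C with (- - (k * (k * k)))%C by ring; rewrite <- E; ring).
  apply Hk, (Cmult_integral_l k k); [|exact Hk]; apply (Cmult_integral_l k _ E2 Hk).
(* Now nothing balances the [X^2] term, so [P = 0]; what is left, [c (w - 1) q X = p2 E^t], forces
   [t = 1 / 3]. *)
- assert (HP0 : forall z, P z = 0%C).
  { assert (H : forall z, (3 * (c * c) * P z)%C = 0%C).
    { set (mu := Rmax t (1 / 3)).
      assert (M1 : t <= mu) by apply Rmax_l; assert (M2 : 1 / 3 <= mu) by apply Rmax_r.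
      assert (M3 : mu < 2 / 3) by (apply Rmax_lub_lt; lra).
      destruct (rgrowth_plus a mu _ _ (Gt mu M1) (rgrowth_scal a (-1) _ _ (rgrowth_plus a _ _ _ (G1 mu M2) (G0 mu ltac:(lra))))) as [B HB].
      apply (leading_coeff_zero a (2 / 3) mu B (fun z => 3 * (c * c) * P z)%C Ha M3 T2).
      apply (growth_ext a _ _ _ _ HB); intros z; cbv beta; rewrite <- Hexp2, EX2; ring. }
    intros z; apply (Cmult_integral_l (3 * (c * c)) _ (H z)), Cmult_neq_0; [apply C3_neq_0|apply Cmult_neq_0; exact Hc]. }
  assert (Hexp3 : forall z, (c * (w - 1) * q z * X z = p2 * cexp a t z)%C).
  { intros z; rewrite <- Hexp2; unfold fdiff; rewrite !HP0; ring. }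
  assert (Hqc : growth a 0 0 (fun z => c * (w - 1) * q z)%C) by (apply growth_scal, Hq).
  destruct (Rtotal_order t (1 / 3)) as [Hlt|[Heq3|Hgt]].
  + exfalso; destruct (Gt t (Rle_refl t)) as [B HB].
    assert (H0 : forall z, (c * (w - 1) * q z = 0)%C).
    { apply (leading_coeff_zero a (1 / 3) t B _ Ha Hlt Hqc).
      apply (growth_ext a _ _ _ _ HB); intros z; symmetry; apply Hexp3. }
    assert (E := Hexp3 (RtoC 0)); rewrite H0, Cmult_0_l in E; symmetry in E.
    exact (cexp_neq_0 _ _ _ (Cmult_integral_l _ _ E Hp2)).
  + split; [exact Heq3|]; exists c; split; [|split; [exact Hc3|]].
    * intros z; rewrite EP, HP0; fold X; ring.
    * intros z; assert (E := Hexp3 z); rewrite Heq3 in E; fold X in E.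
      assert (HX : X z <> 0%C) by apply cexp_neq_0.
      replace (c * (w - 1) * q z)%C with (c * (w - 1) * q z * X z / X z)%C by (field; exact HX).
      rewrite E; field; exact HX.
  + exfalso; apply Hp2.
    destruct (rgrowth_term a (1 / 3) (1 / 3) _ (Rle_refl _) Hqc) as [B HB].
    apply (leading_const_zero a p2 t (1 / 3) B Ha Hgt).
    apply (growth_ext a _ _ _ _ HB); exact Hexp3.
Qed.

(** * Quotient in (2/3, 1) *)

(* At a zero of the right-hand side the derivative of [f^3] vanishes too, but that of the exponential sum does not. *)
Lemma cube_not_two_exponentials (a : C) (t : R) (p1 p2 : C) (f f' : C -> C) : a <> 0%C -> t <> 1 -> p1 <> 0%C -> p2 <> 0%C ->
  has_deriv f f' -> ~ (forall z, (f z * f z * f z = p1 * cexp a 1 z + p2 * cexp a t z)%C).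
Proof.
intros Ha Ht Hp1 Hp2 Hf E.
assert (H1t : RtoC (1 - t) <> 0%C) by (intros K; apply RtoC_inj in K; lra).
destruct (Cexp_surj (- p2 / p1)) as [L HL].
{ intros K; apply Hp2; replace p2 with (- (- p2 / p1) * p1)%C by (field; exact Hp1); rewrite K; ring. }
set (z := (L / (RtoC (1 - t) * a))%C).
assert (Hz : (p1 * cexp a 1 z = - (p2 * cexp a t z))%C).
{ replace 1 with ((1 - t) + t) at 1 by ring; rewrite <- cexp_mult.
  replace (cexp a (1 - t) z) with (- p2 / p1)%C; [field; exact Hp1|].
  rewrite <- HL; unfold cexp, z; f_equal; field; split; assumption. }
assert (Hfz : f z = 0%C).
{ assert (E0 := E z); rewrite Hz in E0; apply NNPP; intros Hn.
  apply (Cmult_neq_0 _ _ (Cmult_neq_0 _ _ Hn Hn) Hn); rewrite E0; ring. }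
assert (D : ((f' z * f z + f z * f' z) * f z + f z * f z * f' z = p1 * (RtoC 1 * a * cexp a 1 z) + p2 * (RtoC t * a * cexp a t z))%C).
{ refine (has_deriv_unique (fun z => p1 * cexp a 1 z + p2 * cexp a t z)%C
    (fun z => (f' z * f z + f z * f' z) * f z + f z * f z * f' z)%C
    (fun z => p1 * (RtoC 1 * a * cexp a 1 z) + p2 * (RtoC t * a * cexp a t z))%C _ _ z).
  - apply (has_deriv_ext (fun z => f z * f z * f z)%C _ (fun z => (f' z * f z + f z * f' z) * f z + f z * f z * f' z)%C); [|exact E|reflexivity].
    apply (has_deriv_mult (fun z => f z * f z)%C); [apply has_deriv_mult|]; exact Hf.
  - apply has_deriv_plus; apply has_deriv_scal, has_deriv_cexp. }
rewrite Hfz in D.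
assert (K : (RtoC (1 - t) * (a * (p2 * cexp a t z)) = 0)%C).
{ replace (RtoC (1 - t) * (a * (p2 * cexp a t z)))%C with
    (- (RtoC t * a * (p2 * cexp a t z) + a * (- (p2 * cexp a t z))))%C by (rewrite RtoC_minus; ring).
  rewrite <- Hz.
  replace (RtoC t * a * (p2 * cexp a t z) + a * (p1 * cexp a 1 z))%C with (p1 * (RtoC 1 * a * cexp a 1 z) + p2 * (RtoC t * a * cexp a t z))%C by ring.
  rewrite <- D; ring. }
apply (Cmult_integral_l _ _) in K; [|exact H1t]; apply (Cmult_integral_l _ _) in K; [|exact Ha].
apply (Cmult_integral_l _ _) in K; [|exact Hp2]; exact (cexp_neq_0 _ _ _ K).
Qed.

(* With [L = (D - a)(D - t a)], [L (f^3) = f phi] for [phi = 6 g^2 + 3 f h], so [f phi = - L (q fdiff f)] and [phi] has polynomial growth; so do [phi1 = phi' - 2 lam phi] and [psi], and [f psi = 5 h phi - 2 g phi1] forces [psi = 0], then [phi1 = 0] and [phi = 0]. *)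
Lemma large_quotient (a : C) (t : R) (p1 p2 : C) (q f : C -> C) : a <> 0%C -> 2 / 3 < t < 1 -> p1 <> 0%C -> p2 <> 0%C ->
  growth a 0 0 q -> growth a (1 / 3) 0 f -> ~ exp_equation a t p1 p2 q f.
Proof.
intros Ha [Ht0 Ht1] Hp1 Hp2 Hq Hf Heq.
assert (HL := solution_large_right a t 0 p1 p2 q f Ht1 Hp1 Hq Hf Heq).
assert (Hf2 := Hf); destruct Hf2 as [[f' Hf'] _].
destruct (deriv_has_deriv f f' Hf') as [f'' Hf''].
assert (Gf' := growth_deriv a _ _ _ _ Hf Hf').
assert (Gf'' := growth_deriv a _ _ _ _ Gf' Hf'').
set (N := fun z => (q z * fdiff f z)%C).
assert (GN : growth a (1 / 3) 0 N).
{ assert (K := growth_mult a _ _ _ _ _ _ Hq (growth_fdiff a _ _ f Hf)); rewrite !Rplus_0_l in K; exact K. }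
assert (GN2 := GN); destruct GN2 as [[N' HN'] _].
destruct (deriv_has_deriv N N' HN') as [N'' HN''].
assert (GN' := growth_deriv a _ _ _ _ GN HN').
assert (GN'' := growth_deriv a _ _ _ _ GN' HN'').
set (g := fun z => (f' z - a / 3 * f z)%C).
set (g' := fun z => (f'' z - a / 3 * f' z)%C).
assert (Hg' : has_deriv g g') by (apply has_deriv_minus; [exact Hf''|apply has_deriv_scal, Hf']).
(* By [3 f^2 g = (t - 1) a p2 E^t - ...] with [f] of size [E^(1/3)], the leading part of [g] is a
   multiple of [E^(t - 2/3)], which [D - lam] removes. *)
set (lam := (RtoC (t - 2 / 3) * a)%C).
set (h := fun z => (g' z - lam * g z)%C).
assert (Gg : growth a (t - 2 / 3) 0 g).
{ assert (K := first_order_growth a t 0 p1 p2 q f f' Ht1 Hp1 Hq Hf Heq Hf').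
  rewrite Rmax_left in K by lra; exact K. }
assert (Gg0 : growth a (1 / 3) 0 g) by (apply (growth_weaken a _ _ _ _ _ Gg); lra).
assert (Gg' := growth_deriv a _ _ _ _ Gg0 Hg').
assert (Gh0 : growth a (1 / 3) 0 h) by (apply growth_minus; [exact Gg'|apply growth_scal, Gg0]).
assert (Gh2 := Gh0); destruct Gh2 as [[h' Hh'] _].
assert (Gh' := growth_deriv a _ _ _ _ Gh0 Hh').
(* Chosen as the cofactor of [f] in [phi1 = 15 g h + f k]. *)
set (k := fun z => (3 * h' z + (a - 6 * lam) * h z)%C).
assert (Gk : growth a (1 / 3) 0 k) by (apply growth_plus; apply growth_scal; assumption).
set (phi := fun z => (6 * (g z * g z) + 3 * (f z * h z))%C).
set (phi' := fun z => (6 * (g' z * g z + g z * g' z) + 3 * (f' z * h z + f z * h' z))%C).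
assert (Hphi' : has_deriv phi phi').
{ apply has_deriv_plus; apply has_deriv_scal, has_deriv_mult; assumption. }
assert (Gprod : forall A B F G, growth a A 0 F -> growth a B 0 G -> growth a (A + B) 0 (fun z => F z * G z)%C).
{ intros A B F G HF HG; assert (K := growth_mult a _ _ _ _ _ _ HF HG); rewrite Rplus_0_l in K; exact K. }
assert (Gphi0 : growth a (1 / 3 + 1 / 3) 0 phi) by (apply growth_plus; apply growth_scal, Gprod; assumption).
assert (Hid1 : forall z, (3 * (f z * (f z * g z)) = (RtoC t - 1) * a * p2 * cexp a t z - (N' z - a * N z))%C).
{ intros z; exact (first_order_identity a t p1 p2 q f f' N' Heq Hf' HN' z). }
assert (Hid2 : forall z, (f z * phi z = - (N'' z - RtoC (1 + t) * a * N' z + RtoC t * (a * a) * N z))%C).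
{ intros z.
  assert (D : (3 * (f' z * (f z * g z) + f z * (f' z * g z + f z * g' z)) =
     (RtoC t - 1) * a * p2 * (RtoC t * a * cexp a t z) - (N'' z - a * N' z))%C).
  { refine (has_deriv_unique (fun z => 3 * (f z * (f z * g z)))%C
      (fun z => 3 * (f' z * (f z * g z) + f z * (f' z * g z + f z * g' z)))%C
      (fun z => (RtoC t - 1) * a * p2 * (RtoC t * a * cexp a t z) - (N'' z - a * N' z))%C _ _ z).
    - apply has_deriv_scal, (has_deriv_mult f (fun z => f z * g z)%C); [exact Hf'|apply has_deriv_mult; assumption].
    - apply (has_deriv_ext (fun z => (RtoC t - 1) * a * p2 * cexp a t z - (N' z - a * N z))%C _
        (fun z => (RtoC t - 1) * a * p2 * (RtoC t * a * cexp a t z) - (N'' z - a * N' z))%C); [|intros w; symmetry; apply Hid1|reflexivity].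
      apply has_deriv_minus; [apply has_deriv_scal, has_deriv_cexp|].
      apply has_deriv_minus; [exact HN''|apply has_deriv_scal, HN']. }
  assert (Hi := Hid1 z).
  replace (- (N'' z - RtoC (1 + t) * a * N' z + RtoC t * (a * a) * N z))%C with
    (((RtoC t - 1) * a * p2 * (RtoC t * a * cexp a t z) - (N'' z - a * N' z))
     - RtoC t * a * ((RtoC t - 1) * a * p2 * cexp a t z - (N' z - a * N z)))%C by (rewrite RtoC_plus; ring).
  rewrite <- D, <- Hi.
  replace (f' z) with (g z + a / 3 * f z)%C by (unfold g; ring).
  replace (g' z) with (h z + lam * g z)%C by (unfold h; ring).
  unfold phi, lam; rewrite RtoC_minus, RtoC_div by lra; field; apply C3_neq_0. }
assert (Gphi : growth a 0 0 phi).
{ apply (growth_weaken a (1 / 3 - 1 / 3) 0); [|lra|lra].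
  apply (growth_div a f _ _ _ _ 0 HL Gphi0).
  apply (growth_ext a _ _ (fun z => (-1) * (N'' z - RtoC (1 + t) * a * N' z + RtoC t * (a * a) * N z))%C).
  - apply growth_scal, growth_plus; [apply growth_minus; [exact GN''|]|]; apply growth_scal; assumption.
  - intros z; rewrite Hid2; ring. }
assert (Gphi' := growth_deriv a _ _ _ _ Gphi Hphi').
assert (Gh : growth a (2 * t - 5 / 3) 0 h).
{ apply (growth_weaken a (2 * (t - 2 / 3) - 1 / 3) 0); [|lra|lra].
  apply (growth_div a f _ _ _ _ 0 HL Gh0), (growth_scal_cancel a 3 _ _ _ C3_neq_0).
  apply (growth_ext a _ _ (fun z => phi z - 6 * (g z * g z))%C); [|intros z; unfold phi; ring].
  apply growth_minus; [apply (growth_weaken a _ _ _ _ _ Gphi); lra|].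
  apply growth_scal, (growth_weaken a ((t - 2 / 3) + (t - 2 / 3)) 0); [apply Gprod; assumption|lra|lra]. }
set (phi1 := fun z => (phi' z - 2 * lam * phi z)%C).
assert (Gphi1 : growth a 0 0 phi1) by (apply growth_minus; [exact Gphi'|apply growth_scal, Gphi]).
assert (Hphi1 : forall z, phi1 z = (15 * (g z * h z) + f z * k z)%C).
{ intros z; unfold phi1, phi', phi, k.
  replace (f' z) with (g z + a / 3 * f z)%C by (unfold g; ring).
  replace (g' z) with (h z + lam * g z)%C by (unfold h; ring).
  field; apply C3_neq_0. }
(* In [5 h phi - 2 g phi1] the terms [30 g^2 h] cancel and a factor [f] splits off. The rate of this
   combination is at most [t - 2/3], so that of [psi] is at most [t - 1 < 0]. *)
set (psi := fun z => (15 * (h z * h z) - 2 * (g z * k z))%C).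
assert (Hpsi : forall z, (f z * psi z = 5 * (h z * phi z) - 2 * (g z * phi1 z))%C).
{ intros z; rewrite Hphi1; unfold psi, phi; ring. }
assert (Gpsi0 : growth a (1 / 3 + 1 / 3) 0 psi) by (apply growth_minus; apply growth_scal, Gprod; assumption).
assert (Gpsi : growth a (t - 2 / 3 - 1 / 3) 0 psi).
{ apply (growth_div a f _ _ _ _ 0 HL Gpsi0).
  apply (growth_ext a _ _ (fun z => 5 * (h z * phi z) - 2 * (g z * phi1 z))%C); [|intros z; symmetry; apply Hpsi].
  apply growth_minus; apply growth_scal.
  - apply (growth_weaken a (2 * t - 5 / 3 + 0) 0); [apply Gprod; assumption|lra|lra].
  - apply (growth_weaken a (t - 2 / 3 + 0) 0); [apply Gprod; assumption|lra|lra]. }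
assert (Hpsi0 : forall z, psi z = 0%C).
{ apply (growth_decay_zero a (t - 2 / 3 - 1 / 3) 0); [exact Ha|lra| |exact Gpsi].
  apply (growth_weaken a _ _ _ _ _ Gpsi); lra. }
(* With [psi = 0], [3 f^2 g phi1] equals [(15 / 2) f^2 h phi], of rate [2 t - 1 < t]. By [Hid1] it
   also contains [phi1 E^t] with a nonzero constant factor, so [phi1] vanishes. *)
assert (Hphi10 : forall z, phi1 z = 0%C).
{ assert (H : forall z, ((RtoC t - 1) * a * p2 * phi1 z)%C = 0%C).
  - set (mu := Rmax (2 * t - 1) (1 / 3)).
    assert (M1 : 2 * t - 1 <= mu) by apply Rmax_l; assert (M2 : 1 / 3 <= mu) by apply Rmax_r.
    assert (M3 : mu < t) by (apply Rmax_lub_lt; lra).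
    apply (leading_coeff_zero a t mu 0 (fun z => (RtoC t - 1) * a * p2 * phi1 z)%C Ha M3); [apply growth_scal, Gphi1|].
    apply (growth_ext a _ _ (fun z => RtoC (15 / 2) * (f z * (f z * (h z * phi z))) + (N' z - a * N z) * phi1 z)%C).
    + apply growth_plus.
      * apply growth_scal, (growth_weaken a (1 / 3 + (1 / 3 + (2 * t - 5 / 3 + 0))) 0); [|lra|lra].
        apply Gprod; [exact Hf|]; apply Gprod; [exact Hf|]; apply Gprod; assumption.
      * apply (growth_weaken a (1 / 3 + 0) 0); [|lra|lra]; apply Gprod; [|exact Gphi1].
        apply growth_minus; [exact GN'|apply growth_scal, GN].
    + intros z; assert (E1 := Hpsi z); rewrite Hpsi0, Cmult_0_r in E1.
      assert (E2 : (RtoC (15 / 2) * (h z * phi z) = 3 * (g z * phi1 z))%C).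
      { apply Ceq_minus; replace (RtoC (15 / 2)) with (RtoC 3 / RtoC 2 * RtoC 5)%C.
        - replace (RtoC 3 / RtoC 2 * RtoC 5 * (h z * phi z) - 3 * (g z * phi1 z))%C with (RtoC 3 / RtoC 2 * (5 * (h z * phi z) - 2 * (g z * phi1 z)))%C by (field; intros K; apply RtoC_inj in K; lra).
          rewrite <- E1; ring.
        - rewrite <- RtoC_div by lra; rewrite <- RtoC_mult; f_equal; field. }
      replace (RtoC (15 / 2) * (f z * (f z * (h z * phi z))) + (N' z - a * N z) * phi1 z)%C with
        (f z * f z * (RtoC (15 / 2) * (h z * phi z)) + (N' z - a * N z) * phi1 z)%C by ring.
      rewrite E2.
      replace ((RtoC t - 1) * a * p2 * phi1 z * cexp a t z)%C with
        (((RtoC t - 1) * a * p2 * cexp a t z - (N' z - a * N z)) * phi1 z + (N' z - a * N z) * phi1 z)%C by ring.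
      rewrite <- Hid1; ring.
  - intros z; apply (Cmult_integral_l _ _ (H z)), Cmult_neq_0; [apply Cmult_neq_0; [|exact Ha]|exact Hp2].
    rewrite <- RtoC_minus; intros K; apply RtoC_inj in K; lra. }
assert (Hphi0 : forall z, phi z = 0%C).
{ destruct (exp_ode phi phi' (2 * lam)%C Hphi') as [c Hc].
  { intros z; replace (phi' z) with (phi1 z + 2 * lam * phi z)%C by (unfold phi1; ring); rewrite Hphi10; ring. }
  assert (Hc2 : forall z, phi z = (c * cexp a (2 * t - 4 / 3) z)%C).
  { intros z; rewrite Hc; unfold cexp, lam; do 2 f_equal.
    replace (2 * t - 4 / 3) with (2 * (t - 2 / 3)) by field; rewrite RtoC_mult; ring. }
  assert (c = 0%C).
  { apply (leading_const_zero a c (2 * t - 4 / 3) 0 0 Ha ltac:(lra)).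
    exact (growth_ext a _ _ _ _ Gphi Hc2). }
  subst c; intros z; rewrite Hc; ring. }
assert (HLN : forall z, (N'' z - RtoC (1 + t) * a * N' z + RtoC t * (a * a) * N z = 0)%C).
{ intros z; assert (E := Hid2 z); rewrite Hphi0, Cmult_0_r in E.
  replace (N'' z - RtoC (1 + t) * a * N' z + RtoC t * (a * a) * N z)%C with (- - (N'' z - RtoC (1 + t) * a * N' z + RtoC t * (a * a) * N z))%C by ring.
  rewrite <- E; ring. }
(* The factors of [(D - a) (D - t a) N = 0] are treated one at a time; [E] and then [E^t] outgrow
   the rate 1/3 of [N], so both constants vanish. *)
assert (HN1 : forall z, (N' z = RtoC t * a * N z)%C).
{ destruct (exp_ode (fun z => N' z - RtoC t * a * N z)%C (fun z => N'' z - RtoC t * a * N' z)%C a) as [c Hc].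
  - apply has_deriv_minus; [exact HN''|apply has_deriv_scal, HN'].
  - intros z; apply Ceq_minus; rewrite <- (HLN z), RtoC_plus; ring.
  - assert (c = 0%C).
    { apply (leading_const_zero a c 1 (1 / 3) 0 Ha ltac:(lra)).
      apply (growth_ext a _ _ (fun z => N' z - RtoC t * a * N z)%C).
      - apply growth_minus; [exact GN'|apply growth_scal, GN].
      - intros z; rewrite Hc; unfold cexp; do 2 f_equal; ring. }
    subst c; intros z; apply Ceq_minus; rewrite Hc; ring. }
assert (HN0 : forall z, N z = 0%C).
{ destruct (exp_ode N N' (RtoC t * a)%C HN' HN1) as [c Hc].
  assert (c = 0%C).
  { apply (leading_const_zero a c t (1 / 3) 0 Ha ltac:(lra)).
    apply (growth_ext a _ _ _ _ GN); intros z; rewrite Hc; unfold cexp; do 2 f_equal; ring. }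
  subst c; intros z; rewrite Hc; ring. }
apply (cube_not_two_exponentials a t p1 p2 f f' Ha ltac:(lra) Hp1 Hp2 Hf').
intros z; rewrite <- Heq; fold (N z); rewrite HN0; ring.
Qed.

(** * Negative quotient *)

Lemma cexp_rescale (a : C) (t s : R) (z : C) : cexp (RtoC t * a) s z = cexp a (s * t) z.
Proof. unfold cexp; f_equal; rewrite RtoC_mult; ring. Qed.

Lemma poly_change_direction (a a' : C) (F : C -> C) : growth a 0 0 F -> growth a' 0 0 F.
Proof. intros H; destruct (growth_poly_growth a F H) as [m Hm]; exact (poly_growth_growth a' m F Hm). Qed.

Lemma exp_equation_swap (a : C) (t : R) (p1 p2 : C) (q f : C -> C) : t <> 0 ->
  exp_equation a t p1 p2 q f -> exp_equation (RtoC t * a) (/ t) p2 p1 q f.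
Proof.
intros Ht H z; rewrite H, !cexp_rescale, Rmult_1_l, Rinv_l by exact Ht; ring.
Qed.

Lemma fdiff_two_exp (a c1 c2 : C) (s t : R) (P f : C -> C) :
  (forall z, f z = c1 * cexp a s z + c2 * cexp a t z + P z)%C -> forall z,
  fdiff f z = (c1 * (Cexp (RtoC s * a) - 1) * cexp a s z + c2 * (Cexp (RtoC t * a) - 1) * cexp a t z + fdiff P z)%C.
Proof. intros H z; unfold fdiff; rewrite !H, !cexp_shift; ring. Qed.

(** All terms of the expanded equation except those in [E] and [E^(2/3)] are collected in [U]. Since
    [t < 0], their rates are at most [(2 + t) / 3] or [1 / 3], below 2/3. *)
Lemma top_coefficients (a : C) (t : R) (p1 p2 c1 c2 : C) (q f P : C -> C) : a <> 0%C -> t < 0 -> p1 <> 0%C ->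
  growth a 0 0 q -> growth a 0 0 P -> exp_equation a t p1 p2 q f ->
  (forall z, f z = c1 * cexp a (1 / 3) z + c2 * cexp a (t / 3) z + P z)%C ->
  (c1 * c1 * c1 = p1)%C /\ forall z, P z = 0%C.
Proof.
intros Ha Ht Hp1 Hq HP Heq Hf.
assert (Hd := fdiff_two_exp a c1 c2 _ _ P f Hf).
set (v1 := (Cexp (RtoC (1 / 3) * a) - 1)%C) in *; set (v2 := (Cexp (RtoC (t / 3) * a) - 1)%C) in *.
set (X := cexp a (1 / 3)) in *; set (Y := cexp a (t / 3)) in *.
assert (EX3 : forall z, cexp a 1 z = (X z * X z * X z)%C) by (intros z; apply cexp_third_cube).
assert (EY3 : forall z, cexp a t z = (Y z * Y z * Y z)%C) by (intros z; apply cexp_third_cube).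
assert (EX2 : forall z, cexp a (2 / 3) z = (X z * X z)%C) by (intros z; unfold X; rewrite cexp_mult; f_equal; field).
assert (EY2 : forall z, cexp a (2 * t / 3) z = (Y z * Y z)%C) by (intros z; unfold Y; rewrite cexp_mult; f_equal; field).
assert (EXXY : forall z, cexp a ((2 + t) / 3) z = (X z * X z * Y z)%C) by (intros z; unfold X, Y; rewrite !cexp_mult; f_equal; field).
assert (EXYY : forall z, cexp a ((1 + 2 * t) / 3) z = (X z * Y z * Y z)%C) by (intros z; unfold X, Y; rewrite !cexp_mult; f_equal; field).
assert (EXY : forall z, cexp a ((1 + t) / 3) z = (X z * Y z)%C) by (intros z; unfold X, Y; rewrite !cexp_mult; f_equal; field).
assert (HdP := growth_fdiff a 0 0 P HP).
assert (HPP := poly_mult a _ _ HP HP).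
set (mu := Rmax ((2 + t) / 3) (1 / 3)).
assert (M1 : (2 + t) / 3 <= mu) by apply Rmax_l; assert (M2 : 1 / 3 <= mu) by apply Rmax_r.
assert (M3 : mu < 2 / 3) by (apply Rmax_lub_lt; lra).
set (U := fun z => ((p2 - c2 * c2 * c2) * cexp a t z + - (3 * (c1 * c1) * c2) * cexp a ((2 + t) / 3) z
  + - (3 * c1 * (c2 * c2)) * cexp a ((1 + 2 * t) / 3) z + - (6 * c1 * c2) * P z * cexp a ((1 + t) / 3) z
  + (- (3 * c1) * (P z * P z) + - (c1 * v1) * q z) * cexp a (1 / 3) z
  + - (3 * (c2 * c2)) * P z * cexp a (2 * t / 3) z
  + (- (3 * c2) * (P z * P z) + - (c2 * v2) * q z) * cexp a (t / 3) z
  + (- (1) * (P z * (P z * P z)) + - (1) * (q z * fdiff P z)) * cexp a 0 z)%C).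
assert (HU : rgrowth a mu U).
{ unfold U; repeat (first [apply (rgrowth_plus a mu) | apply (rgrowth_term a mu); [lra|] | apply (growth_plus a 0 0)
    | apply (growth_scal a _ 0 0) | exact HP | exact HPP | exact Hq | apply growth_const | apply (poly_mult a _ _ HP HPP) | apply (poly_mult a _ _ Hq HdP)]). }
assert (Hexp : forall z, ((c1 * c1 * c1 - p1) * cexp a 1 z + 3 * (c1 * c1) * P z * cexp a (2 / 3) z = U z)%C).
{ intros z; assert (E := Heq z); unfold U; rewrite cexp_0, EX2, EY2, EXXY, EXYY, EXY; rewrite EX3, EY3 in *; fold X Y.
  rewrite Hd, Hf in E.
  apply Ceq_minus in E; apply Ceq_minus; rewrite <- E; ring. }
assert (Hc3 : (c1 * c1 * c1 = p1)%C).
{ apply Ceq_minus.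
  assert (HU1 : rgrowth a (2 / 3) U) by (destruct HU as [B HB]; exists B; apply (growth_weaken a _ _ _ _ _ HB); lra).
  assert (HT : rgrowth a (2 / 3) (fun z => - (3 * (c1 * c1)) * P z * cexp a (2 / 3) z)%C).
  { apply rgrowth_term; [lra|apply growth_scal, HP]. }
  destruct (rgrowth_plus a _ _ _ HU1 HT) as [B HB].
  apply (leading_const_zero a _ 1 (2 / 3) B Ha ltac:(lra)).
  apply (growth_ext a _ _ _ _ HB); intros z; rewrite <- Hexp; ring. }
split; [exact Hc3|].
assert (Hc := cube_neq_0 c1 p1 Hc3 Hp1).
destruct HU as [B HB].
assert (H : forall z, (3 * (c1 * c1) * P z)%C = 0%C).
{ apply (leading_coeff_zero a (2 / 3) mu B (fun z => 3 * (c1 * c1) * P z)%C Ha M3); [apply growth_scal, HP|].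
  apply (growth_ext a _ _ _ _ HB); intros z; rewrite <- Hexp, Hc3; ring. }
intros z; apply (Cmult_integral_l _ _ (H z)), Cmult_neq_0; [apply C3_neq_0|apply Cmult_neq_0; exact Hc].
Qed.

(** After the cubes cancel, the terms in [X^2 Y] and [X] lead, with rates [(2 + t) / 3] and [1 / 3].
    For [t > -1] the first would lead alone with a nonzero coefficient; for [t = -1] the two
    coincide and their coefficients cancel. *)
Lemma mixed_coefficients (a : C) (t : R) (p1 p2 c1 c2 : C) (q f : C -> C) : a <> 0%C -> t < 0 -> p1 <> 0%C -> p2 <> 0%C ->
  growth a 0 0 q -> exp_equation a t p1 p2 q f ->
  (forall z, f z = c1 * cexp a (1 / 3) z + c2 * cexp a (t / 3) z)%C ->
  (c1 * c1 * c1 = p1)%C -> (c2 * c2 * c2 = p2)%C ->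
  t <= -1 /\ (t = -1 -> forall z, (3 * c1 * c2 + q z * (Cexp (RtoC (1 / 3) * a) - 1) = 0)%C).
Proof.
intros Ha Ht Hp1 Hp2 Hq Heq Hf Hc1 Hc2.
assert (N1 := cube_neq_0 c1 p1 Hc1 Hp1); assert (N2 := cube_neq_0 c2 p2 Hc2 Hp2).
assert (Hd := fdiff_two_exp a c1 c2 (1 / 3) (t / 3) (fun _ => RtoC 0) f (fun z => eq_trans (Hf z) (eq_sym (Cplus_0_r _)))).
set (v1 := (Cexp (RtoC (1 / 3) * a) - 1)%C) in *; set (v2 := (Cexp (RtoC (t / 3) * a) - 1)%C) in *.
set (X := cexp a (1 / 3)) in *; set (Y := cexp a (t / 3)) in *.
assert (EX3 : forall z, cexp a 1 z = (X z * X z * X z)%C) by (intros z; apply cexp_third_cube).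
assert (EY3 : forall z, cexp a t z = (Y z * Y z * Y z)%C) by (intros z; apply cexp_third_cube).
assert (EXXY : forall z, cexp a ((2 + t) / 3) z = (X z * X z * Y z)%C) by (intros z; unfold X, Y; rewrite !cexp_mult; f_equal; field).
assert (EXYY : forall z, cexp a ((1 + 2 * t) / 3) z = (X z * Y z * Y z)%C) by (intros z; unfold X, Y; rewrite !cexp_mult; f_equal; field).
assert (Hexp : forall z, (3 * (c1 * c1) * c2 * cexp a ((2 + t) / 3) z + c1 * v1 * q z * X z
   = - (3 * c1 * (c2 * c2)) * cexp a ((1 + 2 * t) / 3) z + - (c2 * v2) * q z * Y z)%C).
{ intros z; assert (E := Heq z); rewrite EX3, EY3, Hd, Hf in E; unfold fdiff in E; fold X Y in E.
  rewrite EXXY, EXYY, <- Hc1, <- Hc2 in *.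
  apply Ceq_minus in E; apply Ceq_minus; rewrite <- E; ring. }
assert (N : (3 * (c1 * c1) * c2)%C <> 0%C).
{ apply Cmult_neq_0; [apply Cmult_neq_0; [apply C3_neq_0|apply Cmult_neq_0; exact N1]|exact N2]. }
assert (HR : forall mu, (1 + 2 * t) / 3 <= mu -> t / 3 <= mu ->
  rgrowth a mu (fun z => - (3 * c1 * (c2 * c2)) * cexp a ((1 + 2 * t) / 3) z + - (c2 * v2) * q z * Y z)%C).
{ intros mu H1 H2; apply rgrowth_plus; apply rgrowth_term; try assumption; [apply growth_const|apply growth_scal, Hq]. }
split.
- apply Rnot_lt_le; intros Hlt; apply N.
  set (mu := Rmax (1 / 3) ((1 + 2 * t) / 3)).
  assert (M1 : 1 / 3 <= mu) by apply Rmax_l; assert (M2 : (1 + 2 * t) / 3 <= mu) by apply Rmax_r.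
  assert (M3 : mu < (2 + t) / 3) by (apply Rmax_lub_lt; lra).
  assert (HX : rgrowth a mu (fun z => - (c1 * v1) * q z * X z)%C) by (apply rgrowth_term; [exact M1|apply growth_scal, Hq]).
  destruct (rgrowth_plus a _ _ _ (HR mu M2 ltac:(lra)) HX) as [B HB].
  apply (leading_const_zero a _ ((2 + t) / 3) mu B Ha M3).
  apply (growth_ext a _ _ _ _ HB); intros z; cbv beta; rewrite <- Hexp; ring.
- intros Ht1.
  destruct (HR (- / 3) ltac:(lra) ltac:(lra)) as [B HB].
  assert (HG : growth a 0 0 (fun z => c1 * (3 * c1 * c2 + q z * v1))%C).
  { apply growth_scal; apply (growth_plus a 0 0 (fun _ => 3 * c1 * c2)%C); [apply growth_const|].
    apply (growth_ext a 0 0 (fun z => v1 * q z)%C); [apply growth_scal, Hq|intros z; ring]. }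
  assert (H : forall z, (c1 * (3 * c1 * c2 + q z * v1))%C = 0%C).
  { apply (leading_coeff_zero a (1 / 3) (- / 3) B _ Ha ltac:(lra) HG).
    apply (growth_ext a _ _ _ _ HB); intros z; cbv beta; rewrite <- Hexp.
    replace ((2 + t) / 3) with (1 / 3) by (rewrite Ht1; field); fold X; ring. }
  intros z; exact (Cmult_integral_l _ _ (H z) N1).
Qed.

(** Each exponential governs one half-plane. [M], the image of [f] under
    [(D - a / 3) (D - t a / 3)], is controlled on the right by the estimate for [a] and on the left
    by that for [t a]; together they give polynomial growth on the whole plane. *)
Lemma negative_quotient (a : C) (t b b' : R) (p1 p2 : C) (q f : C -> C) : a <> 0%C -> t < 0 -> p1 <> 0%C -> p2 <> 0%C ->
  growth a 0 0 q -> growth a (1 / 3) b f -> growth (RtoC t * a) (1 / 3) b' f -> exp_equation a t p1 p2 q f ->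
  t = -1 /\ exists c1 c2, (forall z, f z = c1 * cexp a (1 / 3) z + c2 * cexp a (t / 3) z)%C /\
    (c1 * c1 * c1 = p1)%C /\ (c2 * c2 * c2 = p2)%C /\
    forall z, (3 * c1 * c2 + q z * (Cexp (RtoC (1 / 3) * a) - 1) = 0)%C /\
      (3 * c1 * c2 + q z * (Cexp (RtoC (- / 3) * a) - 1) = 0)%C.
Proof.
intros Ha Ht Hp1 Hp2 Hq Hf Hf2 Heq.
assert (Ht0 : RtoC t <> 0%C) by (intros K; apply RtoC_inj in K; lra).
assert (Hti : / t < 0) by (apply Rinv_lt_0_compat, Ht).
set (a2 := (RtoC t * a)%C) in *.
assert (Ha2 : a2 <> 0%C) by (apply Cmult_neq_0; assumption).
assert (Heq2 := exp_equation_swap a t p1 p2 q f ltac:(lra) Heq); fold a2 in Heq2.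
assert (Hq2 := poly_change_direction a a2 q Hq).
assert (Hf3 := Hf); destruct Hf3 as [[f' Hf'] _].
destruct (deriv_has_deriv f f' Hf') as [f'' Hf''].
assert (G1 := first_order_growth a t b p1 p2 q f f' ltac:(lra) Hp1 Hq Hf Heq Hf').
assert (G2 := first_order_growth a2 (/ t) b' p2 p1 q f f' ltac:(lra) Hp2 Hq2 Hf2 Heq2 Hf').
rewrite Rmax_right in G1, G2 by lra.
assert (D1 : has_deriv (fun z => f' z - a / 3 * f z)%C (fun z => f'' z - a / 3 * f' z)%C).
{ apply has_deriv_minus; [exact Hf''|apply has_deriv_scal, Hf']. }
assert (D2 : has_deriv (fun z => f' z - a2 / 3 * f z)%C (fun z => f'' z - a2 / 3 * f' z)%C).
{ apply has_deriv_minus; [exact Hf''|apply has_deriv_scal, Hf']. }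
set (M := fun z => (f'' z - a / 3 * f' z - a2 / 3 * (f' z - a / 3 * f z))%C).
assert (K1 : growth a (1 / 3 - 2 / 3) b M).
{ apply growth_minus; [exact (growth_deriv a _ _ _ _ G1 D1)|apply growth_scal, G1]. }
assert (K2 : growth a2 (1 / 3 - 2 / 3) b' M).
{ apply (growth_ext a2 _ _ (fun z => f'' z - a2 / 3 * f' z - a / 3 * (f' z - a2 / 3 * f z))%C).
  - apply growth_minus; [exact (growth_deriv a2 _ _ _ _ G2 D2)|apply growth_scal, G2].
  - intros z; unfold M; ring. }
assert (KM : growth a 0 0 M).
{ destruct K1 as [HM [L1 [m1 [HL1 H1]]]]; destruct K2 as [_ [L2 [m2 [HL2 H2]]]].
  split; [exact HM|]; exists (L1 + L2), (m1 + m2)%nat; split; [lra|]; intros z.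
  replace (weight a 0 0 z) with 1 by (unfold weight; rewrite !Rmult_0_l, Rplus_0_l, exp_0; reflexivity).
  rewrite Rmult_1_r; assert (Hz := one_plus_Cmod z); set (r := 1 + Cmod z) in *.
  assert (R1 := pow_ge_1 r m1 Hz); assert (R2 := pow_ge_1 r m2 Hz).
  assert (I1 : L1 * r ^ m1 <= (L1 + L2) * r ^ (m1 + m2)).
  { rewrite pow_add; apply Rmult_le_compat; [exact HL1|lra|lra|nra]. }
  assert (I2 : L2 * r ^ m2 <= (L1 + L2) * r ^ (m1 + m2)).
  { rewrite pow_add; apply Rmult_le_compat; [exact HL2|lra|lra|nra]. }
  assert (Hexp : forall x, 0 <= x -> exp ((1 / 3 - 2 / 3) * x) <= 1) by (intros x Hx; apply Rle_trans with (exp 0); [apply exp_le; lra|right; apply exp_0]).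
  destruct (Rle_lt_dec 0 (Re (a * z))) as [Hx|Hx].
  - specialize (H1 z); rewrite weight_right in H1 by exact Hx; fold r in H1.
    assert (E := Hexp _ Hx); assert (0 <= L1 * r ^ m1) by (apply Rmult_le_pos; lra); nra.
  - assert (Hx2 : 0 <= Re (a2 * z)).
    { unfold a2; rewrite <- Cmult_assoc, re_scal_l; nra. }
    specialize (H2 z); rewrite weight_right in H2 by exact Hx2; fold r in H2.
    assert (E := Hexp _ Hx2); assert (0 <= L2 * r ^ m2) by (apply Rmult_le_pos; lra); nra. }
assert (Ha3 : forall c : C, c <> 0%C -> (c / 3)%C <> 0%C).
{ intros c Hc E; apply Hc; replace c with (c / 3 * 3)%C by (field; apply C3_neq_0); rewrite E; ring. }
destruct (affine_exp_ode a (a2 / 3) _ _ M (Ha3 _ Ha2) KM D1 (fun z => eq_refl)) as [c [P1 [HP1 E1]]].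
assert (Hdiff : (a2 - a)%C <> 0%C).
{ unfold a2; replace (RtoC t * a - a)%C with (RtoC (t - 1) * a)%C by (rewrite RtoC_minus; ring).
  apply Cmult_neq_0; [intros K; apply RtoC_inj in K; lra|exact Ha]. }
(* The particular solution of [F' - (a / 3) F = c e^(a2 z / 3)] has this coefficient; subtracting it
   from [f] leaves a polynomial right-hand side. *)
set (c2 := (3 * c / (a2 - a))%C).
destruct (affine_exp_ode a (a / 3) (fun z => f z - c2 * Cexp (a2 / 3 * z))%C
  (fun z => f' z - c2 * (a2 / 3 * Cexp (a2 / 3 * z)))%C P1 (Ha3 _ Ha) HP1) as [c1 [P [HP E2]]].
{ apply has_deriv_minus; [exact Hf'|apply has_deriv_scal, has_deriv_exp]. }
{ intros z; replace (f' z) with (a / 3 * f z + (f' z - a / 3 * f z))%C by ring; rewrite E1.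
  unfold c2; field; exact Hdiff. }
assert (Ecexp : forall z, cexp a (1 / 3) z = Cexp (a / 3 * z)).
{ intros z; unfold cexp; f_equal; rewrite RtoC_div by lra; field; apply C3_neq_0. }
assert (Ecexp2 : forall z, cexp a (t / 3) z = Cexp (a2 / 3 * z)).
{ intros z; unfold cexp, a2; f_equal; rewrite RtoC_div by lra; field; apply C3_neq_0. }
assert (Ef : forall z, f z = (c1 * cexp a (1 / 3) z + c2 * cexp a (t / 3) z + P z)%C).
{ intros z; rewrite Ecexp, Ecexp2.
  replace (f z) with (c2 * Cexp (a2 / 3 * z) + (f z - c2 * Cexp (a2 / 3 * z)))%C by ring; rewrite E2; ring. }
assert (Es1 : forall z, cexp a2 (1 / 3) z = cexp a (t / 3) z).
{ intros z; unfold a2; rewrite cexp_rescale; f_equal; field. }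
assert (Es2 : forall z, cexp a2 (/ t / 3) z = cexp a (1 / 3) z).
{ intros z; unfold a2; rewrite cexp_rescale; f_equal; field; lra. }
destruct (top_coefficients a t p1 p2 c1 c2 q f P Ha Ht Hp1 Hq HP Heq Ef) as [Hc1 HP0].
destruct (top_coefficients a2 (/ t) p2 p1 c2 c1 q f P Ha2 Hti Hp2 Hq2 (poly_change_direction a a2 P HP) Heq2) as [Hc2 _].
{ intros z; rewrite Es1, Es2, Ef; ring. }
assert (Ef0 : forall z, f z = (c1 * cexp a (1 / 3) z + c2 * cexp a (t / 3) z)%C).
{ intros z; rewrite Ef, HP0; ring. }
destruct (mixed_coefficients a t p1 p2 c1 c2 q f Ha Ht Hp1 Hp2 Hq Heq Ef0 Hc1 Hc2) as [L1 Q1].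
destruct (mixed_coefficients a2 (/ t) p2 p1 c2 c1 q f Ha2 Hti Hp2 Hp1 Hq2 Heq2) as [L2 Q2]; [|exact Hc2|exact Hc1|].
{ intros z; rewrite Es1, Es2, Ef0; ring. }
(* The previous lemma, applied in both directions, gives [t <= -1] and [1 / t <= -1]. *)
assert (Ht1 : t = -1).
{ apply (Rmult_le_compat_neg_l t) in L2; [|lra]; rewrite Rinv_r in L2; lra. }
split; [exact Ht1|]; exists c1, c2; split; [exact Ef0|]; split; [exact Hc1|]; split; [exact Hc2|].
intros z; split; [exact (Q1 Ht1 z)|].
assert (Q2z := Q2 ltac:(rewrite Ht1; field) z).
replace (RtoC (- / 3) * a)%C with (RtoC (1 / 3) * a2)%C.
- rewrite <- Q2z; ring.
- unfold a2; rewrite Ht1, Cmult_assoc, <- RtoC_mult; do 2 f_equal; field.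
Qed.

(** * The classification *)

(** The hypothesis says that [Re (a1 z)] does not drift along the zeros of the right-hand side,
    which are spaced by [2 pi i / (a1 - a2)]. It makes [s = a1 / (a1 - a2)] real, and
    [t = 1 - 1 / s]. *)
Lemma real_quotient_exists (a1 a2 : C) : a1 <> 0%C -> a2 <> 0%C -> a1 <> a2 -> Re (a1 * Ci / (a1 - a2)) = 0 ->
  exists t, t <> 0 /\ t <> 1 /\ a2 = (RtoC t * a1)%C.
Proof.
intros H1 H2 H12 HR.
assert (Hd : (a1 - a2)%C <> 0%C) by (apply Cminus_eq_contra, H12).
set (rho := (a1 / (a1 - a2))%C).
assert (Him : Im rho = 0).
{ replace (a1 * Ci / (a1 - a2))%C with (rho * Ci)%C in HR by (unfold rho; field; exact Hd).
  rewrite re_mult_Ci in HR; lra. }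
set (s := Re rho).
assert (Es : a1 = (RtoC s * (a1 - a2))%C).
{ replace (RtoC s) with rho; [unfold rho; field; exact Hd|].
  rewrite (surjective_pairing rho); unfold RtoC; f_equal; exact Him. }
assert (Hs : s <> 0) by (intros E; apply H1; rewrite Es, E; ring).
assert (Hs2 : RtoC s <> 0%C) by (intros E; apply RtoC_inj in E; auto).
assert (Et : a2 = (RtoC (1 - / s) * a1)%C).
{ rewrite RtoC_minus, RtoC_inv by exact Hs.
  replace a2 with (a1 - / RtoC s * (RtoC s * (a1 - a2)))%C at 1 by (field; exact Hs2).
  rewrite <- Es; ring. }
exists (1 - / s); split; [|split]; [| |exact Et].
- intros E; apply H2; rewrite Et, E; ring.
- intros E; apply H12; rewrite Et, E; ring.
Qed.

Lemma Cexp_third (a z : C) : Cexp (a * z / RtoC 3) = cexp a (1 / 3) z.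
Proof. unfold cexp; f_equal; rewrite RtoC_div by lra; field; apply C3_neq_0. Qed.

Lemma positive_quotient (a : C) (t : R) (p1 p2 : C) (q f : C -> C) : a <> 0%C -> 0 < t < 1 -> p1 <> 0%C -> p2 <> 0%C ->
  growth a 0 0 q -> growth a (1 / 3) 0 f -> exp_equation a t p1 p2 q f ->
  exists c, (forall z, q z = c) /\ exists c1,
    (forall z, f z = (c1 * Cexp (a * z / RtoC 3))%C) /\ (c1 * c1 * c1 = p1)%C /\
    (c1 * (Cexp (a / RtoC 3) - 1) * c = p2)%C /\ a = (RtoC 3 * (RtoC t * a))%C.
Proof.
intros Ha Ht Hp1 Hp2 Hq Hf Heq.
destruct (Rle_lt_dec t (2 / 3)) as [Ht2|Ht2].
2:{ exfalso; exact (large_quotient a t p1 p2 q f Ha ltac:(lra) Hp1 Hp2 Hq Hf Heq). }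
destruct (small_quotient a t p1 p2 q f Ha ltac:(lra) Hp1 Hp2 Hq Hf Heq) as [Ht3 [c1 [Ef [Hc1 Eq]]]].
(* The relation [k * q z = p2] with [p2] nonzero makes [k] nonzero and thereby [q] constant. *)
set (k := (c1 * (Cexp (a / 3) - 1))%C) in *.
assert (Hk : k <> 0%C) by (intros E; apply Hp2; rewrite <- (Eq (RtoC 0)), E; ring).
exists (p2 / k)%C; split.
- intros z; rewrite <- (Eq z); field; exact Hk.
- exists c1; split; [intros z; rewrite Cexp_third; apply Ef|]; split; [exact Hc1|]; split.
  + fold k; field; exact Hk.
  + rewrite Ht3, RtoC_div by lra; field; apply C3_neq_0.
Qed.

Theorem theorem1p1 (q f : C -> C) (p1 p2 a1 a2 : C) :
  is_polynomial q ->
  p1 <> 0%C -> p2 <> 0%C -> a1 <> 0%C -> a2 <> 0%C -> a1 <> a2 ->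
  entire f ->
  Rbar_lt (hyper_order f) (Finite 1) ->
  (forall z : C,
     (f z * f z * f z + q z * fdiff f z)%C =
     (p1 * Cexp (a1 * z) + p2 * Cexp (a2 * z))%C) ->
  exists c : C, (forall z : C, q z = c) /\
   ( (exists e1 e2 : C, e1 <> 0%C /\ e2 <> 0%C /\
        (forall z, f z = (e1 * Cexp (a1 * z / RtoC 3) + e2 * Cexp (a2 * z / RtoC 3))%C) /\
        (((e1 * e1 * e1 = p1)%C /\ (e2 * e2 * e2 = p2)%C) \/
         ((e1 * e1 * e1 = p2)%C /\ (e2 * e2 * e2 = p1)%C)) /\
        (RtoC 3 * e1 * e2 - RtoC 2 * c = 0)%C /\
        (a1 + a2 = 0)%C /\
        Cexp (a1 / RtoC 3) = (- 1)%C)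
   \/ (exists c1 : C,
        (forall z, f z = (c1 * Cexp (a1 * z / RtoC 3))%C) /\
        (c1 * c1 * c1 = p1)%C /\
        (c1 * (Cexp (a1 / RtoC 3) - 1) * c = p2)%C /\
        a1 = (RtoC 3 * a2)%C)
   \/ (exists c2 : C,
        (forall z, f z = (c2 * Cexp (a2 * z / RtoC 3))%C) /\
        (c2 * c2 * c2 = p2)%C /\
        (c2 * (Cexp (a2 / RtoC 3) - 1) * c = p1)%C /\
        a2 = (RtoC 3 * a1)%C)).
Proof.
intros Hq Hp1 Hp2 Ha1 Ha2 Ha12 Hf Hho Heq.
assert (Hfd : has_derivative f) by exact (entire_has_deriv f Hf).
assert (Gq : forall a, growth a 0 0 q) by (intros a; apply growth_polynomial, Hq).
assert (Hqm := growth_poly_growth _ _ (Gq (RtoC 1))).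
assert (HR := nonreal_quotient_contradiction q f p1 p2 a1 a2 Hqm Hfd Hho Hp1 Hp2 Ha12 Heq).
destruct (real_quotient_exists a1 a2 Ha1 Ha2 Ha12 HR) as [t [Ht0 [Ht1 Et]]].
assert (Hti : RtoC t <> 0%C) by (intros K; apply RtoC_inj in K; auto).
destruct (solution_bound q f (fun z => p1 * Cexp (a1 * z) + p2 * Cexp (a2 * z))%C a1 a2 (Cmod p1 + Cmod p2) Hqm Hfd Hho) with (3 := Heq) as [K [m [HK Hb]]].
{ apply Rplus_le_le_0_compat; apply Cmod_ge_0. }
{ intros z; apply two_exp_weight_cube. }
assert (Et2 : a1 = (RtoC (/ t) * a2)%C) by (rewrite Et, RtoC_inv by exact Ht0; field; exact Hti).
assert (Heq1 : exp_equation a1 t p1 p2 q f).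
{ intros z; rewrite Heq, Et; unfold cexp; do 2 f_equal; f_equal; ring. }
assert (Heq2 : exp_equation a2 (/ t) p2 p1 q f).
{ rewrite Et; apply exp_equation_swap; assumption. }
assert (Gf1 : t <= 1 -> growth a1 (1 / 3) (Rmax 0 (- t / 3)) f).
{ intros Hle; apply (growth_of_bound a1 t K m f Hle Hfd HK); intros z; rewrite <- Et; apply Hb. }
assert (Gf2 : / t <= 1 -> growth a2 (1 / 3) (Rmax 0 (- / t / 3)) f).
{ intros Hle; apply (growth_of_bound a2 (/ t) K m f Hle Hfd HK); intros z; rewrite <- Et2.
  apply (Rle_trans _ _ _ (Hb z)), Req_le; unfold two_exp_weight; ring. }
destruct (Rlt_le_dec t 0) as [Hneg|Hpos].
- assert (Hti0 : / t < 0) by (apply Rinv_lt_0_compat, Hneg).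
  assert (G2 := Gf2 ltac:(lra)); rewrite Et in G2.
  destruct (negative_quotient a1 t _ _ p1 p2 q f Ha1 Hneg Hp1 Hp2 (Gq a1) (Gf1 ltac:(lra)) G2 Heq1) as [Htm [c1 [c2 [Ef [Hc1 [Hc2 HE]]]]]].
  assert (N1 := cube_neq_0 c1 p1 Hc1 Hp1); assert (N2 := cube_neq_0 c2 p2 Hc2 Hp2).
  set (w1 := Cexp (RtoC (1 / 3) * a1)) in *; set (w2 := Cexp (RtoC (- / 3) * a1)) in *.
  assert (Hw : (w1 * w2 = 1)%C).
  { unfold w1, w2; rewrite <- Cexp_plus, <- Cexp_0; f_equal.
    replace (- / 3) with (- (1 / 3)) by field; rewrite RtoC_opp; ring. }
  assert (N : (3 * c1 * c2)%C <> 0%C) by (apply Cmult_neq_0; [apply Cmult_neq_0; [apply C3_neq_0|exact N1]|exact N2]).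
  assert (Hw1 : w1 <> 1%C).
  { intros E; destruct (HE (RtoC 0)) as [E1 _]; rewrite E in E1; apply N; rewrite <- E1; ring. }
  assert (Hq0 : q (RtoC 0) <> 0%C).
  { intros E; destruct (HE (RtoC 0)) as [E1 _]; rewrite E in E1; apply N; rewrite <- E1; ring. }
  (* Subtracting the two relations in [HE] gives equality; with [w1 * w2 = 1] and [w1 <> 1] this
     leaves [w1 = - 1]. *)
  assert (Hww : w1 = w2).
  { apply Ceq_minus, (Cmult_integral_l (q (RtoC 0))); [|exact Hq0].
    destruct (HE (RtoC 0)) as [E1 E2].
    replace (q (RtoC 0) * (w1 - w2))%C with ((3 * c1 * c2 + q (RtoC 0) * (w1 - 1)) - (3 * c1 * c2 + q (RtoC 0) * (w2 - 1)))%C by ring.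
    rewrite E1, E2; ring. }
  assert (Hwm : w1 = (- 1)%C).
  { apply Ceq_minus, (Cmult_integral_l (w1 - 1)); [|apply Cminus_eq_contra, Hw1].
    replace ((w1 - 1) * (w1 - - 1))%C with (w1 * w1 - 1)%C by ring; rewrite Hww at 2; rewrite Hw; ring. }
  (* The value of [q] read off from [3 c1 c2 + q (w1 - 1) = 0] at [w1 = - 1]. *)
  exists (3 * c1 * c2 / 2)%C.
  assert (H2 : RtoC 2 <> 0%C) by (intros E; apply RtoC_inj in E; lra).
  split.
  + intros z; destruct (HE z) as [E1 _]; rewrite Hwm in E1.
    replace (3 * c1 * c2)%C with (3 * c1 * c2 + q z * (- 1 - 1) + 2 * q z)%C by ring; rewrite E1; field; exact H2.
  + left; exists c1, c2; split; [exact N1|]; split; [exact N2|]; split; [|split; [|split; [|split]]].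
    * intros z; rewrite !Cexp_third, Et, cexp_rescale, Ef; do 3 f_equal; field.
    * left; split; assumption.
    * field; exact H2.
    * rewrite Et, Htm; replace (RtoC (-1)) with (- RtoC 1)%C by (symmetry; apply RtoC_opp); ring.
    * rewrite <- Hwm; unfold w1; f_equal; rewrite RtoC_div by lra; field; apply C3_neq_0.
- destruct (Rlt_le_dec t 1) as [Hlt|Hge].
  + assert (G1 := Gf1 ltac:(lra)); rewrite Rmax_left in G1 by lra.
    destruct (positive_quotient a1 t p1 p2 q f Ha1 ltac:(lra) Hp1 Hp2 (Gq a1) G1 Heq1) as [c [Hc Hrest]].
    exists c; split; [exact Hc|]; right; left; rewrite <- Et in Hrest; exact Hrest.
  (* For [t > 1] the frequencies exchange roles and the quotient becomes [/ t], which leads to the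
     third alternative. *)
  + assert (Hi0 : 0 < / t) by (apply Rinv_0_lt_compat; lra).
    assert (Hi1 : / t < 1) by (rewrite <- Rinv_1; apply Rinv_lt_contravar; lra).
    assert (G2 := Gf2 ltac:(lra)); rewrite Rmax_left in G2 by lra.
    destruct (positive_quotient a2 (/ t) p2 p1 q f Ha2 ltac:(lra) Hp2 Hp1 (Gq a2) G2 Heq2) as [c [Hc Hrest]].
    exists c; split; [exact Hc|]; right; right; rewrite <- Et2 in Hrest; exact Hrest.
Qed.
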